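(* Let $\beta\in(0,1)$. An expected $(\epsilon_1,\epsilon_2)$-stationary point, i.e. a random point $\bar w$ with $\mathbb{E}[\operatorname{dist}(0,\partial_{\epsilon_1}f(\bar w))]\le\epsilon_2$, can be computed by PISGD (with $S=\lceil K^{1-\beta}\rceil$, $\sigma=\theta\sqrt d K^{-\beta}$, $\eta=\frac{\theta}{L_0}K^{-\beta}$ for a fixed $\theta>0$ and a suitable $K\in\mathbb{Z}_{>0}$) with $$O\left(\max\left(\epsilon_1^{\frac{\beta-2}{\beta}},\ \epsilon_2^{-2\frac{2-\beta}{1-\beta}}\right)\right)$$ gradient calls.
   Context: Setting. $(\Omega,\mathcal{F},P)$ is a probability space, $\xi:\Omega\to\mathbb{R}^p$ is a random vector with law $P_\xi$. $F:\mathbb{R}^d\times\mathbb{R}^p\to\mathbb{R}$ is a Carathéodory function: for each $w\in\mathbb{R}^d$, $F(w,\cdot)$ is Borel measurable, and for each $\xi\in\mathbb{R}^p$, $F(\cdot,\xi)$ is continuous. For all $\xi$ outside a Borel $P_\xi$-null set, $F(\cdot,\xi)$ is $C(\xi)$-Lipschitz continuous (Euclidean norm), and $Q:=\mathbb{E}[C(\xi)^2]<\infty$. The objective $f(w):=\mathbb{E}_\xi[F(w,\xi)]$ is real-valued and is $L_0$-Lipschitz continuous with $L_0:=\mathbb{E}[C(\xi)]$, $L_0>0$; $f$ attains its global minimum at some $x^*$, and $\Delta:=f(x^1)-f(x^* )$. Approximate stochastic gradient: a Borel measurable function $\widetilde{\nabla}F:\mathbb{R}^{d+p}\to\mathbb{R}^d$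 which equals the gradient $\nabla_wF(w,\xi)$ at almost every point (with respect to $m^d\times P_\xi$, $m^d$ Lebesgue measure) where it exists. A gradient call is one evaluation of $\widetilde{\nabla}F(w,\xi)$; the number of gradient calls of PISGD is counted by its upper bound $(K-1)S$. $B(\sigma)=\{z\in\mathbb{R}^d:\|z\|_2\le\sigma\}$ and $U(B(\sigma))$ is the uniform distribution on it. $\partial f(w)$ is the Clarke subdifferential and $\partial_\epsilon f(w):=\mathrm{co}\{\partial f(\hat w):\hat w\in w+B(\epsilon)\}$ is the Clarke $\epsilon$-subdifferential. PISGD, input $x^1\in\mathbb{R}^d$, $K,S\in\mathbb{Z}_{>0}$, $\eta,\sigma>0$: draw $R$ uniformly from $\{1,\dots,K\}$; for $k=1,\dots,R-1$: sample $z^k_l\sim U(B(\sigma))$ and $\xi^k_l\sim P_\xi$ for $l=1,\dots,S$, set $w^k_l=x^k+z^k_l$, and $x^{k+1}=x^k-\frac{\eta}{S}\sum_{l=1}^S\widetilde{\nabla}F(w^k_l,\xi^k_l)$. Output $x^R$. All sampling is done independently. The $O(\cdot)$ is as $\epsilon_1,\epsilon_2\to0$, with constants independent of $\epsilon_1,\epsilon_2$ (they may depend on $\beta,\theta,d,L_0,\Delta,Q$). *)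

(* Defs.v *)
From HB Require Import structures.
From mathcomp Require Import all_boot all_order all_algebra.
From mathcomp Require Import all_classical all_reals all_analysis.
From mathcomp Require Import measurable_realfun.

Set Implicit Arguments.
Unset Strict Implicit.
Unset Printing Implicit Defensive.

Import Order.TTheory GRing.Theory Num.Theory.
Import numFieldNormedType.Exports.

Local Open Scope classical_set_scope.
Local Open Scope ring_scope.

HB.instance Definition _ (R : realType) (n : nat) :=
  @isMeasurable.Build (sigma_display (@open 'rV[R]_n)) 'rV[R]_n
    <<s @open 'rV[R]_n >>
    (@sigma_algebra0 _ setT _) (@sigma_algebraC _ _)
    (@sigma_algebra_bigcup _ setT _).

Section lebesgue.
Variable R : realType.

Definition cons_rV (n : nat) (u : 'rV[R]_n * measurableTypeR R) : 'rV[R]_n.+1 :=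
  \row_i oapp (u.1 0) (u.2 : R) (unlift ord0 i).

Definition rat_ball (n : nat) (q : 'rV[rat]_n * nat) : set 'rV[R]_n :=
  ball (map_mx ratr q.1 : 'rV[R]_n) q.2.+1%:R^-1.

Lemma rat_ball_basis (n : nat) (A : set 'rV[R]_n) : open A ->
  A = \bigcup_(q in [set q | rat_ball q `<=` A]) rat_ball q.
Proof.
move=> oA; apply/seteqP; split; last by move=> x [q /= qA] /qA.
move=> x Ax.
have /nbhs_ballP[e /= e0 xeA] : nbhs x A by apply: open_nbhs_nbhs.
have [N Ne] : exists N : nat, N.+1%:R^-1 < e / 2.
  have [N _ /(_ N (leqnn _))] :=
    near_infty_natSinv_lt (PosNum (divr_gt0 e0 (ltr0Sn R 1))).
  by exists N.
have N0 : (0 : R) < N.+1%:R^-1 by rewrite invr_gt0.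
have qx i : exists q : rat, `|ratr q - x 0 i| < N.+1%:R^-1.
  have [|q] := @rat_in_itvoo R (x 0 i - N.+1%:R^-1) (x 0 i + N.+1%:R^-1).
    by rewrite ltrD2l gtrN.
  by rewrite in_itv/= => qi; exists q; rewrite ltr_distl.
pose q := (\row_i projT1 (cid (qx i)), N).
have qxN : rat_ball q x.
  split=> // i j; rewrite (ord1 i) !mxE; exact: projT2 (cid (qx j)).
exists q => //= y qy; apply: xeA; rewrite [e]splitr.
apply: (@ball_triangle _ _ (map_mx ratr q.1 : 'rV[R]_n)).
- by apply: le_ball (ltW Ne) _ _; exact: ball_sym.
- by apply: le_ball (ltW Ne) _ _.
Qed.

Lemma measurable_cons_rV (n : nat) : measurable_fun setT (@cons_rV n).
Proof.
apply: (measurability (@open 'rV[R]_n.+1)) => //.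
move=> _ [A oA <-]; rewrite setTI (rat_ball_basis oA).
rewrite preimage_bigcup bigcup_mkcond.
apply: countable_bigcupT_measurable => [|q]; first exact: countableP.
case: ifPn => // _.
set c := map_mx ratr q.1 : 'rV[R]_n.+1; set e : R := q.2.+1%:R^-1.
have e0 : 0 < e by rewrite invr_gt0.
rewrite (_ : _ @^-1` _ = ball (\row_j c 0 (lift ord0 j)) e `*` ball (c 0 ord0) e).
  apply: measurableX; first by apply: sub_sigma_algebra; exact: ball_open.
  by apply: open_measurable; exact: ball_open.
apply/seteqP; split=> [[v t] [_ cvt]|[v t] [[_ cv] ct]] /=.
- split=> [|/=]; last by have := cvt ord0 ord0; rewrite [X in ball _ _ X]mxE unlift_none.
  split=> // i j; have := cvt ord0 (lift ord0 j).
  rewrite [X in ball _ _ X]mxE liftK (ord1 i) => h.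
  by rewrite [X in ball X]mxE; exact: h.
- split=> // i j; rewrite (ord1 i) [X in ball _ _ X]mxE.
  have [k ->|->] := unliftP ord0 j => //=.
  by have := cv ord0 k; rewrite [X in ball X]mxE => h; exact: h.
Qed.

Fixpoint lebesgue_rV (n : nat) : {measure set 'rV[R]_n -> \bar R} :=
  if n is n'.+1 then
    measure_function_pushforward__canonical__measure_function_Measure
      (lebesgue_rV n' \x @lebesgue_measure R)%E (@measurable_cons_rV n')
  else \d_(0 : 'rV[R]_0).

Lemma lebesgue_rVS (n : nat) (A : set 'rV[R]_n.+1) :
  lebesgue_rV n.+1 A =
  (lebesgue_rV n \x @lebesgue_measure R)%E (@cons_rV n @^-1` A).
Proof. by []. Qed.

Lemma measurable_coord (n : nat) (i : 'I_n) :
  measurable_fun setT (fun v : 'rV[R]_n => v 0 i).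
Proof.
apply: (measurability _ (RGenOpens.measurableE R)).
move=> _ [_ [a [b ->] <-]]; rewrite setTI; apply: sub_sigma_algebra.
apply: open_comp; last exact: interval_open.
by move=> v _; exact: coord_continuous.
Qed.

Lemma lebesgue_rV_box (n : nat) (A : 'I_n -> set (measurableTypeR R)) :
  (forall i, measurable (A i)) ->
  lebesgue_rV n [set v | forall i, A i (v 0 i)] =
  (\prod_(i < n) lebesgue_measure (A i))%E.
Proof.
elim: n A => [|n IH] A mA.
  by rewrite big_ord0 [LHS]diracE mem_set// => -[].
rewrite lebesgue_rVS (_ : _ @^-1` _ =
    [set v : 'rV[R]_n | forall i, A (lift ord0 i) (v 0 i)] `*` A ord0).
  rewrite product_measure1E//; last first.
    rewrite (_ : [set _ | _] = \bigcap_(i in [set: 'I_n])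
        ((fun v : 'rV[R]_n => v 0 i) @^-1` A (lift ord0 i))).
      apply: fin_bigcap_measurable => // i _.
      rewrite -[X in measurable X]setTI.
      exact: (@measurable_coord n i measurableT _ (mA (lift ord0 i))).
    by apply/seteqP; split=> [v hv i _|v hv i]; exact: hv.
  by rewrite [in RHS]big_ord_recl muleC; congr (_ * _)%E; exact: IH.
apply/seteqP; split=> [[v t] h|[v t] [hv ht] i] /=.
- split=> [i|]; first by have := h (lift ord0 i); rewrite mxE liftK.
  by have := h ord0; rewrite mxE unlift_none.
- by rewrite mxE; case: unliftP => [k ->|->] //=; exact: hv.
Qed.

End lebesgue.

Section euclidean.
Context {R : realType} {d : nat}.
Implicit Types (u v w : 'rV[R]_d) (A : set 'rV[R]_d) (f : 'rV[R]_d -> R).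

Definition dotprod u v : R := \sum_i u 0 i * v 0 i.

(* The library's norm on ['rV[R]_d] is the sup norm. *)
Definition enorm u : R := Num.sqrt (\sum_i u 0 i ^+ 2).

Definition eball (r : R) : set 'rV[R]_d := [set u | enorm u <= r].

Definition convex_hull A : set 'rV[R]_d :=
  [set u | exists n (a : 'I_n -> R) (x : 'I_n -> 'rV[R]_d),
     [/\ forall i, 0 <= a i, \sum_i a i = 1, forall i, A (x i) &
         u = \sum_i a i *: x i]].

Definition dist0 A : \bar R := ereal_inf [set (enorm u)%:E | u in A].

Definition gradient f w : 'rV[R]_d := \row_i 'd f w (delta_mx 0 i).

(* limsup, as y -> w and t -> 0+, of (f (y + t v) - f y) / t *)
Definition clarke_dderiv f w v : \bar R :=
  limf_esup
    (fun yt : 'rV[R]_d * R => ((f (yt.1 + yt.2 *: v) - f yt.1) / yt.2)%:E)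
    (filter_prod (nbhs w) (0 : R)^'+).

Definition clarke f w : set 'rV[R]_d :=
  [set g | forall v, ((dotprod g v)%:E <= clarke_dderiv f w v)%E].

Definition clarke_eps (e : R) f w : set 'rV[R]_d :=
  convex_hull (\bigcup_(z in eball e) clarke f (w + z)).

Definition uniform_eball (r : R) A : \bar R :=
  (lebesgue_rV R d (A `&` eball r) / lebesgue_rV R d (eball r))%E.

(* The measurability clause makes the integral a genuine expectation. *)
Definition expected_stationary {dT} {T : measurableType dT}
    (P : probability T R) f (e1 e2 : R) (W : T -> 'rV[R]_d) : Prop :=
  [/\ measurable_fun setT W,
      measurable_fun setT (fun t => dist0 (clarke_eps e1 f (W t))) &
      (\int[P]_t dist0 (clarke_eps e1 f (W t)) <= e2%:E)%E].

End euclidean.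

Section problem.
Context {R : realType} {d p : nat}.
Implicit Type F : 'rV[R]_d -> 'rV[R]_p -> R.

Definition caratheodory F : Prop :=
  (forall w, measurable_fun setT (F w)) /\ (forall y, continuous (F ^~ y)).

Definition lipschitz_e (f : 'rV[R]_d -> R) (L : R) : Prop :=
  forall w w', `|f w - f w'| <= L * enorm (w - w').

Definition objective {dO} {Omega : measurableType dO} (P : probability Omega R)
    (xi : Omega -> 'rV[R]_p) F (w : 'rV[R]_d) : R :=
  fine 'E_P[fun t => F w (xi t)].

Definition approx_gradient (Pxi : probability 'rV[R]_p R) F
    (G : 'rV[R]_d * 'rV[R]_p -> 'rV[R]_d) : Prop :=
  measurable_fun setT G /\
  {ae (lebesgue_rV R d \x Pxi)%E, forall u,
    differentiable (F ^~ u.2) u.1 -> G u = gradient (F ^~ u.2) u.1}.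

(* Samples are indexed from 1; [pisgd_iterate _ _ _ _ _ _ k] is x^(k+1). *)
Fixpoint pisgd_iterate (eta : R) (S : nat)
    (G : 'rV[R]_d * 'rV[R]_p -> 'rV[R]_d) (x1 : 'rV[R]_d)
    (z : nat -> nat -> 'rV[R]_d) (y : nat -> nat -> 'rV[R]_p) (k : nat) :=
  if k is k'.+1 then
    let x := pisgd_iterate eta S G x1 z y k' in
    x - (eta / S%:R) *: \sum_(1 <= l < S.+1) G (x + z k l, y k l)
  else x1.

(* As the sets may be taken to be full, the last clause is the mutual
   independence of [r] and of all the [z k l] and [y k l]. *)
Record pisgd_sampling {dT} {T : measurableType dT} (Pr : probability T R)
    (Pxi : probability 'rV[R]_p R) (K S : nat) (sigma : R)
    (r : {RV Pr >-> nat}) (z : nat -> nat -> {RV Pr >-> 'rV[R]_d})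
    (y : nat -> nat -> {RV Pr >-> 'rV[R]_p}) : Prop := {
  pisgd_index : forall k, (1 <= k <= K)%N ->
    distribution Pr r [set k] = (K%:R^-1)%:E ;
  pisgd_perturbation : forall k l, (1 <= k < K)%N -> (1 <= l <= S)%N ->
    forall A, measurable A -> distribution Pr (z k l) A = uniform_eball sigma A ;
  pisgd_data : forall k l, (1 <= k < K)%N -> (1 <= l <= S)%N ->
    forall A, measurable A -> distribution Pr (y k l) A = Pxi A ;
  pisgd_indep : forall (A : set nat) (B : nat -> nat -> set 'rV[R]_d)
      (D : nat -> nat -> set 'rV[R]_p),
    (forall k l, measurable (B k l)) -> (forall k l, measurable (D k l)) ->
    Pr [set t | A (r t) /\ forall k l, (1 <= k < K)%N -> (1 <= l <= S)%N ->
                 B k l (z k l t) /\ D k l (y k l t)] =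
    (Pr (r @^-1` A) * \prod_(1 <= k < K) \prod_(1 <= l < S.+1)
       (Pr (z k l @^-1` B k l) * Pr (y k l @^-1` D k l)))%E }.

Definition pisgd_output {T : Type} (eta : R) (S : nat)
    (G : 'rV[R]_d * 'rV[R]_p -> 'rV[R]_d) (x1 : 'rV[R]_d)
    (r : T -> nat) (z : nat -> nat -> T -> 'rV[R]_d)
    (y : nat -> nat -> T -> 'rV[R]_p) (t : T) : 'rV[R]_d :=
  pisgd_iterate eta S G x1 (fun k l => z k l t) (fun k l => y k l t) (r t).-1.

End problem.

Section parameters.
Context {R : realType}.
Variables (beta theta : R) (K : nat).

Definition batch_size : nat := `|Num.ceil (K%:R `^ (1 - beta) : R)|%N.

Definition ball_radius (d : nat) : R :=
  theta * Num.sqrt d%:R * K%:R `^ (- beta).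

Definition step_size (L0 : R) : R := theta / L0 * K%:R `^ (- beta).

Definition gradient_calls : nat := (K.-1 * batch_size)%N.

End parameters.

(* Main.v *)
Require Import Defs.
From HB Require Import structures.
From mathcomp Require Import all_boot all_order all_algebra fingroup perm.
From mathcomp Require Import all_classical all_reals all_analysis.
From mathcomp Require Import measurable_realfun ring lra.

(** Let fs(x) = E f(x + z) with z uniform on the ball of radius sigma.  By
    Rademacher's theorem and dominated convergence, g(x) = E G(x + z, xi) is the
    gradient of fs.  A translation by t moves at most the fraction
    sqrt(d)|t| / (2 sigma) of the ball out of itself, so that fs satisfies the
    descent inequality with constant L0 sqrt(d) / sigma = 1 / eta.  Hence one step
    decreases E fs by (eta / 2) E|g|^2 up to eta Q / (2 S), and averaging over the
    random index bounds E|g(x^R)|^2 by a multiple of K^(beta - 1).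
    If a is a point of almost minimal norm D of the epsilon-subdifferential at x,
    then <u, a> >= D^2 - o(1) for each u in it; integrating over the gradients
    u = grad f(x + z) gives <g(x), a> >= D^2 - o(1), whence
    dist(0, subdifferential) <= |g(x)| as soon as sigma <= epsilon.
    Finally K is taken of order max(eps1^(-1 / beta), eps2^(-2 / (1 - beta))). *)

Set Implicit Arguments.
Unset Strict Implicit.
Unset Printing Implicit Defensive.

Import Order.TTheory GRing.Theory Num.Theory.
Import numFieldNormedType.Exports.

Local Open Scope classical_set_scope.
Local Open Scope ring_scope.

(** * Lebesgue measure and Euclidean norm on row vectors *)

Section rV_norms.
Context {R : realType} {d : nat}.
Implicit Types (u v w : 'rV[R]_d) (a : R).

(** The translation estimate needs the factor sqrt(d), not d. No rotation invariance is required for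
    it: sign flips and transpositions of coordinates already make the second moments of a shell
    isotropic, which gains 1 / d over the Cauchy-Schwarz bound. Rademacher's theorem is used jointly
    in (w, xi), so the set of points of differentiability must be measurable in the pair.
    Differentiability is therefore stated with slopes that may depend on the tolerance, which
    reduces it to countably many conditions on rational data. The gradient of fs enters only through
    limits of difference quotients along 1 / (N + 1), so that sequences suffice. Conditioning on the
    past is replaced by decoupling: a function of two arguments, measurable for independent
    sub-sigma-algebras, has the same integral over the diagonal as over the product. The random
    index takes K values, but only K - 1 steps are made; the gradient at the last iterate is paid
    for by the gap E fs - min f that is left. The distance to the subdifferential is handled as an
    infimum with approximate minimisers, which avoids proving the hull closed. *)

Lemma ler_norm_coord v i : `|v 0 i| <= `|v|.
Proof.
rewrite [leRHS]/Num.norm/= mx_normrE.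
exact: (le_bigmax _ (fun ij => `|v ij.1 ij.2|) (0, i)).
Qed.

Lemma ler_norm_rV v a : 0 <= a -> (forall i, `|v 0 i| <= a) -> `|v| <= a.
Proof.
move=> a0 va; rewrite [leLHS]/Num.norm/= mx_normrE; apply: bigmax_le => //= -[j i] _.
by rewrite (ord1 j).
Qed.

Lemma dotprodE u v : dotprod u v = \sum_i u 0 i * v 0 i.
Proof. by []. Qed.

Lemma dotprodC u v : dotprod u v = dotprod v u.
Proof. by apply: eq_bigr => i _; rewrite mulrC. Qed.

Lemma dotprodDl u v w : dotprod (u + v) w = dotprod u w + dotprod v w.
Proof. by rewrite -big_split/=; apply: eq_bigr => i _; rewrite !mxE mulrDl. Qed.

Lemma dotprodZl a u v : dotprod (a *: u) v = a * dotprod u v.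
Proof. by rewrite mulr_sumr; apply: eq_bigr => i _; rewrite !mxE mulrA. Qed.

Lemma dotprodDr u v w : dotprod w (u + v) = dotprod w u + dotprod w v.
Proof. by rewrite !(dotprodC w) dotprodDl. Qed.

Lemma dotprodZr a u v : dotprod u (a *: v) = a * dotprod u v.
Proof. by rewrite !(dotprodC u) dotprodZl. Qed.

Lemma dotprodNl u v : dotprod (- u) v = - dotprod u v.
Proof. by rewrite -scaleN1r dotprodZl mulN1r. Qed.

Lemma dotprodNr u v : dotprod u (- v) = - dotprod u v.
Proof. by rewrite !(dotprodC u) dotprodNl. Qed.

Lemma dotprodBl u v w : dotprod (u - v) w = dotprod u w - dotprod v w.
Proof. by rewrite dotprodDl dotprodNl. Qed.

Lemma dotprodBr u v w : dotprod w (u - v) = dotprod w u - dotprod w v.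
Proof. by rewrite dotprodDr dotprodNr. Qed.

Lemma dotprod0l u : dotprod 0 u = 0.
Proof. by rewrite -(scale0r u) dotprodZl mul0r. Qed.

Lemma dotprod0r u : dotprod u 0 = 0.
Proof. by rewrite dotprodC dotprod0l. Qed.

Lemma dotprod_suml I (s : seq I) (P : pred I) (f : I -> 'rV[R]_d) v :
  dotprod (\sum_(i <- s | P i) f i) v = \sum_(i <- s | P i) dotprod (f i) v.
Proof. by elim/big_rec2 : _ => [|i x y _ <-]; rewrite ?dotprod0l// dotprodDl. Qed.

Lemma dotprod_delta u i : dotprod u (delta_mx 0 i) = u 0 i.
Proof.
rewrite dotprodE (bigD1 i)//= big1 ?addr0; last first.
  by move=> j ji; rewrite mxE (negbTE ji) mulr0.
by rewrite mxE !eqxx mulr1.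
Qed.

Lemma dotprod_ge0 u : 0 <= dotprod u u.
Proof. by apply: sumr_ge0 => i _; rewrite -expr2 sqr_ge0. Qed.

Lemma enormE u : enorm u = Num.sqrt (dotprod u u).
Proof. by []. Qed.

Lemma enorm_ge0 u : 0 <= enorm u.
Proof. exact: sqrtr_ge0. Qed.

Lemma enorm2 u : enorm u ^+ 2 = dotprod u u.
Proof. by rewrite enormE sqr_sqrtr// dotprod_ge0. Qed.

Lemma enorm0 : enorm (0 : 'rV[R]_d) = 0.
Proof. by rewrite enormE dotprod0l sqrtr0. Qed.

Lemma enormZ a u : enorm (a *: u) = `|a| * enorm u.
Proof.
by rewrite !enormE dotprodZl dotprodZr mulrA -expr2 sqrtrM ?sqr_ge0// sqrtr_sqr.
Qed.

Lemma enormN u : enorm (- u) = enorm u.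
Proof. by rewrite !enormE dotprodNl dotprodNr opprK. Qed.

Lemma enormBC u v : enorm (u - v) = enorm (v - u).
Proof. by rewrite -enormN opprB. Qed.

Lemma enorm_eq0 u : enorm u = 0 -> u = 0.
Proof.
move=> u0; have : dotprod u u = 0 by rewrite -enorm2 u0 expr0n.
move/psumr_eq0P => h; apply/rowP => i; rewrite mxE.
have /eqP : u 0 i * u 0 i = 0 by apply: h => // j _; rewrite -expr2 sqr_ge0.
by rewrite mulf_eq0 orbb => /eqP.
Qed.

Lemma dotprod_le u v : dotprod u v <= enorm u * enorm v.
Proof.
have [u0|u0] := eqVneq (enorm u) 0; first by rewrite u0 (enorm_eq0 u0) dotprod0l mul0r.
have [v0|v0] := eqVneq (enorm v) 0; first by rewrite v0 (enorm_eq0 v0) dotprod0r mulr0.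
have := dotprod_ge0 (enorm v *: u - enorm u *: v).
rewrite !(dotprodBl, dotprodBr, dotprodZl, dotprodZr) -!enorm2 (dotprodC v u).
have u_gt0 : 0 < enorm u by rewrite lt_neqAle eq_sym u0 enorm_ge0.
have v_gt0 : 0 < enorm v by rewrite lt_neqAle eq_sym v0 enorm_ge0.
set x := enorm u in u_gt0 *; set y := enorm v in v_gt0 *; set s := dotprod _ _.
rewrite (_ : _ - _ = 2 * (x * y) * (x * y - s)); last by ring.
by rewrite pmulr_rge0 ?subr_ge0// !mulr_gt0.
Qed.

Lemma normr_dotprod_le u v : `|dotprod u v| <= enorm u * enorm v.
Proof. by rewrite ler_norml dotprod_le lerNl -dotprodNl -(enormN u) dotprod_le. Qed.

Lemma enormD u v : enorm (u + v) <= enorm u + enorm v.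
Proof.
rewrite -(ler_pXn2r (_ : 0 < 2)%N) ?nnegrE ?addr_ge0 ?enorm_ge0//.
rewrite enorm2 !(dotprodDl, dotprodDr) (dotprodC v u) sqrrD !enorm2.
by have := dotprod_le u v; lra.
Qed.

Lemma enormB u v : enorm (u - v) <= enorm u + enorm v.
Proof. by rewrite -(enormN v) enormD. Qed.

Lemma ler_enormB u v : `|enorm u - enorm v| <= enorm (u - v).
Proof.
have := enormD (u - v) v; have := enormD (v - u) u.
by rewrite !subrK (enormBC v u) ler_norml; lra.
Qed.

Lemma enorm_sum I (s : seq I) (P : pred I) (f : I -> 'rV[R]_d) :
  enorm (\sum_(i <- s | P i) f i) <= \sum_(i <- s | P i) enorm (f i).
Proof.
elim/big_rec2 : _ => [|i x y _ h]; first by rewrite enorm0.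
by rewrite (le_trans (enormD _ _))// lerD2l.
Qed.

Lemma ler_coord_enorm u i : `|u 0 i| <= enorm u.
Proof.
rewrite -(ler_pXn2r (_ : 0 < 2)%N) ?nnegrE ?enorm_ge0//.
rewrite enorm2 real_normK ?num_real// dotprodE (bigD1 i)//= -expr2 lerDl.
by apply: sumr_ge0 => j _; rewrite -expr2 sqr_ge0.
Qed.

Lemma ler_enorm_norm u : enorm u <= d%:R * `|u|.
Proof.
have {1}-> : u = \sum_i u 0 i *: delta_mx 0 i by exact: row_sum_delta.
apply: le_trans (enorm_sum _ _ _) _.
rewrite (_ : d%:R * `|u| = \sum_(i < d) `|u|); last by rewrite sumr_const card_ord mulr_natl.
apply: ler_sum => i _.
rewrite enormZ enormE dotprod_delta mxE !eqxx sqrtr1 mulr1.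
exact: ler_norm_coord.
Qed.

End rV_norms.

Section affine1.
Context {R : realType}.
Implicit Types (a b : R) (A : set (measurableTypeR R)).

Let affine a b (t : measurableTypeR R) : measurableTypeR R := a * t + b.

Let measurable_affine a b : measurable_fun setT (affine a b).
Proof.
by apply: measurable_funD; [exact: measurable_funM|exact: measurable_cst].
Qed.

(** The pushforward along the affine map, scaled by |a|, has the right value on half-open intervals,
    and uniqueness does the rest. A negative [a] pulls []x, y]] back to an interval closed on the
    left, hence the two cases. *)
Lemma lebesgue_measure_affine a b A : a != 0 -> measurable A ->
  (lebesgue_measure [set t : measurableTypeR R | A (a * t + b)%R] * `|a|%:E =
   lebesgue_measure A)%E.
Proof.
move=> a0 mA.
have na0 : 0 < `|a| by rewrite normr_gt0.
pose m : {measure set (measurableTypeR R) -> \bar R} :=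
  mscale (NngNum (ltW na0))
    (measure_function_pushforward__canonical__measure_function_Measure (@lebesgue_measure R) (measurable_affine a b)).
suff -> // : lebesgue_measure A = m A by rewrite /m/= /mscale/= muleC.
apply: lebesgue_measure_unique => // _ [[x y] _ <-] /=.
rewrite /m/= /mscale/= /pushforward /affine/=.
have [a_gt0|] := ltP 0 a; last rewrite le_eqVlt (negbTE a0)/= => a_lt0.
  rewrite (_ : _ @^-1` _ = `]((x - b) / a), ((y - b) / a)]%classic); last first.
    apply/seteqP; split => t /=; rewrite !in_itv/= ltr_pdivrMr// ler_pdivlMr// (mulrC t) ltrBlDr lerBrDr//.
  rewrite !lebesgue_measure_itv/= !lte_fin ltr_pM2r ?invr_gt0// ltrD2r.
  case: ifP => // _; last by rewrite mule0.
  by rewrite -!EFinB -EFinM gtr0_norm//; congr (_%:E); field.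
rewrite (_ : _ @^-1` _ = `[((y - b) / a), ((x - b) / a)[%classic); last first.
  apply/seteqP; split => t /=; rewrite !in_itv/= ler_ndivrMr// ltr_ndivlMr// (mulrC t) lerBrDr ltrBlDr andbC//.
rewrite !lebesgue_measure_itv/= !lte_fin ltr_nM2r ?invr_lt0// ltrD2r.
case: ifP => // _; last by rewrite mule0.
by rewrite -!EFinB -EFinM ltr0_norm//; congr (_%:E); field.
Qed.
End affine1.

(** * Lebesgue measure under affine changes of coordinates *)

Section lebesgue_rV_theory.
Context {R : realType}.

Definition rV_boxes (n : nat) : set (set 'rV[R]_n) :=
  [set B : set 'rV[R]_n | exists2 A : 'I_n -> set (measurableTypeR R),
     (forall i, measurable (A i)) & B = [set v : 'rV[R]_n | forall i, A i (v 0 i)]].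

Lemma measurable_rV_box (n : nat) (A : 'I_n -> set (measurableTypeR R)) :
  (forall i, measurable (A i)) ->
  measurable [set v : 'rV[R]_n | forall i, A i (v 0 i)].
Proof.
move=> mA; rewrite (_ : [set _ | _] = \bigcap_(i in [set: 'I_n])
    ((fun v : 'rV[R]_n => v 0 i) @^-1` A i)).
  apply: fin_bigcap_measurable => // i _.
  rewrite -[X in measurable X]setTI.
  exact: (@measurable_coord R n i measurableT _ (mA i)).
by apply/seteqP; split=> [v hv i _|v hv i]; exact: hv.
Qed.

(** Rational sup-norm balls are boxes, and every open set is a countable union of them. Boxes form a
    pi-system on which Lebesgue measure is an explicit product, so measures can be compared
    there. *)
Lemma rV_measurable_boxes (n : nat) :
  @measurable _ 'rV[R]_n = <<s @rV_boxes n >>.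
Proof.
apply/seteqP; split; last first.
  apply: smallest_sub; first exact: sigma_algebra_measurable.
  by move=> _ [A mA ->]; exact: measurable_rV_box.
apply: smallest_sub; first exact: smallest_sigma_algebra.
move=> A oA; rewrite (rat_ball_basis oA).
suff : @measurable _ (g_sigma_algebraType (@rV_boxes n))
   (\bigcup_(q in [set q | rat_ball q `<=` A]) rat_ball q) by [].
rewrite bigcup_mkcond.
apply: countable_bigcupT_measurable => [|q]; first exact: countableP.
case: ifPn => // _; apply: sub_sigma_algebra.
exists (fun i => ball (ratr (q.1 0 i) : R) (q.2.+1%:R^-1 : R)).
  by move=> i; apply: open_measurable; exact: ball_open.
apply/seteqP; split=> v; first by move=> [_ h] i; have := h ord0 i; rewrite mxE.
by move=> h; split => // i j; rewrite (ord1 i) mxE; exact: h.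
Qed.

Lemma rV_boxesI (n : nat) : setI_closed (@rV_boxes n).
Proof.
move=> _ _ [A mA ->] [B mB ->]; exists (fun i => A i `&` B i).
  by move=> i; exact: measurableI.
apply/seteqP; split => v /=; first by case=> h1 h2 i; split.
by move=> h; split => i; case: (h i).
Qed.

Let cube (n k : nat) : set 'rV[R]_n :=
  [set v | forall i, `[- k%:R, k%:R]%classic (v 0 i)].

Let cube_cover (n : nat) : \bigcup_k @cube n k = setT.
Proof.
apply/seteqP; split => // v _.
exists (Num.Def.archi_bound `|v|) => // i /=.
rewrite in_itv/= -ler_norml (le_trans (ler_norm_coord v i))//.
by apply/ltW/archi_boundP.
Qed.

Let cube_lty (n k : nat) : (lebesgue_rV R n (@cube n k) < +oo)%E.
Proof.
rewrite [X in lebesgue_rV R n X](_ : _ = [set v : 'rV[R]_n | forall i, `[- k%:R, k%:R]%classic (v 0 i)])//.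
rewrite (lebesgue_rV_box (A := fun=> `[- k%:R, k%:R]%classic))//.
have : (\prod_(i < n) lebesgue_measure (`[(- k%:R)%R, k%:R]%classic : set R))%E \is a fin_num.
  elim/big_ind : _ => // [x y|i _]; first exact: fin_numM.
  by rewrite lebesgue_measure_itv/=; case: ifP.
by move=> /fin_numPlt/andP[].
Qed.

Lemma lebesgue_rV_unique (n : nat) (m : {measure set 'rV[R]_n -> \bar R}) :
  (forall A : 'I_n -> set (measurableTypeR R), (forall i, measurable (A i)) ->
     m [set v : 'rV[R]_n | forall i, A i (v 0 i)] = (\prod_(i < n) lebesgue_measure (A i))%E) ->
  forall A, measurable A -> lebesgue_rV R n A = m A.
Proof.
move=> mbox; apply: (@measure_unique _ _ _ _ (@cube n) (@rV_measurable_boxes n)).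
- exact: rV_boxesI.
- by move=> k; exists (fun=> `[- k%:R, k%:R]%classic) => //.
- exact: cube_cover.
- by move=> _ [A mA ->]; rewrite lebesgue_rV_box// mbox.
- exact: cube_lty.
Qed.

(** A named copy of [lebesgue_rV], to which the sigma-finite structure demanded by Fubini's theorem
    can be attached. *)
Definition leb (n : nat) (A : set 'rV[R]_n) : \bar R := lebesgue_rV R n A.

HB.instance Definition _ n := Measure.copy (@leb n) (lebesgue_rV R n).

Let leb_sigma_finite n : sigma_finite setT (@leb n).
Proof.
exists (@cube n); first by rewrite cube_cover.
move=> k; split; last exact: cube_lty.
exact: (measurable_rV_box (A := fun=> `[- k%:R, k%:R]%classic)).
Qed.

HB.instance Definition _ n := Measure_isSigmaFinite.Build _ _ _ (@leb n)
  (@leb_sigma_finite n).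

Lemma measurable_fun_rV {d} {T : measurableType d} n (f : T -> 'rV[R]_n) :
  (forall i, measurable_fun setT (fun t => f t 0 i : R)) -> measurable_fun setT f.
Proof.
move=> mf; apply: (measurability _ (rV_measurable_boxes n)) => _ [_ [A mA ->] <-].
rewrite setTI (_ : _ @^-1` _ = \bigcap_(i in [set: 'I_n])
    ((fun t => f t 0 i) @^-1` A i)).
  apply: fin_bigcap_measurable => // i _.
  by rewrite -[X in measurable X]setTI; exact: (mf i measurableT _ (mA i)).
by apply/seteqP; split=> [v hv i _|v hv i]; exact: hv.
Qed.

Lemma measurable_fun_rVP {d} {T : measurableType d} n (f : T -> 'rV[R]_n) :
  measurable_fun setT f -> forall i, measurable_fun setT (fun t => f t 0 i : R).
Proof.
by move=> mf i; exact: (measurableT_comp (@measurable_coord R n i) mf).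
Qed.

Lemma measurable_addr_rV n (x : 'rV[R]_n) :
  measurable_fun setT (fun z : 'rV[R]_n => z + x).
Proof.
apply: measurable_fun_rV => i; under eq_fun do rewrite !mxE.
by apply: measurable_funD => //; exact: measurable_coord.
Qed.

Section coordinate_affine.
Variables (n : nat) (s : {perm 'I_n}) (a b : 'I_n -> R).

(** These maps pull boxes back to boxes, so their change of variables follows from
    [lebesgue_rV_unique] and the one-dimensional case. Translations, dilations, sign flips and
    transpositions are all of this form. *)
Definition coord_affine (v : 'rV[R]_n) : 'rV[R]_n :=
  \row_i (a i * v 0 (s i) + b i).

Lemma measurable_coord_affine : measurable_fun setT coord_affine.
Proof.
apply: measurable_fun_rV => i; under eq_fun do rewrite mxE.
apply: measurable_funD => //; apply: measurable_funM => //.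
exact: measurable_coord.
Qed.

Lemma leb_coord_affine A : (forall i, a i != 0) -> measurable A ->
  (leb (coord_affine @^-1` A) * (\prod_i `|a i|)%:E = leb A)%E.
Proof.
move=> a0 mA.
have na0 : 0 <= \prod_i `|a i| by apply: prodr_ge0.
pose m : {measure set 'rV[R]_n -> \bar R} :=
  mscale (NngNum na0)
    (measure_function_pushforward__canonical__measure_function_Measure (@leb n) measurable_coord_affine).
suff -> // : leb A = m A by rewrite /m/= /mscale/= muleC.
apply: lebesgue_rV_unique => // {mA}A mA.
rewrite /m/= /mscale/= /pushforward.
rewrite (_ : _ @^-1` _ = [set v : 'rV[R]_n | forall i,
    [set t : measurableTypeR R | A ((s^-1)%g i) (a ((s^-1)%g i) * t + b ((s^-1)%g i))%R] (v 0 i)]); last first.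
  apply/seteqP; split => v /= h i; last by have := h (s i); rewrite permK mxE.
  by have := h ((s^-1)%g i); rewrite mxE permKV.
rewrite (_ : leb _ = \prod_(i < n) lebesgue_measure [set t : measurableTypeR R |
    A ((s^-1)%g i) (a ((s^-1)%g i) * t + b ((s^-1)%g i))%R])%E; last first.
  apply: (lebesgue_rV_box (A := fun i => [set t : measurableTypeR R |
    A ((s^-1)%g i) (a ((s^-1)%g i) * t + b ((s^-1)%g i))%R])).
  move=> i; rewrite -[X in measurable X]setTI.
  apply: (_ : measurable_fun setT (fun t : measurableTypeR R =>
     (a ((s^-1)%g i) * t + b ((s^-1)%g i) : measurableTypeR R))) => //.
  by apply: measurable_funD => //; exact: measurable_funM.
rewrite muleC (reindex_inj (@perm_inj _ s))/= -prodEFin -big_split/=.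
apply: eq_bigr => i _; rewrite permK.
by rewrite lebesgue_measure_affine.
Qed.

End coordinate_affine.

Lemma leb_shift n b (A : set 'rV[R]_n) : measurable A ->
  leb [set v | A (v + b)] = leb A.
Proof.
move=> mA; rewrite -[RHS](@leb_coord_affine n 1%g (fun=> 1) (b 0))//.
rewrite big1 ?mule1//; last by move=> i _; rewrite normr1.
congr leb; apply/seteqP; split => v; rewrite /preimage/= (_ : coord_affine _ _ _ _ = v + b)//;
  by apply/rowP => i; rewrite !mxE mul1r perm1.
Qed.

Lemma leb_scale n (a : R) (A : set 'rV[R]_n) : 0 < a -> measurable A ->
  (leb [set v | A (a *: v)] * (a ^+ n)%:E = leb A)%E.
Proof.
move=> a0 mA; rewrite -[RHS](@leb_coord_affine n 1%g (fun=> a) (fun=> 0))//; last first.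
  by move=> i; rewrite gt_eqF.
rewrite prodr_const card_ord gtr0_norm//; congr (_ * _)%E.
congr leb; apply/seteqP; split => v; rewrite /preimage/= (_ : coord_affine _ _ _ _ = a *: v)//;
  by apply/rowP => i; rewrite !mxE addr0 perm1.
Qed.

End lebesgue_rV_theory.

Lemma aeS d (T : measurableType d) (R : realType) (mu : {measure set T -> \bar R})
  (P Q : T -> Prop) : (forall x, P x -> Q x) ->
  {ae mu, forall x, P x} -> {ae mu, forall x, Q x}.
Proof. by move=> PQ; apply: (@filterS _ _ (ae_filter_ringOfSetsType mu)). Qed.

Lemma le_mu d (T : measurableType d) (R : realType)
    (mu : {measure set T -> \bar R}) (A B : set T) :
  measurable A -> measurable B -> A `<=` B -> (mu A <= mu B)%E.
Proof. by move=> mA mB AB; rewrite le_measure// inE. Qed.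

(** * Rademacher's theorem *)

Section lipschitz_line.
Let itv_add_bound (R : realFieldType) (s a t n : R) :
  a * 2 <= t + n -> a * 2 <= n - t -> - s <= a -> s <= a -> - n <= s + t <= n.
Proof. by move=> *; apply/andP; split; lra. Qed.

Let porous_gap (R : realFieldType) (c x : R) :
  0 < c -> x <= 1 - c *+ 2 -> 1 - x < c -> False.
Proof. by rewrite -mulr_natl => *; lra. Qed.

Let porous_ratio (R : realFieldType) (a x : R) : x != 0 ->
  2 * a *+ 2 - a / x *+ 2 = (1 - (4 * x)^-1 *+ 2) * (2 * a *+ 2).
Proof. by move=> x0; field. Qed.

Context {R : realType}.
Local Notation mu := (@lebesgue_measure R).

Definition line_diff (g : R -> R) (t : R) : Prop :=
  exists b : R, forall e : R, 0 < e -> exists2 dl : R, 0 < dl &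
    forall s, `|s| <= dl -> `|g (t + s) - g t - b * s| <= e * `|s|.

(* Since [phi + psi] is linear, the Stieltjes measure of [phi] is dominated by
   Lebesgue measure, so that [phi] is locally the integral of its Radon-Nikodym density. *)
Section nondecreasing.
Variables (phi psi : cumulative R R) (M : R).
Hypotheses (M0 : 0 < M) (phipsi : forall x, phi x + psi x = M * x).

Let muphi := lebesgue_stieltjes_measure phi.
Let mupsi := lebesgue_stieltjes_measure psi.

Let lsm_itv (f : cumulative R R) a b : a <= b ->
  lebesgue_stieltjes_measure f `]a, b]%classic = (f b - f a)%:E.
Proof.
move=> ab; rewrite /lebesgue_stieltjes_measure /measure_extension/=.
rewrite measurable_mu_extE/=; last exact: is_ocitv.
by rewrite wlength_itv_bnd.
Qed.

Let muphi_mupsi A : measurable A -> mu A = (M^-1%:E * (muphi A + mupsi A))%E.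
Proof.
have M0' : 0 <= M^-1 by rewrite invr_ge0 ltW.
pose m : {measure set (measurableTypeR R) -> \bar R} :=
  mscale (NngNum M0') (measure_add muphi mupsi).
move=> mA; suff -> : mu A = m A by rewrite -measure_addE.
apply: lebesgue_measure_unique => // _ [[x y] _ <-] /=.
rewrite -[RHS]/(M^-1%:E * measure_add muphi mupsi `]x, y]%classic)%E measure_addE.
have [xy|yx] := leP x y; last by rewrite set_itv_ge ?measure0 ?bnd_simp ?adde0 ?mule0// -leNgt ltW.
rewrite [X in (_ * (X + _))%E](lsm_itv phi xy) [X in (_ * (_ + X))%E](lsm_itv psi xy) -EFinD -EFinM lebesgue_measure_itv/= lte_fin.
have -> : phi y - phi x + (psi y - psi x) = M * (y - x).
  by rewrite mulrBr -!phipsi; ring.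
rewrite mulKf ?gt_eqF//; case: ltP => // yx.
by rewrite (le_anti (introT andP (conj xy yx))) subrr.
Qed.

Let muphi_dominates : muphi `<< mu.
Proof.
apply/null_content_dominatesP => A mA A0.
have : (muphi A + mupsi A = 0)%E.
  have := muphi_mupsi mA; rewrite A0 => /esym/eqP.
  by rewrite mule_eq0 eqe invr_eq0 gt_eqF//= => /eqP.
by move=> /eqP; rewrite padde_eq0 ?measure_ge0// => /andP[/eqP].
Qed.

Lemma nondecreasing_ae_line_diff : {ae mu, forall t : measurableTypeR R,
  line_diff phi t}.
Proof.
suff H (n : nat) : {ae mu, forall t : measurableTypeR R, - n%:R < t < n%:R ->
  line_diff phi t}.
  have : {ae mu, forall t (n : nat), - n%:R < t < n%:R ->
    line_diff phi t}.
    exact: ae_foralln.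
  apply: aeS => t /(_ (Num.Def.archi_bound `|t|)); apply.
  by rewrite -ltr_norml archi_boundP.
(* Restriction to a bounded interval makes the Stieltjes measure finite, hence its density
   integrable on the whole line. *)
pose D : set (measurableTypeR R) := `](- n%:R), n%:R]%classic.
have mD : measurable D by exact: measurable_itv.
pose nu := mrestr muphi mD.
have nuE A : nu A = muphi (A `&` D) by [].
have nN : - n%:R <= n%:R :> R by rewrite (@le_trans _ _ 0)// oppr_le0.
have nu_fin : fin_num_fun nu.
  move=> A mA; rewrite ge0_fin_numE; last exact: measure_ge0.
  apply: (@le_lt_trans _ _ (muphi D)); last by rewrite [ltLHS](lsm_itv phi nN) ltry.
  rewrite [leLHS]nuE; apply: le_mu => //; exact: measurableI.
pose nu' : {finite_measure set (measurableTypeR R) -> \bar R} :=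
  HB.pack nu (Measure_isFinite.Build _ _ _ nu nu_fin).
have nudom : nu' `<< mu.
  apply/null_content_dominatesP => A mA A0; rewrite /nu'/= nuE.
  apply/eqP; rewrite eq_le measure_ge0 andbT.
  rewrite -((null_content_dominatesP _ _).1 muphi_dominates A mA A0).
  apply: le_mu => //; exact: measurableI.
have [h [h0 hfin hint hE]] := radon_nikodym_sigma_finite nudom.
pose f : R -> R := fine \o h.
have fh : EFin \o f = h by apply/funext => x; rewrite /f/= fineK.
have fint A : measurable A -> mu.-integrable A (EFin \o f).
  by move=> mA; rewrite fh; exact: integrableS hint.
have := @FTC1 _ f (BRight (- n%:R)).
move=> /(_ (fun y => fint _ (measurable_itv _))).
move=> /(_ (open_integrable_locally openT (fint _ measurableT))).
apply: aeS => t Ht /andP[nt tn].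
have nt' : (BRight (- n%:R) < BRight t)%O by rewrite ltBSide/= nt.
pose F (x : R) : R := (\int[mu]_(u in [set` Interval (BRight (- n%:R)) (BRight x)]) f u)%R.
have dF : derivable F t 1 := (Ht nt').1.
have FE x : - n%:R <= x <= n%:R -> F x = phi x - phi (- n%:R).
  move=> /andP[nx xn]; rewrite /F /Rintegral.
  pose I : set R := `]- n%:R, x]%classic.
  have -> : (\int[mu]_(z in I) (f z)%:E = nu I)%E.
    by rewrite -[RHS]/(nu' I) (hE _ (measurable_itv _)) -fh.
  rewrite nuE setIidl; first by rewrite [muphi _](lsm_itv phi nx).
  by rewrite /I /D => z /=; rewrite !in_itv/= => /andP[-> /le_trans]; exact.
have /cvg_ex[/= b Hb] := dF; exists b => e e0.
move/cvgrPdist_le : Hb => /(_ _ e0) /nbhs_ballP[dl /= dl0 Hdl].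
pose dt := Num.min (t + n%:R) (n%:R - t).
have dt0 : 0 < dt by rewrite lt_min -ltrBlDr sub0r nt subr_gt0 tn.
exists (Num.min (dl / 2) (dt / 2)); first by rewrite lt_min !divr_gt0.
move=> s; rewrite le_min => /andP[sdl].
rewrite ler_pdivlMr// le_min => sdt.
have [->|s0] := eqVneq s 0; first by rewrite addr0 subrr mulr0 subr0 normr0 mulr0.
have := Hdl s; rewrite /ball/= sub0r normrN.
have -> : `|s| < dl by rewrite (le_lt_trans sdl)// ltr_pdivrMr// ltr_pMr// ltr1n.
move=> /(_ isT s0); move: sdt => /andP[s1 s2].
have := ler_norm s; have := ler_norm (- s); rewrite normrN => s3 s4.
have stn : - n%:R <= s + t <= n%:R.
  exact: itv_add_bound s1 s2 s3 s4.
rewrite /= [_ *: 1]mulr1 !FE ?(ltW nt) ?(ltW tn)//.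
move=> H; rewrite (_ : _ - _ = - s * (b - s^-1 *: (phi (s + t) - phi (- n%:R) - (phi t - phi (- n%:R))))).
  by rewrite normrM normrN mulrC ler_wpM2r.
rewrite (addrC t) mulrBr [s^-1 *: _]/(_ * _) mulNr mulrA mulNr divff//; ring.
Qed.
End nondecreasing.

(** Both g + M x and M x - g are nondecreasing and their sum is linear, so the monotone case applies
    to the first; subtracting M from its slope gives that of g. *)
Lemma lipschitz_ae_line_diff (g : R -> R) (L : R) :
  (forall x y, `|g x - g y| <= L * `|x - y|) ->
  {ae mu, forall t : measurableTypeR R, line_diff g t}.
Proof.
move=> gL; pose M := `|L| + 1; have M0 : 0 < M by rewrite ltr_wpDl.
have gM x y : `|g x - g y| <= M * `|x - y|.
  by rewrite (le_trans (gL x y))// ler_wpM2r// (le_trans (ler_norm _))// lerDl.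
have cg : continuous g.
  move=> x; apply/cvgrPdist_le => e e0; near=> y.
  rewrite (le_trans (gM x y))// -ler_pdivlMl// mulrC.
  by near: y; apply: cvgr_dist_le; [exact: cvg_id|rewrite divr_gt0].
pose phi x := g x + M * x; pose psi x := M * x - g x.
have phi_nd : {homo phi : x y / x <= y}.
  move=> x y xy; have := gM x y; rewrite distrC (@distrC _ _ x y) (@ger0_norm _ (y - x)) ?subr_ge0//.
  by rewrite ler_norml /phi; lra.
have psi_nd : {homo psi : x y / x <= y}.
  move=> x y xy; have := gM x y; rewrite distrC (@distrC _ _ x y) (@ger0_norm _ (y - x)) ?subr_ge0//.
  by rewrite ler_norml /psi; lra.
have cM : continuous (fun x : R => M * x) by move=> x; exact: mulrl_continuous.
have phi_rc : right_continuous phi.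
  by apply: right_continuousW => x; apply: cvgD; [exact: cg|exact: cM].
have psi_rc : right_continuous psi.
  by apply: right_continuousW => x; apply: cvgB; [exact: cM|exact: cg].
pose Phi : cumulative R R := HB.pack phi (isCumulative.Build _ _ _ phi phi_nd phi_rc).
pose Psi : cumulative R R := HB.pack psi (isCumulative.Build _ _ _ psi psi_nd psi_rc).
have M2 : 0 < 2 * M by rewrite mulr_gt0.
have := @nondecreasing_ae_line_diff Phi Psi (2 * M) M2.
have PP x : Phi x + Psi x = 2 * M * x by rewrite /Phi /Psi/= /phi /psi; ring.
move=> /(_ PP); apply: aeS => t [b Hb].
exists (b - M) => e /Hb[dl dl0 H]; exists dl => // s /H.
by rewrite /Phi/= /phi; congr (`|_| <= _); ring.
Unshelve. all: by end_near. Qed.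

(** Let t be a density point of A. A ball of radius |s| / (k + 1) around t + s that misses A would
    remove a fixed fraction of the ball of radius 2 |s| around t, which is impossible for small
    s. *)
Lemma ae_not_porous (A : set (measurableTypeR R)) : measurable A ->
  {ae mu, forall t : measurableTypeR R, A t -> forall k : nat, exists i : nat,
    forall s : R, `|s| <= i.+1%:R^-1 ->
      exists2 s', `|s' - s| <= `|s| / k.+1%:R & A (t + s')}.
Proof.
move=> mA; have := lebesgue_density mA.
apply: aeS => t + At k.
rewrite indicE mem_set// => /fine_cvgP[].
move=> /nbhs_ballP[d1 /= d10 fin1] /cvgrPdist_lt.
(* Half the fraction occupied by a gap: its length 2 |s| / (k + 1) out of the length 4 |s| of the
   surrounding ball is [2 * c]. *)
pose c : R := (4 * k.+1%:R)^-1.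
have c0 : 0 < c by rewrite invr_gt0 mulr_gt0.
move=> /(_ _ c0)/nbhs_ballP[d2 /= d20 H].
pose dl := Num.min d1 d2 / 3.
have dl0 : 0 < dl by rewrite divr_gt0// lt_min d10.
have [i _ /(_ i (leqnn _)) Hi] := near_infty_natSinv_lt (PosNum dl0).
exists i => s si; apply: contrapT => nex.
have [s0|s0] := eqVneq s 0.
  by apply: nex; exists 0; rewrite ?addr0// s0 subrr normr0 mul0r.
have {}s0 : 0 < `|s| by rewrite normr_gt0.
pose r := 2 * `|s|.
have r0 : 0 < r by rewrite mulr_gt0.
have rd : r < 3 * dl by rewrite /r; have := le_lt_trans si Hi => /=; lra.
have rd1 : r < d1 by rewrite (lt_le_trans rd)// mulrC divfK// ge_min lexx.
have rd2 : r < d2 by rewrite (lt_le_trans rd)// mulrC divfK// ge_min lexx orbT.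
have br d : r < d -> ball (0 : R) d r.
  by move=> ?; rewrite /ball/= sub0r normrN gtr0_norm.
have := H _ (br _ rd2) r0.
have := fin1 _ (br _ rd1) r0.
set B : set (measurableTypeR R) := ball t r.
pose q := `|s| / k.+1%:R.
pose J : set (measurableTypeR R) := ball (t + s) q.
have k1 : q <= `|s|.
  by rewrite /q ler_pdivrMr// ler_peMr// ler1n.
have JB : J `<=` B.
  move=> z; rewrite /J /B /ball/= => h.
  have -> : t - z = (t + s - z) - s by ring.
  by rewrite (le_lt_trans (ler_normB _ _))//; move: k1 h; rewrite /r; lra.
have AJ : A `&` B `<=` B `\` J.
  move=> z [Az Bz]; split=> // Jz; apply: nex; exists (z - t); last first.
    by rewrite addrCA subrr addr0.
  move: Jz; rewrite /J /ball/= => /ltW; congr (_ <= _).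
  by rewrite -normrN; congr `|_|; ring.
have mB : measurable B by exact: measurable_ball.
have mJ : measurable J by exact: measurable_ball.
have s1 : 0 <= q by rewrite /q divr_ge0.
have muB : mu B = (r *+ 2)%:E by rewrite /B lebesgue_measure_ball ?ltW.
have muJ : mu J = (q *+ 2)%:E by rewrite /J lebesgue_measure_ball.
have mAB : (mu (A `&` B) <= ((r *+ 2) - q *+ 2)%:E)%E.
  apply: (@le_trans _ _ (mu (B `\` J))).
    apply: le_mu => //; [exact: measurableI|exact: measurableD].
  rewrite measureD//; last by rewrite [ltLHS]muB ltry.
  by rewrite setIidr// [X in (X - _ <= _)%E]muB [X in (_ - X <= _)%E]muJ -EFinB.
rewrite [X in (_ / X)%E]muB inver mulrn_eq0/= gt_eqF//.
have mABfin : mu (A `&` B) \is a fin_num.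
  rewrite ge0_fin_numE//; exact: le_lt_trans mAB (ltry _).
rewrite -(fineK mABfin) -EFinM/= => _.
move: mAB; rewrite -(fineK mABfin) lee_fin.
set m := fine _ => mAB.
rewrite ltr_norml => /andP[_]; apply: porous_gap => //.
rewrite ler_pdivrMr ?pmulrn_rgt0// (le_trans mAB)// /r /c /q.
by rewrite porous_ratio// pnatr_eq0.
Qed.
End lipschitz_line.

(** * Countable quantifiers and null sets of products *)

Section measurable_quantifiers.
Context d (T : measurableType d) (I : countType).

Lemma measurable_forall (A : I -> set T) : (forall i, measurable (A i)) ->
  measurable [set x | forall i, A i x].
Proof.
move=> mA; rewrite (_ : [set _ | _] = ~` \bigcup_i ~` A i).
  apply: measurableC; apply: countable_bigcupT_measurable; first exact: countableP.
  by move=> i; exact: measurableC.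
apply/seteqP; split => x /=; first by move=> h [i _]; apply; exact: h.
by move=> h i; apply: contrapT => nA; apply: h; exists i.
Qed.

Lemma measurable_exists (A : I -> set T) : (forall i, measurable (A i)) ->
  measurable [set x | exists i, A i x].
Proof.
move=> mA; rewrite (_ : [set _ | _] = \bigcup_i A i).
  by apply: countable_bigcupT_measurable; first exact: countableP.
by apply/seteqP; split => x /= [i]; [exists i|exists i].
Qed.

End measurable_quantifiers.

Lemma measurable_imply d (T : measurableType d) (A B : set T) :
  measurable A -> measurable B -> measurable [set x | A x -> B x].
Proof.
move=> mA mB; rewrite (_ : [set _ | _] = ~` A `|` B).
  by apply: measurableU => //; exact: measurableC.
apply/seteqP; split => x /=; last by case=> //; tauto.
by move=> h; have [/h|] := pselect (A x); [right|left].
Qed.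

Lemma ae_forall_countable d (T : measurableType d) (R : realType) (I : countType)
    (mu : {measure set T -> \bar R}) (P : I -> T -> Prop) :
  (forall i, {ae mu, forall x, P i x}) -> {ae mu, forall x, forall i, P i x}.
Proof.
move=> aeP; have : {ae mu, forall x, forall n : nat, forall i, pickle i = n -> P i x}.
  apply: ae_foralln => n.
  have [[i ipn]|ni] := pselect (exists i : I, pickle i = n).
    apply: (aeS _ (aeP i)) => x Pix j.
    by rewrite -ipn => /(pcan_inj pickleK) ->.
  by apply: aeW => x i ipn; exfalso; apply: ni; exists i.
by apply: aeS => x + i => /(_ _ _ erefl).
Qed.

Section product_null.
Context d1 d2 (T1 : measurableType d1) (T2 : measurableType d2) (R : realType).
Variable m1 : {sigma_finite_measure set T1 -> \bar R}.
Variable m2 : {sigma_finite_measure set T2 -> \bar R}.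

Lemma product_null_xsection (A : set (T1 * T2)) :
  (forall x, m2 (xsection A x) = 0)%E -> (m1 \x m2)%E A = 0%E.
Proof. by move=> A0; apply: integral0_eq => x _ /=; exact: A0. Qed.

(** The product measure is defined by integrating over sections at a fixed first coordinate.
    Uniqueness on rectangles gives the other order, needed when a property is known for each fixed
    second coordinate. *)
Lemma product_measure_ysection (A : set (T1 * T2)) : measurable A ->
  (m1 \x m2)%E A = (\int[m2]_y m1 (ysection A y))%E.
Proof.
move=> mA; rewrite (@product_measure_unique _ _ _ _ _ m1 m2 (m1 \x^ m2)%E)//.
by move=> B C mB mC; exact: product_measure2E.
Qed.

Lemma product_null_ysection (A : set (T1 * T2)) : measurable A ->
  (forall y, m1 (ysection A y) = 0)%E -> (m1 \x m2)%E A = 0%E.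
Proof.
by move=> mA A0; rewrite product_measure_ysection//; apply: integral0_eq => y _; exact: A0.
Qed.

End product_null.

Section rV_topology.
Context {R : realType} {n : nat}.

Lemma nbhs_rVP (x : 'rV[R]_n) (A : set 'rV[R]_n) :
  nbhs x A <-> exists2 e : R, 0 < e & forall y, `|y - x| < e -> A y.
Proof.
split.
  move=> /nbhs_ballP[e /= e0 H]; exists e => // y yx; apply: H.
  by rewrite -ball_normE/= distrC.
move=> [e e0 H]; apply/nbhs_ballP; exists e => //= y.
by rewrite -ball_normE/= distrC => /H.
Qed.

Lemma closed_rV (A : set 'rV[R]_n) :
  (forall x, ~ A x -> exists2 e : R, 0 < e & forall y, `|y - x| < e -> ~ A y) ->
  closed A.
Proof.
move=> H; rewrite -[X in closed X]setCK; apply: open_closedC; rewrite openE => x nx.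
by apply/nbhs_rVP; have [e e0 h] := H x nx; exists e.
Qed.

Lemma closed_rVP (A : set 'rV[R]_n) : closed A ->
  forall x, ~ A x -> exists2 e : R, 0 < e & forall y, `|y - x| < e -> ~ A y.
Proof.
move=> cA x nx; have : nbhs x (~` A).
  by apply: open_nbhs_nbhs; split => //; exact: closed_openC.
by move=> /nbhs_rVP.
Qed.

Lemma closed_measurable_rV (A : set 'rV[R]_n) : closed A -> measurable A.
Proof.
by move=> cA; rewrite -(setCK A); apply: measurableC; apply: sub_sigma_algebra; exact: closed_openC.
Qed.

Lemma continuous_measurable_rV (f : 'rV[R]_n -> R) : continuous f ->
  measurable_fun setT f.
Proof.
move=> cf; apply: (measurability _ (RGenOpens.measurableE R)).
move=> _ [_ [a [b ->] <-]]; rewrite setTI; apply: sub_sigma_algebra.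
by apply: open_comp; [move=> v _; exact: cf|exact: interval_open].
Qed.

Lemma closed_forall (T : topologicalType) (I : Type) (P : I -> Prop) (A : I -> set T) :
  (forall i, P i -> closed (A i)) -> closed [set x | forall i, P i -> A i x].
Proof.
move=> cA; rewrite (_ : [set _ | _] = \bigcap_(i in [set i | P i]) A i).
  by apply: closed_bigI => i; exact: cA.
by apply/seteqP; split.
Qed.

Lemma closed_leP (T : topologicalType) (f : T -> R) (c : R) : continuous f ->
  closed [set x | f x <= c].
Proof.
move=> cf; rewrite (_ : [set _ | _] = f @^-1` `]-oo, c]%classic).
  by apply: preimage_closed => [x _|]; [exact: cf|exact: lray_closed].
by apply/seteqP; split => x /=; rewrite in_itv.
Qed.

Lemma lipschitz_continuous_rV (f : 'rV[R]_n -> R) (L : R) :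
  (forall x y, `|f x - f y| <= L * `|x - y|) -> continuous f.
Proof.
move=> fL x; pose M := `|L| + 1; have M0 : 0 < M by rewrite ltr_wpDl.
move=> A /nbhs_ballP[e /= e0 xA].
apply/nbhs_rVP; exists (e / (2 * M)); first by rewrite divr_gt0// mulr_gt0.
move=> y /ltW yx; apply: xA; rewrite -ball_normE/=; apply: (@le_lt_trans _ _ (e / 2)); last by rewrite ltr_pdivrMr// ltr_pMr// ltr1n.
 rewrite (le_trans (fL x y))// (@le_trans _ _ (M * `|x - y|))//.
  by rewrite ler_wpM2r// (le_trans (ler_norm _))// lerDl.
by rewrite -ler_pdivlMl// mulrC distrC -mulrA -invfM.
Qed.

End rV_topology.

(** The error budget of [good_rV_diff]: [2 * M + 2] counts two Lipschitz errors [M * q] and two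
    slope errors [q], all relative to the length [w] of the increment. *)
Lemma ler_norm_add4 (R : realFieldType) (M q a e w k t1 t2 t3 t4 : R) :
  0 <= M -> 0 <= q -> q * (2 * M + 2) <= e -> 0 <= w -> a <= w -> k <= w ->
  `|t1| <= M * (q * a) -> `|t2| <= q * k -> `|t3| <= M * (q * a) ->
  `|t4| <= q * a -> `|t1 + t2 + t3 + t4| <= e * w.
Proof.
move=> M0 q0 qe w0 aw kw h1 h2 h3 h4.
apply: (@le_trans _ _ (`|t1| + `|t2| + `|t3| + `|t4|)).
  by rewrite !(le_trans (ler_normD _ _))// !lerD// !(le_trans (ler_normD _ _))// lerD// ler_normD.
have := ler_wpM2r w0 qe; have := ler_wpM2l q0 aw; have := ler_wpM2l q0 kw.
have := ler_wpM2l M0 (ler_wpM2l q0 aw); nra.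
Qed.

Section cons_rV_theory.
Context {R : realType} {n : nat}.
Local Notation cons v t := (@cons_rV R n (v, t)).

Lemma cons_rVD (u v : 'rV[R]_n) (s t : R) :
  cons (u + v) (s + t) = cons u s + cons v t.
Proof.
apply/rowP => i; have [j ->|->] := unliftP ord0 i;
  by rewrite !mxE ?liftK ?unlift_none/= ?mxE.
Qed.

Lemma cons_rVB (u v : 'rV[R]_n) (s t : R) :
  cons u s - cons v t = cons (u - v) (s - t).
Proof. by apply/eqP; rewrite subr_eq -cons_rVD !subrK. Qed.

Lemma cons_rV0 (v : 'rV[R]_n) t : (cons v t) 0 ord0 = t.
Proof. by rewrite mxE unlift_none. Qed.

Lemma cons_rV_lift (v : 'rV[R]_n) t j : (cons v t) 0 (lift ord0 j) = v 0 j.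
Proof. by rewrite mxE liftK. Qed.

Definition rV_tail (w : 'rV[R]_n.+1) : 'rV[R]_n := \row_j w 0 (lift ord0 j).

Lemma cons_rV_eta (w : 'rV[R]_n.+1) : w = cons (rV_tail w) (w 0 ord0).
Proof.
apply/rowP => i; have [j ->|->] := unliftP ord0 i;
  by rewrite !mxE ?liftK ?unlift_none/= ?mxE.
Qed.

Lemma ler_norm_tail (w : 'rV[R]_n.+1) : `|rV_tail w| <= `|w|.
Proof. by apply: ler_norm_rV => // i; rewrite mxE ler_norm_coord. Qed.

Lemma ler_norm_cons (v : 'rV[R]_n) t a : `|v| <= a -> `|t| <= a -> `|cons v t| <= a.
Proof.
move=> va ta; apply: ler_norm_rV => [|i]; first exact: le_trans ta.
rewrite mxE/=; case: unliftP => [j|] _ //=.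
by rewrite (le_trans (ler_norm_coord v j)).
Qed.

Lemma dotprod_cons (u v : 'rV[R]_n) (s t : R) :
  dotprod (cons u s) (cons v t) = s * t + dotprod u v.
Proof.
rewrite dotprodE big_ord_recl !cons_rV0; congr (_ + _).
by apply: eq_bigr => i _; rewrite !cons_rV_lift.
Qed.

End cons_rV_theory.

Lemma rat_approx (R : realType) (x e : R) : 0 < e -> exists q : rat, `|x - ratr q| <= e.
Proof.
move=> e0; have [|q] := @rat_in_itvoo R (x - e) (x + e); first by rewrite ltrD2l gtrN.
rewrite in_itv/= => qi; exists q; rewrite distrC ltW// ltr_distl//.
Qed.

Lemma rat_approx_rV (R : realType) n (c : 'rV[R]_n) (e : R) : 0 < e ->
  exists q : 'rV[rat]_n, forall h,
    `|dotprod c h - dotprod (map_mx ratr q) h| <= e * `|h|.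
Proof.
move=> e0; have e1 : 0 < e / n.+1%:R by rewrite divr_gt0.
pose q := \row_i projT1 (cid (rat_approx (c 0 i) e1)).
exists q => h; rewrite -dotprodBl dotprodE (le_trans (ler_norm_sum _ _ _))//.
apply: (@le_trans _ _ (\sum_(i < n) (e / n.+1%:R * `|h|))).
  apply: ler_sum => i _; rewrite normrM ler_pM ?ler_norm_coord// !mxE.
  by case: cid.
rewrite sumr_const card_ord -[_ *+ n]mulr_natl mulrA ler_wpM2r// mulrCA.
by apply: ler_piMr; [exact: ltW|rewrite ler_pdivrMr// mul1r ler_nat].
Qed.

Lemma natSinv_le (R : realType) (e : R) : 0 < e -> exists j : nat, j.+1%:R^-1 <= e.
Proof.
move=> e0; have [j _ /(_ j (leqnn _)) /= Hj] := near_infty_natSinv_lt (PosNum e0).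
by exists j; exact: ltW.
Qed.

(** * Almost everywhere differentiability by induction on the dimension *)

Section rademacher.
Context {R : realType}.

(** The slope [c] may depend on [e]. It can then be taken rational at each precision, so that the
    property becomes a countable combination of measurable conditions; [rV_diff_slope] recovers a
    single slope. *)
Definition rV_diff n (f : 'rV[R]_n -> R) (x : 'rV[R]_n) : Prop :=
  forall e : R, 0 < e -> exists c : 'rV[R]_n, exists2 dl : R, 0 < dl &
    forall h, `|h| <= dl -> `|f (x + h) - f x - dotprod c h| <= e * `|h|.

Lemma rV_diff_rat n (f : 'rV[R]_n -> R) x : rV_diff f x ->
  forall m : nat, exists c : 'rV[rat]_n, exists j : nat, forall h : 'rV[R]_n,
    `|h| <= j.+1%:R^-1 ->
    `|f (x + h) - f x - dotprod (map_mx ratr c) h| <= m.+1%:R^-1 * `|h|.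
Proof.
move=> fx m; have e0 : 0 < (2 * m.+1%:R)^-1 :> R by rewrite invr_gt0 mulr_gt0.
have [c [dl dl0 H]] := fx _ e0.
have [q Hq] := rat_approx_rV c e0; have [j Hj] := natSinv_le dl0.
exists q, j => h hj.
rewrite (_ : _ - _ = f (x + h) - f x - dotprod c h +
  (dotprod c h - dotprod (map_mx ratr q) h)); last by ring.
rewrite (le_trans (ler_normD _ _))//.
rewrite (le_trans (lerD (H h (le_trans hj Hj)) (Hq h)))// -mulrDl.
by rewrite -mulr2n -[_ *+ 2]mulr_natl invfM mulrA divff// mul1r.
Qed.

Section rademacher_step.
Variables (n : nat) (f : 'rV[R]_n.+1 -> R) (L : R).
Hypothesis fL : forall x y, `|f x - f y| <= L * `|x - y|.
Local Notation cons v t := (@cons_rV R n (v, t)).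

Let cf : continuous f. Proof. exact: lipschitz_continuous_rV fL. Qed.

Let E (c : 'rV[rat]_n) (m j : nat) : set 'rV[R]_n.+1 :=
  [set u | forall h : 'rV[R]_n, `|h| <= j.+1%:R^-1 ->
    `|f (u + cons h 0) - f u - dotprod (map_mx ratr c) h| <= m.+1%:R^-1 * `|h|].

Let D (b : rat) (m j : nat) : set 'rV[R]_n.+1 :=
  [set u | forall s : R, `|s| <= j.+1%:R^-1 ->
    `|f (u + cons 0 s) - f u - ratr b * s| <= m.+1%:R^-1 * `|s|].

Let S (A : set 'rV[R]_n.+1) (k i : nat) : set 'rV[R]_n.+1 :=
  [set u | forall s : R, `|s| <= i.+1%:R^-1 ->
    exists2 s', `|s' - s| <= `|s| / k.+1%:R & A (u + cons 0 s')].

Let cfsub (v : 'rV[R]_n.+1) (c : R) : continuous (fun u : 'rV[R]_n.+1 => `|f (u + v) - f u - c|).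
Proof.
apply: (@lipschitz_continuous_rV _ _ _ (2 * L)) => x y.
rewrite (le_trans (ler_dist_dist _ _))//.
rewrite (_ : _ - _ = (f (x + v) - f (y + v)) - (f x - f y)); last by ring.
rewrite (le_trans (ler_normB _ _))// mulr2n mulrDl !mul1r mulrDl lerD//.
by rewrite (le_trans (fL _ _))// opprD addrACA subrr addr0.
Qed.

Let closedE c m j : closed (E c m j).
Proof. by apply: closed_forall => h _; apply: closed_leP; exact: cfsub. Qed.

Let closedD c m j : closed (D c m j).
Proof. by apply: closed_forall => h _; apply: closed_leP; exact: cfsub. Qed.

(** The witness [s'] ranges over a compact interval, so by the tube lemma the absence of a witness
    is an open condition on the base point. *)
Let closedS A k i : closed A -> closed (S A k i).
Proof.
move=> cA; apply: closed_forall => s _; apply: closed_rV => u /= nu.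
pose r := `|s| / k.+1%:R.
have := @segment_compact R (s - r) (s + r) => /compact_near_coveringP.
move=> /(_ _ (nbhs u) (fun u' s' => ~ A (u' + cons 0 s')) (nbhs_filter u)).
have H (s' : R) : `[s - r, s + r]%classic s' <-> `|s' - s| <= r.
  by rewrite /= in_itv/= ler_distl.
suff h : forall x : R, `[s - r, s + r]%classic x ->
    \forall x' \near x & u' \near nbhs u, ~ A (u' + cons 0 x').
  move=> /(_ h)/nbhs_rVP[e e0 He]; exists e => // y /He ye [s' /H /ye]; exact.
move=> s' /H s's.
have [|e e0 He] := closed_rVP cA (x := u + cons 0 s').
  by move=> As'; apply: nu; exists s'.
have e2 : 0 < e / 2 by rewrite divr_gt0.
exists (ball s' (e / 2), [set u' | `|u' - u| < e / 2]) => /=.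
  by split; [exact: nbhsx_ballx|apply/nbhs_rVP; exists (e / 2)].
move=> [x' u'] /= [bx bu]; apply: He.
rewrite opprD addrACA [e]splitr (le_lt_trans (ler_normD _ _))// ltr_leD//.
rewrite cons_rVB subrr.
by apply: ler_norm_cons; rewrite ?normr0 1?ltW// distrC.
Qed.

(* A point where [f] has slopes along both factors need not be a point of
   differentiability.  The third condition supplies it: near [u] on the line in the
   first coordinate, points that share the slope [c] of [u] leave no large gaps. *)
Let good : set 'rV[R]_n.+1 := [set u |
  [/\ forall m, exists c, exists j, E c m j u,
      forall m, exists b, exists j, D b m j u &
      forall c m j, E c m j u -> forall k, exists i, S (E c m j) k i u]].

(** The increment (h, s) is taken through a point u + (0, s') with s' close to s at which the slope
    [c] along the other coordinates still holds with the uniform radius 1 / (j + 1). Moving between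
    s and s' costs a Lipschitz error twice, which the absence of gaps makes small relative to
    |s|. *)
Let good_rV_diff u : good u -> rV_diff f u.
Proof.
move=> [gE gD gS] e e0.
pose M := `|L| + 1; have M0 : 0 < M by rewrite ltr_wpDl.
have fM x y : `|f x - f y| <= M * `|x - y|.
  by rewrite (le_trans (fL x y))// ler_wpM2r// (le_trans (ler_norm _))// lerDl.
have d0 : 0 < e / (2 * M + 2) by rewrite divr_gt0// addr_gt0// mulr_gt0.
have [m _ /(_ m (leqnn _)) /= Hm] := near_infty_natSinv_lt (PosNum d0).
have [c [j Ej]] := gE m; have [b [j' Dj]] := gD m.
have [i Si] := gS c m j Ej m.
exists (cons (map_mx ratr c) (ratr b)).
pose dl : R := Num.min j.+1%:R^-1 (Num.min j'.+1%:R^-1 i.+1%:R^-1).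
exists dl; first by rewrite !lt_min !invr_gt0 !ltr0n.
move=> w; rewrite !le_min => /andP[wj /andP[wj' wi]].
rewrite {1 2}(cons_rV_eta w) dotprod_cons.
set h := rV_tail w; set s := w 0 ord0.
have hw : `|h| <= `|w| by exact: ler_norm_tail.
have sw : `|s| <= `|w| by exact: ler_norm_coord.
have [s' s's Es'] := Si s (le_trans sw wi).
have := Es' h (le_trans hw wj).
have := Dj s (le_trans sw wj').
have H v : `|f (u + cons v s) - f (u + cons v s')| <= M * (m.+1%:R^-1 * `|s|).
  rewrite (le_trans (fM _ _))// ler_wpM2l ?(ltW M0)// (@le_trans _ _ `|s' - s|)//.
    rewrite opprD addrACA subrr add0r cons_rVB subrr.
    by apply: ler_norm_cons; rewrite ?normr0// distrC.
  by rewrite mulrC.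
have h1 := H 0; have h2 := H h.
have E1 : u + cons h s' = u + cons 0 s' + cons h 0.
  by rewrite -addrA -cons_rVD add0r addr0.
rewrite E1 in h2 => h3 h4.
have Hq : m.+1%:R^-1 * (2 * M + 2) <= e.
  by rewrite -ler_pdivlMr ?ltW// addr_gt0// mulr_gt0.
have -> : f (u + cons h s) - f u - (ratr b * s + dotprod (map_mx ratr c) h) =
  (f (u + cons h s) - f (u + cons 0 s' + cons h 0)) +
  (f (u + cons 0 s' + cons h 0) - f (u + cons 0 s') - dotprod (map_mx ratr c) h) +
  (f (u + cons 0 s') - f (u + cons 0 s)) + (f (u + cons 0 s) - f u - ratr b * s).
  by ring.
apply: (ler_norm_add4 (ltW M0) _ Hq _ sw hw) => //.
by rewrite distrC.
Qed.

Let mE c m j : measurable (E c m j). Proof. exact: closed_measurable_rV. Qed.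
Let mD c m j : measurable (D c m j). Proof. exact: closed_measurable_rV. Qed.
Let mS c m j k i : measurable (S (E c m j) k i).
Proof. by apply: closed_measurable_rV; exact: closedS. Qed.

Let good1 : set 'rV[R]_n.+1 := [set u | forall m, exists c, exists j, E c m j u].
Let good2 : set 'rV[R]_n.+1 := [set u | forall m, exists b, exists j, D b m j u].
Let good3 : set 'rV[R]_n.+1 := [set u | forall c m j, E c m j u ->
  forall k, exists i, S (E c m j) k i u].

Let mgood1 : measurable good1.
Proof. by do 3 (apply: measurable_forall => ? || apply: measurable_exists => ?). Qed.

Let mgood2 : measurable good2.
Proof. by do 3 (apply: measurable_forall => ? || apply: measurable_exists => ?). Qed.

Let mgood3 : measurable good3.
Proof.
do 3 apply: measurable_forall => ?; apply: measurable_imply => //.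
by apply: measurable_forall => ?; apply: measurable_exists.
Qed.

Hypothesis IH : forall g : 'rV[R]_n -> R,
  (forall x y, `|g x - g y| <= L * `|x - y|) ->
  {ae @leb R n, forall x, rV_diff g x}.

Let cons_pre (A : set 'rV[R]_n.+1) : measurable A ->
  measurable (@cons_rV R n @^-1` A).
Proof.
by move=> mA; rewrite -[X in measurable X]setTI; exact: measurable_cons_rV.
Qed.

(** For a fixed first coordinate t the section of f is Lipschitz on the space of dimension n, and
    the induction hypothesis applies to it. *)
Let null1 : leb (~` good1) = 0%E.
Proof.
rewrite [LHS]lebesgue_rVS.
apply: (@product_null_ysection _ _ _ _ _ (@leb R n) (@lebesgue_measure R)).
  by apply: cons_pre; exact: measurableC.
move=> t; apply: measure_negligible.
  by apply: measurable_ysection; apply: cons_pre; exact: measurableC.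
have : {ae @leb R n, forall v, rV_diff (fun v => f (cons v t)) v}.
  apply: IH => x y; rewrite (le_trans (fL _ _))// cons_rVB subrr.
  (* The sign of [L] is not given; distinct points force it to be nonnegative. *)
  have [xy0|xy0] := eqVneq (x - y) 0.
    rewrite xy0 (_ : cons 0 0 = 0) ?normr0//.
    by apply/rowP => i; have [j ->|->] := unliftP ord0 i; rewrite !mxE ?liftK ?unlift_none/= ?mxE.
  have xy_gt0 : 0 < `|x - y| by rewrite normr_gt0.
  have L0 : 0 <= L.
    have := fL (cons x t) (cons y t) => /(le_trans (normr_ge0 _)).
    rewrite pmulr_lge0// normr_gt0; apply: contra xy0 => /eqP h.
    apply/eqP/rowP => j; have := congr1 (fun u : 'rV[R]_n.+1 => u 0 (lift ord0 j)) h.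
    by rewrite !mxE liftK/=.
  by rewrite ler_wpM2l//; apply: ler_norm_cons; rewrite ?normr0.
apply: negligibleS => v /=; rewrite /ysection/= inE/=; apply: contra_not => fv m.
have [q [j H]] := rV_diff_rat fv m; exists q, j => h /H.
by rewrite -cons_rVD addr0.
Qed.

Let null2 : leb (~` good2) = 0%E.
Proof.
rewrite [LHS]lebesgue_rVS.
apply: (@product_null_xsection _ _ _ _ _ (@leb R n) (@lebesgue_measure R)) => v.
apply: measure_negligible.
  by apply: measurable_xsection; apply: cons_pre; exact: measurableC.
have H : {ae @lebesgue_measure R, forall t : measurableTypeR R, line_diff (fun t => f (cons v t)) t}.
  apply: (@lipschitz_ae_line_diff R _ `|L|) => x y; rewrite (le_trans (fL _ _))// (@le_trans _ _ (`|L| * `|cons v x - cons v y|))//.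
    by rewrite ler_wpM2r// ler_norm.
  rewrite ler_wpM2l// cons_rVB subrr.
  by apply: ler_norm_cons; rewrite ?normr0.
move: H; apply: negligibleS => t /=; rewrite /xsection/= inE/=; apply: contra_not => -[b fv] m.
have e0 : 0 < (2 * m.+1%:R)^-1 :> R by rewrite invr_gt0 mulr_gt0.
have [dl dl0 H] := fv _ e0.
have [q Hq] := rat_approx b e0; have [j Hj] := natSinv_le dl0.
exists q, j => s sj.
rewrite -cons_rVD addr0.
rewrite (_ : _ - _ = f (cons v (t + s)) - f (cons v t) - b * s + (b - ratr q) * s); last by ring.
rewrite (le_trans (ler_normD _ _))//.
rewrite (le_trans (lerD (H s (le_trans sj Hj)) (_ : _ <= (2 * m.+1%:R)^-1 * `|s|)))//.
  by rewrite normrM ler_wpM2r.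
rewrite -mulrDl.
by rewrite -mulr2n -[_ *+ 2]mulr_natl invfM mulrA divff// mul1r.
Qed.

(** Rational slopes leave countably many sets [E c m j]. On each line in the first coordinate,
    almost every point of the section of such a set satisfies the conclusion of [ae_not_porous]. *)
Let null3 : leb (~` good3) = 0%E.
Proof.
rewrite [LHS]lebesgue_rVS.
apply: (@product_null_xsection _ _ _ _ _ (@leb R n) (@lebesgue_measure R)) => v.
apply: measure_negligible.
  by apply: measurable_xsection; apply: cons_pre; exact: measurableC.
have : {ae @lebesgue_measure R, forall t : measurableTypeR R,
    forall cmj : 'rV[rat]_n * nat * nat,
    E cmj.1.1 cmj.1.2 cmj.2 (cons v t) -> forall k : nat, exists i : nat,
    forall s : R, `|s| <= i.+1%:R^-1 ->
      exists2 s', `|s' - s| <= `|s| / k.+1%:R &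
        E cmj.1.1 cmj.1.2 cmj.2 (cons v (t + s'))}.
  apply: ae_forall_countable => -[[c m] j] /=.
  apply: (@ae_not_porous R [set t : measurableTypeR R | E c m j (cons v t)]).
  have := measurable_xsection v (cons_pre (mE c m j)).
  by congr (measurable _); apply/seteqP; split => t; rewrite /xsection/= inE.
apply: negligibleS => t /=; rewrite /xsection/= inE/=; apply: contra_not => h c m j Et k.
have [i Hi] := h (c, m, j) Et k; exists i => s /Hi[s' s's Es']; exists s' => //.
by rewrite -cons_rVD addr0.
Qed.

Lemma rV_diff_step : {ae @leb R n.+1, forall x, rV_diff f x}.
Proof.
have : {ae @leb R n.+1, forall x, good x}.
  exists (~` good1 `|` ~` good2 `|` ~` good3); split.
  - by do 2 (apply: measurableU; last exact: measurableC); exact: measurableC.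
  - apply/eqP; rewrite eq_le measure_ge0 andbT.
    rewrite (le_trans (measureU2 _ _ _))//; [|exact: measurableC|].
    + by apply: measurableU; exact: measurableC.
    + rewrite [X in (_ + X <= _)%E]null3 adde0 (le_trans (measureU2 _ _ _))//; [exact: measurableC|exact: measurableC|].
      by rewrite [X in (X + _ <= _)%E]null1 [X in (_ + X <= _)%E]null2 adde0.
  - move=> u /= ng; apply: contrapT => /not_orP[/not_orP[/contrapT g1 /contrapT g2] /contrapT g3].
    by apply: ng.
by apply: aeS => u; exact: good_rV_diff.
Qed.

End rademacher_step.

Lemma lipschitz_ae_rV_diff n (f : 'rV[R]_n -> R) (L : R) :
  (forall x y, `|f x - f y| <= L * `|x - y|) -> {ae @leb R n, forall x, rV_diff f x}.
Proof.
elim: n f => [|n IH] f fL; last exact: rV_diff_step fL IH.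
apply: aeW => x e e0; exists 0, 1 => // h _.
have -> : h = 0 by apply/rowP => -[].
by rewrite addr0 subrr dotprod0r subr0 !normr0 mulr0.
Qed.
End rademacher.

(** * From approximate slopes to the differential *)

Section differentiability.
Context {R : realType} {n : nat}.
Implicit Types (f : 'rV[R]_n -> R) (x c h : 'rV[R]_n).

Let approx_slope f x (e : R) c := exists2 dl : R, 0 < dl &
  forall h, `|h| <= dl -> `|f (x + h) - f x - dotprod c h| <= e * `|h|.

Let norm_delta (t : R) i : 0 <= t -> `|t *: delta_mx 0 i : 'rV[R]_n| = t.
Proof.
move=> t0; apply/eqP; rewrite eq_le; apply/andP; split; last first.
  have := ler_norm_coord (t *: delta_mx 0 i) i.
  by rewrite !mxE !eqxx mulr1 ger0_norm.
apply: ler_norm_rV => // j; rewrite !mxE eqxx/=.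
by case: eqP => _; rewrite ?mulr1 ?mulr0 ?normr0// ger0_norm.
Qed.

Let approx_slope_close f x e1 c1 e2 c2 i : approx_slope f x e1 c1 ->
  approx_slope f x e2 c2 -> c1 0 i - e1 <= c2 0 i + e2.
Proof.
move=> [d1 d10 H1] [d2 d20 H2]; pose t := Num.min d1 d2.
have t0 : 0 < t by rewrite lt_min d10.
have := H1 (t *: delta_mx 0 i); rewrite norm_delta ?(ltW t0)// => /(_ _)/wrap[].
  by rewrite ge_min lexx.
have := H2 (t *: delta_mx 0 i); rewrite norm_delta ?(ltW t0)// => /(_ _)/wrap[].
  by rewrite ge_min lexx orbT.
rewrite !dotprodZr !dotprod_delta; set X := f _ - f x => h2 h1.
rewrite -(ler_pM2r t0); move: h1 h2; rewrite !ler_norml => /andP[a _] /andP[_ b].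
by move: a b; lra.
Qed.

(** Each slope [c] of tolerance [e] confines every coordinate of the true slope to the interval from
    c_i - e to c_i + e. These intervals are pairwise compatible, so the supremum of the lower ends
    lies in all of them. *)
Lemma rV_diff_slope f x : rV_diff f x ->
  exists c, forall e : R, 0 < e -> exists2 dl : R, 0 < dl &
    forall h, `|h| <= dl -> `|f (x + h) - f x - dotprod c h| <= e * `|h|.
Proof.
move=> fx.
pose S i := [set c.1 0 i - c.2 | c in [set c : 'rV[R]_n * R | approx_slope f x c.2 c.1]].
have [c0 S0] := fx 1 ltr01.
have Sub i e c : approx_slope f x e c -> ubound (S i) (c 0 i + e).
  by move=> h _ [[c1 e1]/= h1 <-]; exact: approx_slope_close h1 h.
have S_sup i e c : approx_slope f x e c -> `|sup (S i) - c 0 i| <= e.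
  move=> h; rewrite ler_norml; apply/andP; split.
    rewrite lerBrDr addrC; apply: ub_le_sup; last by exists (c, e).
    by exists (c 0 i + e); exact: Sub.
  rewrite lerBlDr addrC; apply: ge_sup; last exact: Sub.
  by exists (c 0 i - e); exists (c, e).
exists (\row_i sup (S i)) => e e0.
(* Of the n + 1 shares of [e], one pays for the approximate slope and one for each coordinate of its
   correction. *)
have e1 : 0 < e / n.+1%:R by rewrite divr_gt0.
have [c [dl dl0 H]] := fx _ e1; exists dl => // h hdl.
rewrite (_ : _ - _ = f (x + h) - f x - dotprod c h - dotprod (\row_i sup (S i) - c) h); last first.
  by rewrite dotprodBl; ring.
rewrite (le_trans (ler_normB _ _))//.
rewrite (@le_trans _ _ (e / n.+1%:R * `|h| + \sum_(i < n) (e / n.+1%:R * `|h|)))//.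
  apply: lerD; first exact: H.
  rewrite dotprodE (le_trans (ler_norm_sum _ _ _))//; apply: ler_sum => i _.
  rewrite normrM ler_pM ?ler_norm_coord// !mxE; apply: S_sup.
  by exists dl.
rewrite sumr_const card_ord -[_ *+ n]mulr_natl.
rewrite -[X in X + _]mul1r -mulrDl mulrA addrC natr1 mulrCA divff ?mulr1//.
Qed.

Lemma dotprod_is_linear c : linear (dotprod c : 'rV[R]_n -> R).
Proof. by move=> a u v; rewrite dotprodDr dotprodZr. Qed.

HB.instance Definition _ c := GRing.isLinear.Build R 'rV[R]_n R _ (dotprod c)
  (dotprod_is_linear c).

Lemma dotprod_continuous c : continuous (dotprod c : 'rV[R]_n -> R).
Proof.
apply: (@lipschitz_continuous_rV _ _ _ (enorm c * n%:R)) => u v.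
rewrite -dotprodBr (le_trans (normr_dotprod_le _ _))// -mulrA ler_wpM2l ?enorm_ge0//.
exact: ler_enorm_norm.
Qed.

Lemma rV_diffP f x : rV_diff f x -> differentiable f x /\
  forall e : R, 0 < e -> exists2 dl : R, 0 < dl &
    forall h, `|h| <= dl -> `|f (x + h) - f x - dotprod (gradient f x) h| <= e * `|h|.
Proof.
move=> /rV_diff_slope[c H].
have Hd : f \o shift x = cst (f x) + dotprod c +o_ (0 : 'rV[R]_n) id.
  apply/eqaddoP => e e0; have [dl dl0 {}H] := H _ e0.
  apply/nbhs_rVP; exists dl => // h; rewrite subr0 => /ltW/H.
  by rewrite /= !fctE opprD addrA (addrC h).
have dc : 'd f x = dotprod c :> (_ -> _).
  apply: diff_unique; [exact: dotprod_continuous|exact: Hd].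
have gc : gradient f x = c by apply/rowP => i; rewrite mxE dc dotprod_delta.
split; last by rewrite gc.
apply/diff_locallyP; rewrite dc; split; [exact: dotprod_continuous|exact: Hd].
Qed.

End differentiability.

Lemma measurable_leP d (T : measurableType d) (R : realType) (f : T -> R) (c : R) :
  measurable_fun setT f -> measurable [set x | f x <= c].
Proof.
by move=> mf; rewrite -[X in measurable X]setTI; apply: measurable_fun_le.
Qed.

Lemma measurable_imply_cst d (T : measurableType d) (P : Prop) (A : set T) :
  (P -> measurable A) -> measurable [set x | P -> A x].
Proof.
move=> mA; have [p|np] := pselect P.
  have -> : [set x | P -> A x] = A by apply/seteqP; split => x /=; tauto.
  exact: mA.
have -> : [set x | P -> A x] = setT by apply/seteqP; split => x /=; tauto.
exact: measurableT.
Qed.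

Lemma continuous_rVP (R : realType) n (f : 'rV[R]_n -> R) :
  continuous f <-> forall (x : 'rV[R]_n) (e : R), 0 < e -> exists2 dl : R, 0 < dl &
    forall y, `|y - x| < dl -> `|f x - f y| < e.
Proof.
split => [cf x e e0|H x A /nbhs_ballP[e /= e0 xA]].
  by have /nbhs_rVP := cf x _ (nbhsx_ballx (f x) e e0).
apply/nbhs_rVP; have [dl dl0 h] := H x e e0.
by exists dl => // y /h fy; exact: xA.
Qed.

Lemma continuous_addr_rV (R : realType) n (f : 'rV[R]_n -> R) (v : 'rV[R]_n) :
  continuous f -> continuous (fun x : 'rV[R]_n => f (x + v)).
Proof.
move=> /continuous_rVP cf; apply/continuous_rVP => x e e0.
have [dl dl0 H] := cf (x + v) e e0; exists dl => // y yx; apply: H.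
by rewrite opprD addrACA subrr addr0.
Qed.

Lemma continuous_subr_rV (R : realType) n (f g : 'rV[R]_n -> R) :
  continuous f -> continuous g -> continuous (fun x : 'rV[R]_n => f x - g x).
Proof. by move=> cf cg x; exact: (cvgB (cf x) (cg x)). Qed.

Lemma continuous_normr_rV (R : realType) n (f : 'rV[R]_n -> R) :
  continuous f -> continuous (fun x : 'rV[R]_n => `|f x|).
Proof. by move=> cf x; exact: (cvg_norm (cf x)). Qed.

(** * Caratheodory functions *)

Section caratheodory.
Context {R : realType} {n : nat} {dY} {Y : measurableType dY}.
Implicit Type F : 'rV[R]_n -> Y -> R.

Let rat_near (w : 'rV[R]_n) (e : R) : 0 < e ->
  exists q : 'rV[rat]_n, `|map_mx ratr q - w| <= e.
Proof.
move=> e0; exists (\row_i projT1 (cid (rat_approx (w 0 i) e0))).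
apply: ler_norm_rV => [|i]; first exact: ltW.
by rewrite !mxE distrC; case: cid.
Qed.

(** By continuity, F(w, y) < a holds exactly when F(q, y) stays below a by some margin 1 / (m + 1)
    for all rational q in some neighbourhood of w; only countably many sections F(q, .) occur. *)
Lemma caratheodory_measurable F (mF : forall w, measurable_fun setT (F w))
  (cF : forall y, continuous (F ^~ y)) :
  measurable_fun setT (fun u : 'rV[R]_n * Y => F u.1 u.2).
Proof.
apply: (measurability _ (RGenInftyO.measurableE R)) => _ [_ [a ->] <-].
rewrite setTI [X in measurable X](_ : _ = [set u : 'rV[R]_n * Y |
    exists m : nat, exists j : nat, forall q : 'rV[rat]_n,
     `|map_mx ratr q - u.1| < j.+1%:R^-1 -> F (map_mx ratr q) u.2 <= a - m.+1%:R^-1]).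
  apply: measurable_exists => m; apply: measurable_exists => j.
  apply: measurable_forall => q; apply: measurable_imply.
    rewrite [X in measurable X](_ : _ = fst @^-1` [set w | `|map_mx ratr q - w| < j.+1%:R^-1]); last by [].
    rewrite -[X in measurable X]setTI; apply: measurable_fst => //.
    apply: sub_sigma_algebra; rewrite (_ : [set _ | _] = ball (map_mx ratr q : 'rV[R]_n) j.+1%:R^-1).
      exact: ball_open.
    by rewrite -ball_normE.
  rewrite [X in measurable X](_ : _ = snd @^-1` [set y | F (map_mx ratr q) y <= a - m.+1%:R^-1]); last by [].
  rewrite -[X in measurable X]setTI; apply: measurable_snd => //.
  rewrite -[X in measurable X]setTI; apply: measurable_fun_le => //.
apply/seteqP; split=> [[w y]|[w y]] /=; rewrite in_itv/=.
  move=> Fa; have e0 : 0 < (a - F w y) / 2 by rewrite divr_gt0// subr_gt0.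
  have [m Hm] := natSinv_le e0; have [dl dl0 H] := (continuous_rVP _).1 (cF y) w _ e0.
  have [j Hj] := natSinv_le dl0; exists m, j => q qw.
  have := H _ (lt_le_trans qw Hj); rewrite ltr_norml => /andP[h _].
  by move: h Hm; set x3 := m.+1%:R^-1; clear; lra.
move=> [m [j H]].
have e0 : 0 < m.+1%:R^-1 / 2 :> R by rewrite divr_gt0.
have [dl dl0 Hd] := (continuous_rVP _).1 (cF y) w _ e0.
have e1 : 0 < Num.min (dl / 2) (j.+1%:R^-1 / 2) by rewrite lt_min !divr_gt0.
have [q] := rat_near w e1; rewrite le_min => /andP[qd qj].
have hf (x : R) : 0 < x -> x / 2 < x by move=> x0; rewrite ltr_pdivrMr// ltr_pMr// ltr1n.
have := H q (le_lt_trans qj (hf _ _)); rewrite invr_gt0 ltr0n => /(_ isT).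
have := Hd _ (le_lt_trans qd (hf _ dl0)); rewrite ltr_norml => /andP[_].
by move: e0; set x3 := m.+1%:R^-1; clear; lra.
Qed.

(** Slopes, radii and tolerances range over countable sets by [rV_diff_rat]; increments may be
    restricted to rational ones because the inequality is closed in h. *)
Lemma measurable_rV_diff F (mF : forall w, measurable_fun setT (F w))
  (cF : forall y, continuous (F ^~ y)) :
  measurable [set u : 'rV[R]_n * Y | rV_diff (F ^~ u.2) u.1].
Proof.
rewrite [X in measurable X](_ : _ = [set u : 'rV[R]_n * Y | forall m : nat,
   exists c : 'rV[rat]_n, exists j : nat, forall h : 'rV[rat]_n,
   `|map_mx ratr h : 'rV[R]_n| <= j.+1%:R^-1 ->
   `|F (u.1 + map_mx ratr h) u.2 - F u.1 u.2 - dotprod (map_mx ratr c) (map_mx ratr h)|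
   <= m.+1%:R^-1 * `|map_mx ratr h : 'rV[R]_n|]).
  apply: measurable_forall => m; apply: measurable_exists => c.
  apply: measurable_exists => j; apply: measurable_forall => h.
  apply: measurable_imply_cst => _; apply: measurable_leP.
  apply: measurableT_comp => //; apply: measurable_funB => //.
  apply: measurable_funB; last exact: caratheodory_measurable.
  apply: (@caratheodory_measurable (fun w y => F (w + map_mx ratr h) y)) => [w|y].
    exact: mF.
  exact: (continuous_addr_rV (cF y)).
apply/seteqP; split => -[w y] /= H m.
  by have [c [j Hj]] := rV_diff_rat H m; exists c, j => h; exact: Hj.
move=> m0; have [k Hk] := natSinv_le m0; have [c [j Hj]] := H k.
(* Half the radius, so that rational approximations of h still have norm at most 1 / (j + 1). *)
exists (map_mx ratr c); exists (j.+1%:R^-1 / 2); first by rewrite divr_gt0.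
move=> h hj.
pose g (h : 'rV[R]_n) := `|F (w + h) y - F w y - dotprod (map_mx ratr c) h| - m * `|h|.
suff : [set h | g h <= 0] h by rewrite /g/= subr_le0.
have cg : continuous g.
  apply: continuous_subr_rV.
    apply: continuous_normr_rV; apply: continuous_subr_rV; last exact: dotprod_continuous.
    apply: continuous_subr_rV; last by apply: (@lipschitz_continuous_rV _ _ _ 0) => *; rewrite subrr normr0 mul0r.
    by have := continuous_addr_rV (v := w) (cF y); under eq_fun do rewrite addrC.
  apply: (@lipschitz_continuous_rV _ _ _ m) => u v.
  by rewrite -mulrBr normrM (gtr0_norm m0) ler_pM2l// ler_dist_dist.
apply: contrapT => /(closed_rVP (closed_leP (c := 0) cg))[e e0 He].
have e1 : 0 < Num.min (e / 2) (j.+1%:R^-1 / 2) by rewrite lt_min !divr_gt0.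
have [q] := rat_near h e1; rewrite le_min => /andP[qe qj].
apply: (He (map_mx ratr q)); first by rewrite (le_lt_trans qe)// ltr_pdivrMr// ltr_pMr// ltr1n.
rewrite /= /g subr_le0 (le_trans (Hj q _))//; last by rewrite ler_wpM2r.
rewrite -[X in `|X|](subrK h) (le_trans (ler_normD _ _))//.
by rewrite [leRHS]splitr lerD.
Qed.

Lemma lipschitz_e_sup (f : 'rV[R]_n -> R) (L : R) : lipschitz_e f L ->
  forall x y, `|f x - f y| <= `|L| * n%:R * `|x - y|.
Proof.
move=> fL x y; rewrite (le_trans (fL x y))// -mulrA.
rewrite (le_trans (ler_wpM2r (enorm_ge0 _) (ler_norm L)))//.
by rewrite ler_wpM2l// ler_enorm_norm.
Qed.

Lemma lipschitz_e_continuous (f : 'rV[R]_n -> R) (L : R) :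
  lipschitz_e f L -> continuous f.
Proof. by move=> /lipschitz_e_sup; exact: lipschitz_continuous_rV. Qed.

(** Rademacher's theorem holds for each fixed y outside a null set. Measurability of the set of
    differentiability turns this into a statement about the product measure. *)
Lemma ae_rV_diff (P : probability Y R) F (C : Y -> R) :
  (forall w, measurable_fun setT (F w)) -> (forall y, continuous (F ^~ y)) ->
  {ae P, forall y, lipschitz_e (F ^~ y) (C y)} ->
  {ae (@leb R n \x P)%E, forall u, rV_diff (F ^~ u.2) u.1}.
Proof.
move=> mF cF FC; set A := [set u : 'rV[R]_n * Y | rV_diff (F ^~ u.2) u.1].
have mA : measurable (~` A) by apply: measurableC; exact: measurable_rV_diff.
exists (~` A); split => //.
rewrite (product_measure_ysection (@leb R n) P)//.
rewrite (@ae_eq_integral _ _ _ P setT (cst 0%E))//; first by rewrite integral0.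
  exact: measurable_fun_ysection.
apply: (aeS _ FC) => y /lipschitz_e_sup Fy _ /=.
apply: measure_negligible; first exact: measurable_ysection.
apply: negligibleS (lipschitz_ae_rV_diff Fy) => w /=.
by rewrite /ysection/= inE.
Qed.

End caratheodory.

(** * The uniform measure on a ball and its translates *)

Lemma expr_le_secant (R : realFieldType) (x : R) n : 0 <= x <= 1 ->
  (1 + x) ^+ n <= 1 + (2 ^+ n - 1) * x.
Proof.
move=> /andP[x0 x1]; elim: n => [|n IH]; first by rewrite !expr0 subrr mul0r addr0.
rewrite exprSr (le_trans (ler_wpM2r _ IH))// ?addr_ge0// exprSr.
have h : 0 <= (2 ^+ n - 1) * x by rewrite mulr_ge0// subr_ge0 exprn_ege1// ler1n.
by have := ler_wpM2l h x1; set A := 2 ^+ n; lra.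
Qed.

Lemma bernoulli_ineq (R : realFieldType) (x : R) n : 0 <= x <= 1 ->
  1 - n%:R * x <= (1 - x) ^+ n.
Proof.
move=> /andP[x0 x1]; elim: n => [|n IH]; first by rewrite expr0 mul0r subr0.
rewrite exprSr (le_trans _ (ler_wpM2r _ IH)) ?subr_ge0// -natr1.
have : 0 <= n%:R * x * x by rewrite !mulr_ge0.
by nra.
Qed.

(* The limit eps -> 0 of the bound given by the bump of width eps, with
   k = eps ^ 2. *)
Lemma ball_shift_limit (R : realType) (V rho s tau X : R) n : 0 <= V -> 0 < rho ->
  0 < s -> s ^+ 2 = n%:R -> 0 <= tau ->
  (forall eps : R, 0 < eps -> eps <= 4^-1 ->
    X <= 2 * (V * (1 - (1 - eps) ^+ n)) +
    V * ((1 + eps ^+ 2) ^+ n - (1 - eps - eps ^+ 2) ^+ n) *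
     (tau * (2 * ((1 + eps ^+ 2) * rho) / s + eps ^+ 2 * rho) /
      (rho ^+ 2 - ((1 - eps) * rho) ^+ 2))) ->
  X <= V * s * tau / rho.
Proof.
move=> V0 rho0 s0 s2 tau0 H.
have n0 : (0 < n%:R :> R) by rewrite -s2 exprn_gt0.
have n1 : (1 <= n%:R :> R) by move: n0; rewrite ltr0n ler1n.
(* In the shell volume the terms of order eps^2 come from Bernoulli's inequality (the 1) and from
   the chord bound for (1 + q)^n (the 2^n). *)
pose c : R := 1 + 2 ^+ n; have c1 : 1 <= c by rewrite lerDl exprn_ge0.
pose p := s^-1; have p0 : 0 < p by rewrite invr_gt0.
pose B := V * n%:R * tau / rho.
have B0 : 0 <= B by rewrite divr_ge0 ?(ltW rho0)// !mulr_ge0// ltW.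
(* The value of the bound at eps = 0 is [B * p], and [K] bounds its rate of growth in eps. The first
   summand comes from the two boundary layers, the second from the shell. *)
pose K := 2 * V * n%:R + B * ((p + 1) * (4 * c + 3)).
have K0 : 0 <= K.
  rewrite /K; apply: addr_ge0; first by rewrite !mulr_ge0// ltW.
  by apply: mulr_ge0 => //; apply: mulr_ge0; lra.
have BE : V * s * tau / rho = B * p.
  by rewrite /B /p -s2; field; rewrite !gt_eqF.
rewrite BE; apply/ler_addgt0Pr => e e0.
have K1 : 0 < K + 1 by rewrite ltr_wpDl.
pose eps := Num.min 4^-1 (e / (K + 1)).
have eps0 : 0 < eps by rewrite lt_min invr_gt0 divr_gt0// ltr0n.
have eps4 : eps <= 4^-1 by rewrite ge_min lexx.
have epsK : eps * K <= e.
  have : eps <= e / (K + 1) by rewrite ge_min lexx orbT.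
  by rewrite ler_pdivlMr// => /(le_trans _); apply; rewrite ler_wpM2l ?(ltW eps0)// lerDl.
apply: (le_trans (H _ eps0 eps4)); apply: (@le_trans _ _ (B * p + eps * K)); last by rewrite lerD2l.
set q := eps ^+ 2; have q0 : 0 <= q by rewrite sqr_ge0.
have qe : q <= eps / 4 by rewrite /q expr2 ler_wpM2l// ltW.
have b1 : 1 - (1 - eps) ^+ n <= n%:R * eps.
  by have := @bernoulli_ineq _ eps n; rewrite (ltW eps0)/=; lra.
have b2 : (1 + q) ^+ n - (1 - eps - q) ^+ n <= n%:R * eps * (1 + c * eps).
  have h1 := @expr_le_secant _ q n; have h2 := @bernoulli_ineq _ (eps + q) n.
  have {}h1 : (1 + q) ^+ n <= 1 + (2 ^+ n - 1) * q by apply: h1; rewrite q0; lra.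
  have {}h2 : 1 - n%:R * (eps + q) <= (1 - eps - q) ^+ n.
    by rewrite -addrA -opprD; apply: h2; apply/andP; split; lra.
  have h3 : 2 ^+ n * q <= n%:R * 2 ^+ n * q.
    by rewrite ler_wpM2r// ler_peMl// exprn_ge0.
  apply: (@le_trans _ _ (n%:R * (eps + q) + n%:R * 2 ^+ n * q)); first by lra.
  by rewrite le_eqVlt /c /q; apply/orP; left; apply/eqP; ring.
have dE : rho ^+ 2 - ((1 - eps) * rho) ^+ 2 = rho ^+ 2 * (eps * (2 - eps)) by ring.
have e2 : 0 < 2 - eps by lra.
have W : tau * (2 * ((1 + q) * rho) / s + q * rho) / (rho ^+ 2 - ((1 - eps) * rho) ^+ 2) =
   tau / (rho * eps) * ((2 * (1 + q) * p + q) / (2 - eps)).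
  by rewrite dE /p; field; rewrite !gt_eqF.
(* The estimate wanted for the shell term, divided by [B] and multiplied by [2 - eps]. Both sides
   start with [2 * p]; the other terms are compared through multiples of [g] and [g * c]. *)
have main : (1 + c * eps) * (2 * (1 + q) * p + q) <= (p + eps * ((p + 1) * (4 * c + 3))) * (2 - eps).
  pose g := eps * (p + 1); have g0 : 0 <= g by rewrite mulr_ge0 ?(ltW eps0)// addr_ge0 ?(ltW p0).
  have gc : 0 <= g * c by rewrite mulr_ge0// (le_trans ler01).
  have l1 : 2 * (1 + q) * p + q <= 2 * p + g / 2.
    by rewrite /g; have := ler_wpM2r (ltW p0) qe; have := mulr_ge0 (ltW eps0) (ltW p0); lra.
  have ce0 : 0 <= 1 + c * eps by rewrite addr_ge0// mulr_ge0 ?(ltW eps0)// (le_trans ler01).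
  apply: (le_trans (ler_wpM2l ce0 l1)).
  have l2 : c * eps * g <= c * g / 4.
    rewrite [leLHS](_ : _ = c * g * eps); last by ring.
    by rewrite ler_wpM2l// mulrC.
  have l3 : c * eps * p <= g * c.
    rewrite /g; have : 0 <= eps * c by rewrite mulr_ge0 ?(ltW eps0)// (le_trans ler01).
    by lra.
  have l4 : eps * p <= g by rewrite /g; lra.
  have l5 : g * eps <= g / 4 by rewrite ler_wpM2l.
  have l6 : g * c * eps <= g * c / 4 by rewrite ler_wpM2l.
  rewrite (_ : (p + eps * _) * _ = 2 * p - eps * p + 8 * (g * c) + 6 * g - 4 * (g * c * eps) - 3 * (g * eps)); last first.
    by rewrite /g; ring.
  rewrite (_ : (1 + _) * _ = 2 * p + g / 2 + 2 * (c * eps * p) + (c * eps * g) / 2); last by field.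
  have : c * g = g * c by ring.
  by lra.
rewrite (_ : B * p + eps * K = 2 * (V * (n%:R * eps)) +
  B * (p + eps * ((p + 1) * (4 * c + 3)))); last by rewrite /K; ring.
apply: lerD; first by rewrite ler_pM2l// ler_wpM2l.
rewrite W (le_trans (ler_wpM2r _ (ler_wpM2l V0 b2)))//.
  rewrite mulr_ge0// ?divr_ge0 ?mulr_ge0 ?(ltW rho0) ?(ltW eps0) ?(ltW e2)//.
  by rewrite !addr_ge0// ?mulr_ge0 ?addr_ge0 ?(ltW p0).
rewrite [leLHS](_ : _ = B * ((1 + c * eps) * (2 * (1 + q) * p + q) / (2 - eps))); last first.
  by rewrite /B; field; rewrite !gt_eqF.
by rewrite ler_wpM2l// ler_pdivrMr.
Qed.

(** * Volumes and moments of balls and shells *)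

Section ball_geometry.
Context {R : realType} {d : nat}.
Implicit Types (u v h z : 'rV[R]_d) (r s t : R).
Local Notation mu := (@leb R d).

Lemma enorm_continuous : continuous (enorm : 'rV[R]_d -> R).
Proof.
apply: (@lipschitz_continuous_rV _ _ _ d%:R) => u v.
by rewrite (le_trans (ler_enormB _ _))// ler_enorm_norm.
Qed.

Lemma measurable_enorm : measurable_fun setT (enorm : 'rV[R]_d -> R).
Proof. by apply: continuous_measurable_rV; exact: enorm_continuous. Qed.

Lemma measurable_dotprodr h : measurable_fun setT (dotprod ^~ h : 'rV[R]_d -> R).
Proof.
rewrite (_ : dotprod^~ h = dotprod h); last by apply/funext => u; rewrite dotprodC.
by apply: continuous_measurable_rV; exact: dotprod_continuous.
Qed.

Lemma measurable_eball r : measurable (eball r : set 'rV[R]_d).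
Proof. exact: measurable_leP measurable_enorm. Qed.
Hint Resolve measurable_eball : core.

Let box r : set 'rV[R]_d := [set u | forall i, `[- r, r]%classic (u 0 i)].

Lemma leb_box_lty r : (mu (box r) < +oo)%E.
Proof.
rewrite [X in (X < _)%E](@lebesgue_rV_box R d (fun=> `[- r, r]%classic))//.
have : (\prod_(i < d) lebesgue_measure (`[(- r)%R, r]%classic : set R))%E \is a fin_num.
  apply: prode_fin_num => i _.
  by rewrite lebesgue_measure_itv/=; case: ifP.
by move=> /fin_numPlt/andP[].
Qed.

Lemma leb_eball_lty r : (mu (eball r) < +oo)%E.
Proof.
apply: le_lt_trans (leb_box_lty r); apply: le_mu => //.
  exact: (measurable_rV_box (A := fun=> `[- r, r]%classic)).
move=> u ur i; rewrite /= in_itv/= -ler_norml.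
exact: le_trans (ler_coord_enorm _ _) ur.
Qed.

Lemma leb_eball_fin r : mu (eball r) \is a fin_num.
Proof. by rewrite ge0_fin_numE// leb_eball_lty. Qed.

Lemma leb_eball_gt0 r : 0 < r -> (0 < mu (eball r))%E.
Proof.
move=> r0; pose a := r / d.+1%:R; have a0 : 0 < a by rewrite divr_gt0.
apply: (@lt_le_trans _ _ (mu (box a))); last first.
  apply: le_mu => //; first exact: (measurable_rV_box (A := fun=> `[- a, a]%classic)).
  move=> u ua; rewrite /eball/= (le_trans (ler_enorm_norm _))//.
  rewrite (@le_trans _ _ (d%:R * a))// ?ler_wpM2l//.
    apply: ler_norm_rV => [|i]; first exact: ltW.
    by have := ua i; rewrite /= in_itv/= -ler_norml.
  by rewrite /a mulrCA ler_piMr ?(ltW r0)// ler_pdivrMr// mul1r ler_nat.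
rewrite [X in (_ < X)%E](@lebesgue_rV_box R d (fun=> `[- a, a]%classic))//.
rewrite (eq_bigr (fun=> (a + a)%:E)) => [|i _]; last first.
  by rewrite lebesgue_measure_itv/= lte_fin gtrN// -EFinB opprK.
by rewrite prodEFin lte_fin prodr_gt0// => i _; rewrite addr_gt0.
Qed.

Lemma leb_eball_scale a r : 0 < a ->
  mu (eball (a * r)) = ((a ^+ d)%:E * mu (eball r))%E.
Proof.
move=> a0; rewrite -(leb_scale a0)// muleC; congr (_ * mu _)%E.
apply/seteqP; split => u; rewrite /eball/= enormZ (gtr0_norm a0);
  by rewrite ler_pM2l.
Qed.

Lemma ge0_integral_leb_comp (T : 'rV[R]_d -> 'rV[R]_d) (D : set 'rV[R]_d)
    (f : 'rV[R]_d -> \bar R) : measurable_fun setT T ->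
  (forall A, measurable A -> mu (T @^-1` A) = mu A) ->
  measurable D -> measurable_fun D f -> (forall x, (0 <= f x)%E) ->
  (\int[mu]_(z in T @^-1` D) f (T z) = \int[mu]_(z in D) f z)%E.
Proof.
move=> mT muT mD mf f0.
rewrite -[LHS](@ge0_integral_pushforward _ _ _ _ _ _ mT mu D f)//.
by apply: (eq_measure_integral mu) => A mA _; exact: muT.
Qed.

Section shell_moments.
Variables (a b : R).

Definition shell : set 'rV[R]_d := [set z | a < enorm z <= b].

Lemma shellE : shell = eball b `\` eball a.
Proof.
apply/seteqP; split => z; rewrite /shell/eball/=.
- by move=> /andP[az zb]; split => //; apply/negP; rewrite -ltNge.
- by move=> [zb /negP]; rewrite -ltNge => az; rewrite az.
Qed.

Lemma measurable_shell : measurable shell.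
Proof. by rewrite shellE; exact: measurableD. Qed.
Hint Resolve measurable_shell : core.

Let e (i : 'I_d) : 'rV[R]_d := delta_mx 0 i.

Let I h : \bar R := (\int[mu]_(z in shell) ((dotprod z h) ^+ 2)%:E)%E.

Let mI h : measurable_fun shell (fun z => ((dotprod z h) ^+ 2)%:E).
Proof.
apply/measurable_EFinP/measurable_funTS; apply: measurable_funX.
exact: measurable_dotprodr.
Qed.

Let flip (i : 'I_d) : 'rV[R]_d -> 'rV[R]_d :=
  coord_affine 1%g (fun j => if j == i then -1 else 1) (fun=> 0).

Let flipE i z j : flip i z 0 j = (if j == i then -1 else 1) * z 0 j.
Proof. by rewrite mxE perm1 addr0. Qed.

Let dotprod_flip i z h : dotprod (flip i z) h = dotprod z (flip i h).
Proof. by rewrite !dotprodE; apply: eq_bigr => j _; rewrite !flipE mulrCA mulrA. Qed.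

Let enorm_flip i z : enorm (flip i z) = enorm z.
Proof.
rewrite !enormE; congr Num.sqrt; rewrite !dotprodE; apply: eq_bigr => j _.
by rewrite flipE; case: ifP => _; rewrite ?mulN1r ?mulrNN// mul1r.
Qed.

Let shell_pre T : (forall z, enorm (T z) = enorm z) -> T @^-1` shell = shell.
Proof. by move=> TE; apply/seteqP; split => z; rewrite /shell/= TE. Qed.

Let I_flip i h : I (flip i h) = I h.
Proof.
rewrite /I -[RHS](@ge0_integral_leb_comp (flip i))//.
- rewrite shell_pre; last exact: enorm_flip.
  by apply: eq_integral => z _; rewrite dotprod_flip.
- exact: measurable_coord_affine.
- move=> A mA; rewrite -[RHS](@leb_coord_affine R d 1%g (fun j => if j == i then -1 else 1) (fun=> 0))//.
    rewrite big1 ?mule1// => j _; case: ifP => _; by rewrite ?normrN normr1.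
  by move=> j; case: ifP => _; rewrite ?oppr_eq0 oner_eq0.
- by move=> z; rewrite lee_fin sqr_ge0.
Qed.

Let swap (i j : 'I_d) : 'rV[R]_d -> 'rV[R]_d :=
  coord_affine (tperm i j) (fun=> 1) (fun=> 0).

Let I_swap i j : I (e i) = I (e j).
Proof.
have E z k : swap i j z 0 k = z 0 (tperm i j k) by rewrite mxE mul1r addr0.
rewrite /I -[RHS](@ge0_integral_leb_comp (swap i j))//.
- rewrite shell_pre; last first.
    move=> z; rewrite !enormE !dotprodE; congr Num.sqrt.
    rewrite [RHS](reindex_inj (@perm_inj _ (tperm i j)))/=.
    by apply: eq_bigr => k _; rewrite E.
  by apply: eq_integral => z _; rewrite !dotprod_delta E tpermR.
- exact: measurable_coord_affine.
- move=> A mA; rewrite -[RHS](@leb_coord_affine R d (tperm i j) (fun=> 1) (fun=> 0))//.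
  by rewrite big1 ?mule1// => k _; rewrite normr1.
- by move=> z; rewrite lee_fin sqr_ge0.
Qed.

(* The parallelogram identity applied to h and its reflection splits off one
   coordinate while keeping every integrand nonnegative. *)
Let I_split i h : h 0 i = 0 -> forall x : R,
  I (h + x *: e i)%R = (I h + (x ^+ 2)%:E * I (e i))%E.
Proof.
move=> hi x; have II : (I (h + x *: e i)%R + I (h + x *: e i)%R =
    2%:E * (I h + (x ^+ 2)%:E * I (e i)))%E.
  rewrite -{2}(I_flip i).
  rewrite /I -ge0_integralD//; [|by move=> *; rewrite lee_fin sqr_ge0..].
  rewrite -ge0_integralZl_EFin ?sqr_ge0//; last by move=> *; rewrite lee_fin sqr_ge0.
  rewrite -ge0_integralD//; first last.
  - by apply: emeasurable_funM => //; exact: mI.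
  - by move=> *; rewrite -EFinM lee_fin mulr_ge0 ?sqr_ge0.
  - by move=> *; rewrite lee_fin sqr_ge0.
  rewrite -ge0_integralZl_EFin//; first last.
  - by apply: emeasurable_funD => //; apply: emeasurable_funM => //; exact: mI.
  - move=> *; rewrite -EFinM -EFinD lee_fin; apply: addr_ge0; first exact: sqr_ge0.
    by apply: mulr_ge0; exact: sqr_ge0.
  apply: eq_integral => z _; rewrite -!EFinD -!EFinM; congr (_%:E).
  have -> : flip i (h + x *: e i)%R = h - x *: e i.
    apply/rowP => j; rewrite flipE !mxE eqxx/=; case: eqP => [->|_].
      by rewrite hi; ring.
    by rewrite (_ : false%:R = 0 :> R)//; ring.
  by rewrite dotprodBr dotprodDr !dotprodZr; ring.
have : (2%:E * I (h + x *: e i)%R = 2%:E * (I h + (x ^+ 2)%:E * I (e i)))%E.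
  by rewrite -II -[2%R]/(1 + 1)%R EFinD ge0_muleDl ?mul1e//.
by move/(congr1 (fun y => 2^-1%:E * y)%E); rewrite !muleA -!EFinM mulVf// !mul1e.
Qed.

Let I_sum h : I h = (\sum_(i < d) ((h 0%R i) ^+ 2)%:E * I (e i))%E.
Proof.
pose hk k : 'rV[R]_d := \row_i (if (i < k)%N then h 0 i else 0).
have H k : (k <= d)%N -> I (hk k) =
    (\sum_(i < d | (i < k)%N) ((h 0%R i) ^+ 2)%:E * I (e i))%E.
  elim: k => [|k IHk] kd.
    rewrite big_pred0//; rewrite /I integral0_eq// => z _.
    rewrite (_ : hk 0%N = 0) ?dotprod0r ?expr0n//.
    by apply/rowP => i; rewrite !mxE.
  pose i := Ordinal kd.
  rewrite (bigD1 i)//= addeC (_ : hk k.+1 = hk k + h 0 i *: e i).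
    rewrite I_split ?mxE ?ltnn// IHk ?(ltnW kd)//; congr (_ + _)%E.
    apply: eq_bigl => j; rewrite ltnS (leq_eqVlt j) -(inj_eq val_inj)/=.
    by case: (ltngtP j k).
  apply/rowP => j; rewrite !mxE eqxx/= ltnS leq_eqVlt -(inj_eq val_inj) /=.
  case: (ltngtP j k) => [| |jk]; rewrite ?mulr0 ?addr0// mulr1 add0r.
  by congr (h 0 _); exact: val_inj.
rewrite -[in LHS](_ : hk d = h); last by apply/rowP => i; rewrite mxE ltn_ord.
by rewrite H//; apply: eq_bigl => i; rewrite ltn_ord.
Qed.

(** The quadratic form [I] is a multiple c |h|^2 because flips kill its off-diagonal part and
    transpositions equate its diagonal entries. Summing over the basis, d c is the integral of
    |z|^2, at most b^2 times the volume: this is the gain of 1 / d. *)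
Lemma shell_second_moment h : (0 < d)%N -> 0 <= b ->
  (\int[mu]_(z in shell) ((dotprod z h) ^+ 2)%:E <=
   (enorm h ^+ 2 * b ^+ 2 / d%:R)%:E * mu shell)%E.
Proof.
move=> d0 b0; pose i0 := Ordinal d0; pose c := I (e i0).
have c0 : (0 <= c)%E by apply: integral_ge0 => z _; rewrite lee_fin sqr_ge0.
have -> : (\int[mu]_(z in shell) ((dotprod z h) ^+ 2)%:E = (enorm h ^+ 2)%:E * c)%E.
  rewrite -[LHS]/(I h) I_sum enorm2 dotprodE -sumEFin ge0_sume_distrl.
    by apply: eq_bigr => i _; rewrite (I_swap i i0) expr2.
  by move=> i _; rewrite lee_fin -expr2 sqr_ge0.
have dc : (d%:R%:E * c <= (b ^+ 2)%:E * mu shell)%E.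
  have -> : (d%:R%:E * c = \sum_(i < d) I (e i))%E.
    rewrite (eq_bigr (fun=> c)) => [|i _]; last exact: I_swap.
    by rewrite sumr_const card_ord mule_natl.
  rewrite /I -ge0_integral_sum//; [|by move=> i z _; rewrite lee_fin sqr_ge0].
  rewrite -integral_cst//; apply: ge0_le_integral => //.
  - by move=> z _; apply: sume_ge0 => i _; rewrite lee_fin sqr_ge0.
  - by apply: emeasurable_sum => i; exact: mI.
  - move=> z /andP[_ zb]; rewrite sumEFin lee_fin.
    rewrite (eq_bigr (fun i => z 0 i * z 0 i)) -?[X in X <= _]/(dotprod z z) => [|i _]; last first.
      by rewrite dotprod_delta expr2.
    by rewrite -enorm2 ler_pXn2r// nnegrE enorm_ge0.
have -> : ((enorm h ^+ 2 * b ^+ 2 / d%:R)%:E * mu shell =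
    (enorm h ^+ 2)%:E * (d%:R^-1%:E * ((b ^+ 2)%:E * mu shell)))%E.
  by rewrite !muleA -!EFinM; congr (_%:E * _)%E; ring.
apply: lee_wpmul2l; first by rewrite lee_fin sqr_ge0.
by rewrite lee_pdivlMl ?ltr0n.
Qed.

End shell_moments.

Section ball_shift.
Variable rho : R.
Hypotheses (rho0 : 0 < rho) (d0 : (0 < d)%N).

Let V : R := fine (mu (eball rho)).
Let VE : mu (eball rho) = V%:E. Proof. by rewrite fineK// leb_eball_fin. Qed.
Let V0 : 0 < V. Proof. by rewrite -lte_fin -VE leb_eball_gt0. Qed.

Let clip (x : R) : R := Num.min 1 (Num.max 0 x).

Let clip_lip x y : `|clip x - clip y| <= `|x - y|.
Proof.
have E (z : R) : clip z = if z <= 0 then 0 else if z <= 1 then z else 1.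
  rewrite /clip; case: (leP z 0) => z0; first by rewrite min_r.
  by case: (leP z 1).
have := ler_norm (x - y); have := ler_norm (y - x); rewrite (distrC y) !E.
by case: (leP x 0); case: (leP y 0); case: (leP x 1); case: (leP y 1);
  rewrite ler_norml; lra.
Qed.

Lemma shell_measure a b : 0 < a -> a <= b ->
  mu (shell (a * rho) (b * rho)) = (V * (b ^+ d - a ^+ d))%:E.
Proof.
move=> a0 ab; have b0 := lt_le_trans a0 ab.
rewrite shellE measureD ?leb_eball_lty// setIidr; last first.
  by move=> z; rewrite /eball/= => /le_trans; apply; rewrite ler_pM2r.
rewrite [X in (X - _)%E](leb_eball_scale rho b0) [X in (_ - X)%E](leb_eball_scale rho a0).
by rewrite VE -!EFinM -EFinB; congr (_%:E); ring.
Qed.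

(* [psi] below is a continuous radial function close to the indicator of the ball.
   Its translates differ in a thin shell only, where the linear term of
   [|z - h|^2 - |z|^2] is controlled by the second moment of the shell; a translation
   by [t] is cut into [N] small ones so that the quadratic term disappears. *)
Section bump.
Variables (eps : R).
Hypotheses (eps0 : 0 < eps) (eps1 : eps < 1).

Let delta : R := rho ^+ 2 - ((1 - eps) * rho) ^+ 2.
Let delta0 : 0 < delta.
Proof.
rewrite /delta (_ : _ - _ = rho ^+ 2 * (eps * (2 - eps))); last by ring.
by rewrite mulr_gt0 ?exprn_gt0// mulr_gt0// subr_gt0 (lt_trans eps1)// ltr1n.
Qed.

Let psi z : R := clip ((rho ^+ 2 - enorm z ^+ 2) / delta).

Let psi_ge0 z : 0 <= psi z.
Proof. by rewrite /psi /clip le_min ler01 le_max lexx. Qed.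

Let psi_le1 z : psi z <= 1.
Proof. by rewrite /psi /clip ge_min lexx. Qed.

Let psi_out z : rho <= enorm z -> psi z = 0.
Proof.
move=> rz; rewrite /psi /clip max_l ?min_r//.
rewrite pmulr_lle0 ?invr_gt0// subr_le0 ler_pXn2r ?nnegrE ?enorm_ge0//.
exact: ltW.
Qed.

Let psi_in z : enorm z <= (1 - eps) * rho -> psi z = 1.
Proof.
move=> zr; have h : 1 <= (rho ^+ 2 - enorm z ^+ 2) / delta.
  rewrite ler_pdivlMr// mul1r /delta lerD2l lerN2.
  by rewrite ler_pXn2r// nnegrE ?enorm_ge0// (le_trans (enorm_ge0 z)).
by rewrite /psi /clip max_r ?min_l// (le_trans _ h).
Qed.

Let mpsi : measurable_fun setT psi.
Proof.
apply: measurable_minr => //; apply: measurable_maxr => //.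
apply: measurable_funM => //; apply: measurable_funB => //.
by apply: measurable_funX; exact: measurable_enorm.
Qed.

Let msub (h : 'rV[R]_d) : measurable_fun setT (fun z : 'rV[R]_d => z - h).
Proof. exact: measurable_addr_rV. Qed.

Let T h : \bar R := (\int[mu]_z (`|psi z - psi (z - h)%R|)%:E)%E.

Let mT h : measurable_fun setT (fun z => (`|psi z - psi (z - h)|)%:E).
Proof.
apply/measurable_EFinP; apply: measurableT_comp => //; apply: measurable_funB => //.
exact: (measurableT_comp mpsi (msub h)).
Qed.

(** [T] is the L1 distance between [psi] and its translate. Invariance of Lebesgue measure lets the
    second increment start at z - h, and the triangle inequality concludes. *)
Let T_add h h' : (T (h + h')%R <= T h + T h')%E.
Proof.
have -> : T h' = (\int[mu]_z (`|psi (z - h)%R - psi (z - h - h')%R|)%:E)%E.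
  exact/esym/(@ge0_integral_leb_comp (fun z => z - h) setT
    (fun z => (`|psi z - psi (z - h')|)%:E) (msub h) (fun A => @leb_shift _ _ (- h) A)).
rewrite /T -ge0_integralD//; last first.
  apply/measurable_EFinP; apply: measurableT_comp => //; apply: measurable_funB.
    exact: (measurableT_comp mpsi (msub h)).
  exact: (measurableT_comp mpsi (measurableT_comp (msub h') (msub h))).
apply: ge0_le_integral => //.
- by apply: emeasurable_funD => //; apply/measurable_EFinP; apply: measurableT_comp => //; apply: measurable_funB;
   [exact: (measurableT_comp mpsi (msub h))|exact: (measurableT_comp mpsi (measurableT_comp (msub h') (msub h)))].
- move=> z _; rewrite -EFinD lee_fin opprD addrA.
  by rewrite (le_trans _ (ler_normD _ _))// addrA subrK.
Qed.

Let T_mul n h : (T (n%:R *: h)%R <= n%:R%:E * T h)%E.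
Proof.
elim: n => [|n IHn].
  by rewrite scale0r mul0e /T integral0_eq// => z _; rewrite subr0 subrr normr0.
rewrite -natr1 scalerDl scale1r (le_trans (T_add _ _))// EFinD ge0_muleDl ?lee_fin//.
by rewrite mul1e leeD2r.
Qed.

Lemma bump_shift_small (k : R) h : 0 <= k -> eps + k < 1 -> enorm h <= k * rho ->
  (T h <= (V * ((1 + k) ^+ d - (1 - eps - k) ^+ d) *
     (enorm h * (2 * ((1 + k) * rho) / Num.sqrt d%:R + enorm h) / delta))%:E)%E.
Proof.
move=> k0 ek hk.
have a0 : 0 < 1 - eps - k by rewrite -addrA -opprD subr_gt0.
have b0 : 0 < 1 + k by rewrite ltr_wpDr.
set r1 := (1 - eps - k) * rho; set r2 := (1 + k) * rho.
pose S := shell r1 r2.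
have r20 : 0 < r2 by rewrite mulr_gt0.
have mS : measurable S by exact: measurable_shell.
have muS : mu S = (V * ((1 + k) ^+ d - (1 - eps - k) ^+ d))%:E.
  have ab : 1 - eps - k <= 1 + k by have := eps0; lra.
  by rewrite -shell_measure.
(* A translation by at most k rho changes the norm by no more than that, so outside the shell both
   values are 1 or both are 0. *)
have T0 z : ~ S z -> psi z = psi (z - h).
  move=> /negP; rewrite negb_and -leNgt -ltNge => /orP[zr|zr].
    have zh : enorm (z - h) <= (1 - eps) * rho.
      by rewrite (le_trans (enormB _ _))// (le_trans (lerD zr hk))// /r1 mulrBl subrK.
    rewrite !psi_in// (le_trans zr)// /r1 mulrBl gerBl mulr_ge0// ltW//.
  have zh : rho <= enorm (z - h).
    have := enormD (z - h) h; rewrite subrK.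
    by move: zr hk; rewrite /r2 mulrDl mul1r; lra.
  by rewrite !psi_out// (le_trans _ (ltW zr))// /r2 mulrDl mul1r lerDl mulr_ge0// ltW.
rewrite -[X in (_ <= (X * _)%:E)%E]/(fine (V * _)%:E) -muS.
have muSfin : mu S \is a fin_num by rewrite muS.
have [h0|h0] := eqVneq (enorm h) 0.
  rewrite /T integral0_eq ?h0; last first.
    by move=> z _; rewrite (enorm_eq0 h0) subr0 subrr normr0.
  by rewrite !mul0r mulr0.
have {}h0 : 0 < enorm h by rewrite lt_neqAle eq_sym h0 enorm_ge0.
set s := Num.sqrt d%:R; have s0 : 0 < s by rewrite sqrtr_gt0 ltr0n.
have s2 : s ^+ 2 = d%:R by rewrite sqr_sqrtr// ler0n.
(* The weight in 2 |<z, h>| <= al <z, h>^2 + 1 / al. This choice makes the two averages over the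
   shell equal under the second moment bound, each being r2 |h| / sqrt(d). *)
pose al := s / (r2 * enorm h); have al0 : 0 < al by rewrite divr_gt0// mulr_gt0.
pose c := al^-1 + enorm h ^+ 2.
have c0 : 0 <= c by rewrite addr_ge0 ?sqr_ge0// invr_ge0 ltW.
have mdot : measurable_fun S (fun z => (dotprod z h ^+ 2)%:E).
  by apply/measurable_EFinP/measurable_funTS/measurable_funX; exact: measurable_dotprodr.
have H : (T h <= \int[mu]_(z in S) (delta^-1%:E * (al%:E * ((dotprod z h) ^+ 2)%:E + c%:E)))%E.
  rewrite [leRHS]integral_mkcond; apply: ge0_le_integral => //.
  - apply/(measurable_restrictT _ mS); apply: emeasurable_funM => //.
    by apply: emeasurable_funD => //; apply: emeasurable_funM.
  - move=> z _; rewrite patchE; case: ifPn => [_|/negP zS]; last first.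
      by rewrite T0 ?subrr ?normr0// => /mem_set.
    rewrite -[(al%:E * _)%E]EFinM -EFinD -EFinM lee_fin (le_trans (clip_lip _ _))//.
    rewrite -mulrBl normrM (@gtr0_norm _ delta^-1) ?invr_gt0// mulrC ler_wpM2l ?invr_ge0 ?(ltW delta0)//.
    rewrite (_ : _ - _ = enorm h ^+ 2 - 2 * dotprod z h); last first.
      by rewrite !enorm2 !(dotprodBl, dotprodBr) (dotprodC h z); ring.
    rewrite (le_trans (ler_normB _ _))// (ger0_norm (sqr_ge0 _)) /c addrA (addrC (enorm h ^+ 2)) lerD2r.
    rewrite normrM ger0_norm//.
    have := sqr_ge0 (al * `|dotprod z h| - 1).
    rewrite -(real_normK (num_real (dotprod z h))); set x := `|_|.
    rewrite sqrrB1 exprMn -(pmulr_rge0 _ (_ : 0 < al^-1)) ?invr_gt0//.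
    by rewrite (_ : al^-1 * _ = al * x ^+ 2 + al^-1 - 2 * x) ?subr_ge0//; field; rewrite gt_eqF.
apply: (le_trans H).
rewrite ge0_integralZl_EFin ?invr_ge0 ?(ltW delta0)//; first last.
- by apply: emeasurable_funD => //; apply: emeasurable_funM.
- by move=> z _; rewrite adde_ge0 ?mule_ge0 ?lee_fin ?sqr_ge0 ?(ltW al0).
rewrite ge0_integralD//; first last.
- by apply: emeasurable_funM.
- by move=> z _; rewrite mule_ge0 ?lee_fin ?sqr_ge0 ?(ltW al0).
rewrite ge0_integralZl_EFin ?(ltW al0)//; last by move=> z _; rewrite lee_fin sqr_ge0.
rewrite integral_cst//.
apply: (@le_trans _ _ (delta^-1%:E * (al%:E * ((enorm h ^+ 2 * r2 ^+ 2 / d%:R)%:E * mu S) + c%:E * mu S))%E).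
  rewrite lee_wpmul2l ?lee_fin ?invr_ge0 ?(ltW delta0)// leeD2r// lee_wpmul2l ?lee_fin ?(ltW al0)//.
  by apply: shell_second_moment => //; exact: ltW.
have fold (a b e g m : R) (X : \bar R) : X = m%:E ->
    (a%:E * (b%:E * (e%:E * X) + g%:E * X) = (a * (b * (e * m) + g * m))%:E)%E.
  by move->.
rewrite (fold _ _ _ _ (fine (mu S))) ?fineK// lee_fin /c /al -s2 le_eqVlt; apply/orP; left.
apply/eqP; field.
by rewrite !gt_eqF.
Qed.

Lemma bump_shift (k : R) (t : 'rV[R]_d) : 0 < k -> eps + k < 1 ->
  (T t <= (V * ((1 + k) ^+ d - (1 - eps - k) ^+ d) *
     (enorm t * (2 * ((1 + k) * rho) / Num.sqrt d%:R + k * rho) / delta))%:E)%E.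
Proof.
move=> k0 ek; have kr : 0 < k * rho by rewrite mulr_gt0.
have t1 : 0 < enorm t + 1 by rewrite ltr_wpDl// enorm_ge0.
have [N HN] := natSinv_le (divr_gt0 kr t1).
pose h := N.+1%:R^-1 *: t.
have hE : enorm h = N.+1%:R^-1 * enorm t by rewrite enormZ ger0_norm.
have hk : enorm h <= k * rho.
  rewrite hE (le_trans (ler_wpM2r (enorm_ge0 t) HN))// mulrAC ler_pdivrMr//.
  by rewrite ler_wpM2l ?(ltW kr)// lerDl.
rewrite [in leLHS](_ : t = N.+1%:R *: h); last by rewrite scalerA divff ?scale1r.
rewrite (le_trans (T_mul _ _))//.
rewrite (le_trans (lee_wpmul2l _ (bump_shift_small (ltW k0) ek hk)))//.
rewrite -EFinM lee_fin mulrCA ler_wpM2l//.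
  rewrite mulr_ge0 ?(ltW V0)// subr_ge0 ler_pXn2r ?nnegrE//.
  - by have := eps0; lra.
  - by lra.
  - by lra.
rewrite !mulrA ler_wpM2r ?invr_ge0 ?(ltW delta0)// hE mulrA divff// mul1r.
by rewrite ler_wpM2l ?enorm_ge0// lerD2l -hE.
Qed.

Let mindic (h : 'rV[R]_d) : measurable_fun setT (fun z : 'rV[R]_d => (\1_(eball rho) (z - h) : R)).
Proof.
by apply: (measurableT_comp _ (msub h)); exact: measurable_indic.
Qed.

Let indic_bump : (\int[mu]_z (`|\1_(eball rho) z - psi z|)%:E <=
  (V * (1 - (1 - eps) ^+ d))%:E)%E.
Proof.
have e1 : 0 < 1 - eps by rewrite subr_gt0.
rewrite -[X in (_ <= (V * (X - _))%:E)%E](expr1n _ d) -shell_measure//; last by have := eps0; lra.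
rewrite mul1r; apply: (@le_trans _ _ (\int[mu]_z (\1_(shell ((1 - eps) * rho) rho) z)%:E)%E); last first.
  by rewrite integral_indic ?setIT//; exact: measurable_shell.
apply: ge0_le_integral => //.
- apply/measurable_EFinP; apply: measurableT_comp => //; apply: measurable_funB => //.
- by apply/measurable_EFinP; apply: measurable_indic; exact: measurable_shell.
- move=> z _; rewrite lee_fin !indicE.
  have [zr|rz] := leP (enorm z) rho; last first.
    rewrite memNset; last by rewrite /eball/= leNgt rz.
    by rewrite psi_out ?(ltW rz)// subrr normr0.
  rewrite mem_set//; have [zi|iz] := leP (enorm z) ((1 - eps) * rho).
    by rewrite psi_in// subrr normr0.
  rewrite mem_set; last by rewrite /shell/= iz.
  by rewrite ger0_norm ?subr_ge0 ?psi_le1// gerBl psi_ge0.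
Qed.

Lemma ball_shift_bump (k : R) (t : 'rV[R]_d) : 0 < k -> eps + k < 1 ->
  (\int[mu]_z (`|\1_(eball rho) z - \1_(eball rho) (z - t)%R|)%:E <=
    (2 * (V * (1 - (1 - eps) ^+ d)) + V * ((1 + k) ^+ d - (1 - eps - k) ^+ d) *
     (enorm t * (2 * ((1 + k) * rho) / Num.sqrt d%:R + k * rho) / delta))%:E)%E.
Proof.
move=> k0 ek.
have m1 : measurable_fun setT (fun z : 'rV[R]_d => (`|\1_(eball rho) z - psi z|)%:E).
  by apply/measurable_EFinP; apply: measurableT_comp => //; apply: measurable_funB.
have m2 : measurable_fun setT (fun z : 'rV[R]_d => (`|\1_(eball rho) (z - t) - psi (z - t)|)%:E).
  exact: (measurableT_comp m1 (msub t)).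
apply: (@le_trans _ _ (\int[mu]_z ((`|\1_(eball rho) z - psi z|)%:E +
    (`|psi z - psi (z - t)%R|)%:E + (`|\1_(eball rho) (z - t)%R - psi (z - t)%R|)%:E))%E).
  apply: ge0_le_integral => //.
  - apply/measurable_EFinP; apply: measurableT_comp => //; apply: measurable_funB => //.
  - by do 2 apply: emeasurable_funD => //.
  - move=> z _; rewrite -!EFinD lee_fin.
    set a := \1_ _ _; set b := \1_ _ _; set c := psi z; set e := psi _.
    rewrite (_ : a - b = (a - c) + (c - e) - (b - e)); last by ring.
    by rewrite (le_trans (ler_normB _ _))// lerD2r ler_normD.
rewrite ge0_integralD//; [|by move=> z _; rewrite adde_ge0|by apply: emeasurable_funD].
rewrite ge0_integralD//.
have -> : (\int[mu]_z (`|\1_(eball rho) (z - t)%R - psi (z - t)%R|)%:E =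
    \int[mu]_z (`|\1_(eball rho) z - psi z|)%:E)%E.
  exact: (@ge0_integral_leb_comp (fun z => z - t) setT
    (fun z => (`|\1_(eball rho) z - psi z|)%:E) (msub t) (fun A => @leb_shift _ _ (- t) A)).
rewrite addeAC mulr2n mulrDl !mul1r !EFinD.
by apply: leeD; [apply: leeD|exact: bump_shift].
Qed.

End bump.

Let shifted (t : 'rV[R]_d) : set 'rV[R]_d := [set z | eball rho (z - t)].

Let mshifted (t : 'rV[R]_d) : measurable (shifted t).
Proof. exact: measurable_leP (measurableT_comp measurable_enorm (measurable_addr_rV (- t))). Qed.

Let mu_shifted (t : 'rV[R]_d) : mu (shifted t) = V%:E.
Proof. by rewrite -VE; exact: (leb_shift (- t)). Qed.

(** The bump estimate bounds the whole symmetric difference in the limit of width 0. Ball and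
    translate have equal volume, hence so do the two halves of that difference, which gives the 2 in
    the denominator. *)
Lemma ball_shift_measure (t : 'rV[R]_d) :
  (mu (shifted t `\` eball rho) <= (V * (Num.sqrt d%:R * enorm t / (2 * rho)))%:E)%E.
Proof.
pose X := (\int[mu]_z (`|\1_(eball rho) z - \1_(eball rho) (z - t)%R|)%:E)%E.
pose bound (eps : R) : R := 2 * (V * (1 - (1 - eps) ^+ d)) +
   V * ((1 + eps ^+ 2) ^+ d - (1 - eps - eps ^+ 2) ^+ d) *
     (enorm t * (2 * ((1 + eps ^+ 2) * rho) / Num.sqrt d%:R + eps ^+ 2 * rho) /
      (rho ^+ 2 - ((1 - eps) * rho) ^+ 2)).
have Xb eps : 0 < eps -> eps <= 4^-1 -> (X <= (bound eps)%:E)%E.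
  move=> eps0 eps4; apply: ball_shift_bump => //; first by lra.
    by rewrite exprn_gt0.
  have : eps ^+ 2 <= eps / 4 by rewrite expr2 ler_wpM2l// ltW.
  by lra.
have X0 : (0 <= X)%E by apply: integral_ge0.
have Xfin : X \is a fin_num.
  rewrite ge0_fin_numE//; apply: le_lt_trans (Xb 4^-1 _ _) (ltry _) => //.
have XV : fine X <= V * Num.sqrt d%:R * enorm t / rho.
  apply: ball_shift_limit (enorm_ge0 t) _ => //; first exact: ltW.
  - by rewrite sqrtr_gt0 ltr0n.
  - by rewrite sqr_sqrtr.
  - by move=> eps eps0 eps4; rewrite -lee_fin fineK// Xb.
have XE : X = (mu (shifted t `\` eball rho) + mu (eball rho `\` shifted t))%E.
  have indE A : measurable A -> mu A = (\int[mu]_z (\1_A z)%:E)%E.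
    by move=> mA; rewrite integral_indic// setIT.
  rewrite !indE; try exact: measurableD.
  rewrite -ge0_integralD//; try by apply/measurable_EFinP; apply: measurable_indic; exact: measurableD.
  apply: eq_integral => z _; rewrite -EFinD; congr (_%:E).
  rewrite !indicE !in_setD /= (_ : (z \in shifted t) = (z - t \in eball rho)); last first.
    by apply/idP/idP; rewrite !inE.
  by case: (_ \in _); case: (_ \in _) => /=;
    rewrite ?subrr ?sub0r ?subr0 ?normrN ?normr1 ?normr0 ?addr0 ?add0r.
have EE : mu (eball rho `\` shifted t) = mu (shifted t `\` eball rho).
  rewrite !measureD// ?leb_eball_lty//; last by rewrite [ltLHS]mu_shifted ltry.
  by rewrite [X in (X - _)%E]VE [X in _ = (X - _)%E]mu_shifted setIC.
have Nfin : mu (shifted t `\` eball rho) \is a fin_num.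
  rewrite ge0_fin_numE//; apply: (@le_lt_trans _ _ (mu (shifted t))).
    by apply: le_mu => //; exact: measurableD.
  by rewrite [ltLHS]mu_shifted ltry.
rewrite EE -(fineK Nfin) -EFinD in XE.
rewrite -(fineK Nfin) lee_fin.
move: XV; rewrite XE/=; set m := fine _.
rewrite (_ : V * _ * _ / _ = 2 * (V * (Num.sqrt d%:R * enorm t / (2 * rho)))).
  by lra.
by field; rewrite gt_eqF.
Qed.

(** The Dirac mass is the default that [mnormalize] requires for a measure whose total mass is zero
    or infinite. Bundling the uniform law as a probability gives access to product measures. *)
Definition unif_ball : probability 'rV[R]_d R :=
  mnormalize (mrestr mu (measurable_eball rho)) (\d_(0 : 'rV[R]_d)).

Lemma unif_ballE (A : set 'rV[R]_d) :
  unif_ball A = (mu (A `&` eball rho) * (V^-1)%:E)%E.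
Proof.
transitivity (mnormalize (mrestr mu (measurable_eball rho)) (\d_(0 : 'rV[R]_d)) A) => //.
rewrite /mnormalize/= /mrestr setTI.
rewrite (_ : (mu (eball rho) == 0%E) || _ = false)//.
by rewrite [mu (eball rho)]VE eqe gt_eqF.
Qed.

Lemma unif_ball_uniform (A : set 'rV[R]_d) :
  unif_ball A = uniform_eball rho A.
Proof.
rewrite unif_ballE /uniform_eball; congr (_ * _)%E.
by rewrite [lebesgue_rV _ _ _]VE inver gt_eqF.
Qed.

Lemma unif_ball_null (A : set 'rV[R]_d) : measurable A -> mu A = 0%E -> unif_ball A = 0%E.
Proof.
move=> mA A0; rewrite unif_ballE (_ : mu (A `&` _) = 0%E) ?mul0e//.
by apply/eqP; rewrite eq_le measure_ge0 andbT -A0; apply: le_mu => //; exact: measurableI.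
Qed.

Lemma unif_ball_supp : unif_ball (eball rho) = 1%E.
Proof. by rewrite unif_ballE setIid VE -EFinM divff// gt_eqF. Qed.

(** The laws of z and z + t coincide on the overlap of the two balls. The rest of the law of z + t
    has the mass estimated in [ball_shift_measure], counted here with the maximal value M. *)
Lemma unif_ball_shift (phi : 'rV[R]_d -> R) (M : R) (t : 'rV[R]_d) :
  measurable_fun setT phi -> (forall z, 0 <= phi z <= M) ->
  (\int[unif_ball]_z (phi (z + t)%R)%:E <= \int[unif_ball]_z (phi z)%:E +
    (M * (Num.sqrt d%:R * enorm t / (2 * rho)))%:E)%E.
Proof.
move=> mphi phiM.
have M0 : 0 <= M by have /andP[a b] := phiM 0; exact: le_trans b.
have mT := measurable_addr_rV t.
pose P1 : {measure set 'rV[R]_d -> \bar R} :=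
  measure_function_pushforward__canonical__measure_function_Measure unif_ball mT.
have P1E A : measurable A -> P1 A = (mu (A `&` shifted t) * (V^-1)%:E)%E.
  move=> mA; rewrite /P1/= /pushforward unif_ballE; congr (_ * _)%E.
  rewrite -[RHS](leb_shift t); last exact: measurableI.
  by congr mu; apply/seteqP; split => z; rewrite /shifted/= addrK.
pose E := eball rho `&` shifted t.
have mE : measurable E by exact: measurableI.
have mphi' D : measurable_fun D (EFin \o phi) by apply/measurable_EFinP/measurable_funTS.
rewrite -[leLHS](@ge0_integral_pushforward _ _ _ _ _ _ mT unif_ball setT (EFin \o phi))//; last first.
  by move=> z _; rewrite /= lee_fin; have /andP[] := phiM z.
rewrite -/(pushforward _ _) -[leLHS]/(\int[P1]_y (EFin \o phi) y)%E -(setUv E).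
have phi0 z : (0 <= (EFin \o phi) z)%E by rewrite /= lee_fin; have /andP[] := phiM z.
have mEC : measurable (~` E) by exact: measurableC.
rewrite (@ge0_integral_setU _ _ _ P1 _ _ mE mEC _ (mphi' _) (fun x _ => phi0 x)); last first.
  by rewrite disj_set2E setICr.
apply: leeD.
  rewrite (@eq_measure_integral _ _ _ E unif_ball P1).
    apply: ge0_subset_integral => //; try exact: measurableU; try exact: mphi'.
  move=> A mA AE; rewrite P1E// [RHS]unif_ballE; congr (mu _ * _)%E.
  by rewrite !setIidl// => z /AE[].
apply: (@le_trans _ _ (\int[P1]_(x in ~` E) cst M%:E x)%E).
  apply: ge0_le_integral => // z _.
  by rewrite /= lee_fin; have /andP[] := phiM z.
rewrite integral_cst; last exact: measurableC.
rewrite EFinM lee_wpmul2l ?lee_fin//.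
have PE := P1E _ mEC.
rewrite (_ : ~` E `&` shifted t = shifted t `\` eball rho) in PE; last first.
  by apply/seteqP; split => z; rewrite /E/=; tauto.
rewrite [leLHS](_ : _ = (mu (shifted t `\` eball rho) * V^-1%:E)%E); last exact: PE.
rewrite (le_trans (lee_wpmul2r _ (ball_shift_measure t)))//.
  by rewrite lee_fin invr_ge0 ltW.
by rewrite -EFinM lee_fin mulrAC divff ?mul1r// gt_eqF.
Qed.

End ball_shift.
End ball_geometry.

(** * Smoothing by averaging over a ball *)

Section integral_aux.
Context d (T : measurableType d) (R : realType) (mu : {measure set T -> \bar R}).
Implicit Types f g : T -> R.

Lemma integrable_ae_le f g : measurable_fun setT f ->
  mu.-integrable setT (EFin \o g) -> {ae mu, forall x, `|f x| <= g x} ->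
  mu.-integrable setT (EFin \o f).
Proof.
move=> mf /integrableP[mg goo] fg; apply/integrableP; split; first exact/measurable_EFinP.
apply: le_lt_trans goo; apply: ae_ge0_le_integral => //.
- by apply: measurableT_comp => //; exact/measurable_EFinP.
- exact: measurableT_comp.
apply: aeS fg => x fgx _ /=.
by rewrite lee_fin (le_trans fgx)// ler_norm.
Qed.

Lemma integrable_real_sum (I : Type) (s : seq I) (f : I -> T -> R) :
  (forall i, mu.-integrable setT (EFin \o f i)) ->
  mu.-integrable setT (EFin \o (fun t => \sum_(i <- s) f i t)).
Proof.
move=> If; have := @integrable_sum _ _ _ mu setT measurableT _ s xpredT _ (fun i _ => If i).
by apply: eq_integrable => // t _; rewrite /= sumEFin.
Qed.

Lemma Rintegral_sum (I : Type) (s : seq I) (f : I -> T -> R) :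
  (forall i, mu.-integrable setT (EFin \o f i)) ->
  \int[mu]_t (\sum_(i <- s) f i t) = \sum_(i <- s) \int[mu]_t f i t.
Proof.
move=> If; elim: s => [|i s IH].
  by rewrite big_nil; under eq_Rintegral do rewrite big_nil; rewrite /Rintegral integral0.
rewrite big_cons -IH -RintegralD//; last exact: integrable_real_sum.
by apply: eq_Rintegral => t _; rewrite big_cons.
Qed.

End integral_aux.

Section probability_aux.
Context d (T : measurableType d) (R : realType) (P : probability T R).
Implicit Types f g : T -> R.

Lemma probability_integrable_cst (c : R) : P.-integrable setT (EFin \o cst c).
Proof. exact: finite_measure_integrable_cst. Qed.

Lemma Rintegral_cstT (c : R) : \int[P]_x c = c.
Proof. by rewrite Rintegral_cst// [X in fine X]probability_setT mulr1. Qed.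

Lemma integrable_ae_bounded f (M : R) : measurable_fun setT f ->
  {ae P, forall x, `|f x| <= M} -> P.-integrable setT (EFin \o f).
Proof. by move=> mf fM; apply: (integrable_ae_le mf (probability_integrable_cst M) fM). Qed.

Lemma Rintegral_ae_le f g : P.-integrable setT (EFin \o f) ->
  P.-integrable setT (EFin \o g) -> {ae P, forall x, f x <= g x} ->
  \int[P]_x f x <= \int[P]_x g x.
Proof.
move=> If Ig fg; rewrite -subr_ge0 -RintegralB//.
have mgf : measurable_fun setT (fun x => g x - f x).
  by apply: measurable_funB; apply/measurable_EFinP; [exact: measurable_int Ig|exact: measurable_int If].
rewrite /Rintegral (@ae_eq_integral _ _ _ P setT (fun x => `|g x - f x|%:E))//; first last.
- apply: aeS fg => x fgx _ /=.
  by rewrite ger0_norm ?subr_ge0.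
- by apply/measurable_EFinP; exact: measurableT_comp.
- exact/measurable_EFinP.
by apply: fine_ge0; apply: integral_ge0.
Qed.

End probability_aux.

Section smoothing.
Context {R : realType} {d : nat}.
Variable rho : R.
Hypotheses (rho0 : 0 < rho) (d0 : (0 < d)%N).
Local Notation U := (@unif_ball R d rho).
Implicit Types x y z s t h : 'rV[R]_d.

Lemma unif_ball_ae : {ae U, forall z, enorm z <= rho}.
Proof.
exists (~` eball rho); split => //; first by apply: measurableC; exact: measurable_eball.
rewrite [LHS]probability_setC; last exact: measurable_eball.
by rewrite [X in (_ - X)%E]unif_ball_supp// subee.
Qed.

Definition smooth (f : 'rV[R]_d -> R) (x : 'rV[R]_d) : R := \int[U]_z f (x + z).

Section lipschitz.
Variables (f : 'rV[R]_d -> R) (L : R).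
Hypothesis fL : lipschitz_e f L.

Lemma lipschitz_e_ge0 : 0 <= L.
Proof.
have := fL 0 (const_mx 1); set u : 'rV[R]_d := 0 - const_mx 1.
have u0 : 0 < enorm u.
  rewrite lt_neqAle enorm_ge0 andbT eq_sym; apply/negP => /eqP/enorm_eq0/rowP/(_ (Ordinal d0)).
  by rewrite /u !mxE sub0r => /eqP; rewrite oppr_eq0 oner_eq0.
by move=> H; rewrite -(pmulr_lge0 _ u0); apply: le_trans H.
Qed.

Lemma lipschitz_e_measurable : measurable_fun setT f.
Proof. exact: continuous_measurable_rV (lipschitz_e_continuous fL). Qed.

Lemma lipschitz_e_shift x : lipschitz_e (fun z : 'rV[R]_d => f (x + z)) L.
Proof. by move=> u v; rewrite (le_trans (fL _ _))// opprD addrACA subrr add0r. Qed.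

Lemma measurable_shift x : measurable_fun setT (fun z : 'rV[R]_d => f (x + z)).
Proof.
by apply: continuous_measurable_rV; exact: lipschitz_e_continuous (lipschitz_e_shift x).
Qed.

Lemma smooth_integrable x : U.-integrable setT (EFin \o (fun z : 'rV[R]_d => f (x + z))).
Proof.
apply: (@integrable_ae_bounded _ _ _ _ _ (`|f x| + L * rho)); first exact: measurable_shift.
apply: aeS unif_ball_ae => z zr.
rewrite -[f (x + z)](subrK (f x)) addrC (le_trans (ler_normD _ _))// lerD2l.
by rewrite (le_trans (fL _ _))// addrC addKr ler_wpM2l// lipschitz_e_ge0.
Qed.

Lemma smoothB x y : smooth f x - smooth f y = \int[U]_z (f (x + z) - f (y + z)).
Proof. by rewrite RintegralB//; exact: smooth_integrable. Qed.

Lemma smoothB_integrable x y :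
  U.-integrable setT (EFin \o (fun z : 'rV[R]_d => f (x + z) - f (y + z))).
Proof.
rewrite (_ : _ \o _ = ((EFin \o (fun z : 'rV[R]_d => f (x + z)%R)) \- (EFin \o (fun z : 'rV[R]_d => f (y + z)%R)))%E)//.
by apply: integrableB => //; exact: smooth_integrable.
Qed.

Lemma lipschitz_smooth : lipschitz_e (smooth f) L.
Proof.
move=> x y; rewrite smoothB (le_trans (le_normr_Rintegral _ (smoothB_integrable _ _)))//.
rewrite -[leRHS](Rintegral_cstT U); apply: le_Rintegral => //.
- by have := integrable_abse (smoothB_integrable x y).
- exact: probability_integrable_cst.
- by move=> z _; rewrite (le_trans (fL _ _))// opprD addrACA subrr addr0.
Qed.

Lemma smooth_ge c x : (forall w, c <= f w) -> c <= smooth f x.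
Proof.
move=> cf; rewrite -[leLHS](Rintegral_cstT U); apply: le_Rintegral => //.
- exact: probability_integrable_cst.
- exact: smooth_integrable.
Qed.

Lemma smooth_le x : smooth f x <= f x + L * rho.
Proof.
rewrite -[leRHS](Rintegral_cstT U); apply: Rintegral_ae_le.
- exact: smooth_integrable.
- exact: probability_integrable_cst.
apply: aeS unif_ball_ae => z zr.
rewrite -lerBlDl (le_trans (ler_norm _))// (le_trans (fL _ _))// addrC addKr.
by rewrite ler_wpM2l// lipschitz_e_ge0.
Qed.

(** A Hessian bound in terms of second differences. The increment of f in direction s, raised by L
    |s|, takes values between 0 and 2 L |s|, so [unif_ball_shift] applies to it; the 2 cancels the
    one in the fraction of escaping mass. *)
Lemma smooth_diff2 (x s t : 'rV[R]_d) :
  smooth f (x + t + s) - smooth f (x + t) <= smooth f (x + s) - smooth f x +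
  L * Num.sqrt d%:R / rho * enorm s * enorm t.
Proof.
pose phi (z : 'rV[R]_d) : R := f (x + s + z) - f (x + z) + L * enorm s.
have mphi : measurable_fun setT phi.
  by apply: measurable_funD => //; apply: measurable_funB; exact: measurable_shift.
have phiD z y : phi (z + y) = f (x + y + s + z) - f (x + y + z) + L * enorm s.
  by rewrite /phi (addrC z) !addrA (addrAC x s).
have phiM z : 0 <= phi z <= 2 * L * enorm s.
  have := fL (x + s + z) (x + z).
  rewrite (_ : _ + _ - _ = s); last by rewrite opprD addrACA subrr addr0 (addrC x) addrK.
  by rewrite ler_norml /phi => /andP[a b]; apply/andP; split; move: a b; lra.
have := unif_ball_shift rho0 d0 t mphi phiM.
have E1 (y : 'rV[R]_d) : (\int[U]_z (phi (z + y)%R)%:E =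
  (smooth f (x + y + s) - smooth f (x + y) + L * enorm s)%:E)%E.
  have I1 : U.-integrable setT (EFin \o (fun z : 'rV[R]_d => phi (z + y))).
    rewrite (_ : _ \o _ = ((EFin \o (fun z : 'rV[R]_d => f (x + y + s + z) - f (x + y + z))%R) \+ (EFin \o cst (L * enorm s)%R))%E).
      by apply: integrableD => //; [exact: smoothB_integrable|exact: probability_integrable_cst].
    by apply/funext => z; rewrite /= phiD.
  rewrite -[LHS]fineK; last exact: (integrable_fin_num _ I1).
  congr (_%:E); rewrite smoothB -[L * enorm s in RHS](Rintegral_cstT U) -RintegralD//.
  - by apply: eq_Rintegral => z _; rewrite phiD.
  - exact: smoothB_integrable.
  - exact: probability_integrable_cst.
rewrite E1; under eq_integral do rewrite -[X in phi X]addr0.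
rewrite E1 addr0 -EFinD lee_fin => H.
rewrite (_ : L * _ / _ * _ * _ = 2 * L * enorm s * (Num.sqrt d%:R * enorm t / (2 * rho))).
  by move: H; lra.
by field; rewrite gt_eqF.
Qed.

(** Cut h into N + 1 equal pieces k. By [smooth_diff2] the increment over piece number j, counted
    from 0, exceeds the first one by at most L1 j |k|^2. These excesses add up to at most L1 |h|^2 /
    2, while N + 1 copies of the first increment tend to l. *)
Lemma smooth_descent (x h : 'rV[R]_d) (l : R) :
  N.+1%:R * (smooth f (x + N.+1%:R^-1 *: h) - smooth f x) @[N --> \oo] --> l ->
  smooth f (x + h) <= smooth f x + l + L * Num.sqrt d%:R / rho / 2 * enorm h ^+ 2.
Proof.
set L1 := L * _ / _ => Hl.
have L10 : 0 <= L1 by rewrite divr_ge0 ?mulr_ge0 ?lipschitz_e_ge0 ?sqrtr_ge0 ?ltW.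
rewrite -addrA -lerBlDl -lerBlDr.
apply: (cvgr_to_ge Hl); apply: nearW => N.
set k := N.+1%:R^-1 *: h.
have kh : N.+1%:R *: k = h by rewrite /k scalerA divff// scale1r.
have kE : N.+1%:R * enorm k = enorm h by rewrite -kh [in RHS]enormZ ger0_norm.
clearbody k.
have H (j : nat) : smooth f (x + j%:R *: k) - smooth f x <=
    j%:R * (smooth f (x + k) - smooth f x) + L1 / 2 * (j%:R * enorm k) ^+ 2.
  elim: j => [|j IH]; first by rewrite scale0r addr0 subrr !mul0r expr0n mulr0 addr0.
  have := smooth_diff2 x k (j%:R *: k).
  rewrite -/L1 enormZ ger0_norm// -addrA -[X in _ + (_ + X)]scale1r -scalerDl.
  have := mulr_ge0 L10 (sqr_ge0 (enorm k)).
  rewrite -natr1; move: IH; set a := smooth _ _; set b := smooth _ _; set c := smooth _ (x + k).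
  set e := smooth _ _; set m : R := j%:R; set q := enorm k => IH H2 H3.
  rewrite (_ : L1 / 2 * _ = L1 / 2 * (m * q) ^+ 2 + L1 * q * (m * q) + L1 * q ^+ 2 / 2); last by field.
  by move: IH H2 H3; lra.
by have := H N.+1; rewrite kh kE; lra.
Qed.

End lipschitz.
End smoothing.

Lemma ler_enorm_sqr (R : realType) d (g : 'rV[R]_d) (L : R) : 0 <= L ->
  enorm g ^+ 2 <= L * enorm g -> enorm g <= L.
Proof.
move=> L0; have [->//|g0] := eqVneq (enorm g) 0.
by rewrite expr2 ler_pM2r// lt_neqAle eq_sym g0 enorm_ge0.
Qed.

(** * Difference quotients and the gradient of the smoothed objective *)

Section difference_quotients.
Context {R : realType} {d : nat}.
Implicit Types (f : 'rV[R]_d -> R) (x h : 'rV[R]_d).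

Lemma rV_diff_quotient_cvg f x h : rV_diff f x ->
  N.+1%:R * (f (x + N.+1%:R^-1 *: h) - f x) @[N --> \oo] --> dotprod (gradient f x) h.
Proof.
move=> /rV_diffP[_ H]; apply/cvgrPdist_le => e e0.
have h1 : 0 < `|h| + 1 by rewrite ltr_wpDl.
have [dl dl0 Hd] := H _ (divr_gt0 e0 h1).
have [j Hj] := natSinv_le (divr_gt0 dl0 h1).
exists j => //= N /= jN.
have N0 : 0 < N.+1%:R :> R by rewrite ltr0n.
have hE : `|N.+1%:R^-1 *: h| = N.+1%:R^-1 * `|h| by rewrite normrZ ger0_norm ?invr_ge0.
have hN : `|N.+1%:R^-1 *: h| <= dl.
  rewrite hE ler_pdivrMl// (@le_trans _ _ (`|h| + 1)) ?lerDl// -ler_pdivrMr//.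
  rewrite -[leLHS]invrK -[leRHS]invrK lef_pV2 ?posrE ?invr_gt0 ?divr_gt0 ?ltr0n//.
  rewrite invf_div (le_trans _ Hj)// lef_pV2 ?posrE ?ltr0n// ler_nat.
  by rewrite ltnS.
have := Hd _ hN; rewrite hE dotprodZr => HN.
rewrite distrC (_ : _ - _ = N.+1%:R * (f (x + N.+1%:R^-1 *: h) - f x -
    N.+1%:R^-1 * dotprod (gradient f x) h)); last by field.
rewrite normrM gtr0_norm// -ler_pdivlMl// (le_trans HN)// mulrCA ler_wpM2l ?invr_ge0//.
by rewrite mulrAC ler_pdivrMr// ler_pM2l// lerDl.
Qed.

Lemma diff_quotient_le f x h (L : R) N : lipschitz_e f L ->
  `|N.+1%:R * (f (x + N.+1%:R^-1 *: h) - f x)| <= L * enorm h.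
Proof.
move=> fL; rewrite normrM ger0_norm// -ler_pdivlMl// mulrCA (le_trans (fL _ _))//.
by rewrite addrC addKr enormZ ger0_norm.
Qed.

Lemma gradient_le f x (L : R) : (0 < d)%N -> lipschitz_e f L -> rV_diff f x ->
  enorm (gradient f x) <= L.
Proof.
move=> d0 fL /(rV_diff_quotient_cvg (h := gradient f x)); rewrite -enorm2.
set g := gradient f x => Hg; have {}Hg : enorm g ^+ 2 <= L * enorm g.
  apply: (cvgr_to_le Hg); apply: nearW => N.
  exact: le_trans (ler_norm _) (diff_quotient_le _ _ _ fL).
exact: ler_enorm_sqr (lipschitz_e_ge0 d0 fL) _.
Qed.

End difference_quotients.

Section translated_product.
Context {R : realType} {n : nat} dY (Y : measurableType dY).
Variables (P : probability Y R) (rho : R).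
Hypothesis rho0 : 0 < rho.
Local Notation U := (@unif_ball R n rho).

Definition translate (x : 'rV[R]_n) (u : 'rV[R]_n * Y) : 'rV[R]_n * Y := (x + u.1, u.2).

Lemma measurable_translate x : measurable_fun setT (translate x).
Proof.
apply/measurable_fun_pairP; split => //=; last exact: measurable_snd.
apply: measurable_fun_rV => i /=; under eq_fun do rewrite !mxE.
by apply: measurable_funD => //; apply: (measurableT_comp (@measurable_coord R n i)).
Qed.

(** For each y the section of the null set, shifted by x, stays Lebesgue null, and the uniform law
    is absolutely continuous. This is how a gradient known only almost everywhere can be evaluated
    at the random points x + z. *)
Lemma ae_translate (Q : 'rV[R]_n * Y -> Prop) (x : 'rV[R]_n) :
  {ae (@leb R n \x P)%E, forall u, Q u} -> {ae (U \x P)%E, forall u, Q (translate x u)}.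
Proof.
move=> [N [mN N0 QN]]; set N' := translate x @^-1` N.
have mN' : measurable N'.
  by rewrite -[X in measurable X]setTI; exact: measurable_translate.
exists N'; split => //; last by move=> u /= Qu; exact: QN.
move: N0; rewrite (product_measure_ysection (@leb R n) P)// (product_measure_ysection U P)// => N0.
have : ae_eq P setT (@leb R n \o ysection N) (cst 0%E).
  apply/ae_eq_integral_abs => //; first exact: measurable_fun_ysection.
  by rewrite -[RHS]N0; apply: eq_integral => y _; rewrite gee0_abs.
move=> H; rewrite (@ae_eq_integral _ _ _ P setT (cst 0%E))//; first by rewrite integral0.
  exact: measurable_fun_ysection.
apply: aeS H => y H _ /=.
apply: unif_ball_null => //; first exact: measurable_ysection.
rewrite -[RHS](H I)/= -[RHS](leb_shift x); last exact: measurable_ysection.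
congr leb; apply/seteqP; split => z; rewrite /ysection/= !inE /N' /translate/= addrC//.
Qed.

End translated_product.

Section smooth_gradient.
Context {R : realType} {n : nat} dY (Y : measurableType dY).
Variables (P : probability Y R) (rho : R).
Hypotheses (rho0 : 0 < rho) (n0 : (0 < n)%N).
Variables (F : 'rV[R]_n -> Y -> R) (C : Y -> R) (G : 'rV[R]_n * Y -> 'rV[R]_n) (L0 : R).
Hypotheses (mF : forall w, measurable_fun setT (F w)) (cF : forall y, continuous (F ^~ y)).
Hypothesis lipF : {ae P, forall y, lipschitz_e (F ^~ y) (C y)}.
Hypothesis intC : P.-integrable setT (EFin \o C).
Hypothesis intF : forall w, P.-integrable setT (EFin \o F w).
Hypothesis mG : measurable_fun setT G.
Hypothesis aeG : {ae (@leb R n \x P)%E, forall u,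
  differentiable (F ^~ u.2) u.1 -> G u = gradient (F ^~ u.2) u.1}.
Local Notation U := (@unif_ball R n rho).
Local Notation f := (fun w => \int[P]_y F w y).
Hypothesis fL : lipschitz_e f L0.
Implicit Types x h : 'rV[R]_n.

(** The mean of a single stochastic gradient at x, built from G alone; [smooth_diff_quotient_cvg]
    links it to the derivatives of the smoothed objective. *)
Definition smooth_gradient x : 'rV[R]_n :=
  \row_i \int[(U \x P)%E]_u G (translate x u) 0 i.

Lemma ae_snd (Q : Y -> Prop) : {ae P, forall y, Q y} -> {ae (U \x P)%E, forall u, Q u.2}.
Proof.
move=> [N [mN N0 QN]]; exists (setT `*` N); split; first exact: measurableX.
  by rewrite product_measure1E// [X in (_ * X)%E](_ : _ = 0%E) ?mule0.
by move=> [z y] /= Qy; split => //; exact: QN.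
Qed.

Lemma integrable_snd (g : Y -> R) : P.-integrable setT (EFin \o g) ->
  (U \x P)%E.-integrable setT (EFin \o (fun u : 'rV[R]_n * Y => g u.2)).
Proof.
move=> /integrableP[mg gfin]; have {}mg : measurable_fun setT g by exact/measurable_EFinP.
apply/integrable12ltyP; first by apply/measurable_EFinP; apply: measurableT_comp.
by rewrite /= integral_cst// [X in (_ * X)%E]probability_setT mule1.
Qed.

Lemma ge0_integral_snd (g : Y -> R) : measurable_fun setT g -> (forall y, 0 <= g y) ->
  (\int[(U \x P)%E]_u (g u.2)%:E = \int[P]_y (g y)%:E)%E.
Proof.
move=> mg g0; rewrite fubini_tonelli1//.
- by rewrite /fubini_F/= integral_cst// [X in (_ * X)%E]probability_setT mule1.
- by apply/measurable_EFinP; apply: measurableT_comp.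
- by move=> u; rewrite lee_fin.
Qed.

Lemma ae_gradient x : {ae (U \x P)%E, forall u, let v := translate x u in
  [/\ lipschitz_e (F ^~ v.2) (C v.2), rV_diff (F ^~ v.2) v.1 & G v = gradient (F ^~ v.2) v.1]}.
Proof.
have H := @ae_translate R n _ Y P rho rho0 _ x.
have H1 := H _ (ae_rV_diff mF cF lipF); have H2 := H _ aeG; have H3 := ae_snd lipF.
apply: (@filterS3 _ _ (ae_filter_ringOfSetsType (U \x P)%E)) H1 H2 H3.
move=> u /= h1 h2 h3; split => //; apply: h2.
by have [] := rV_diffP h1.
Qed.

Lemma ae_approx_gradient_le x : {ae (U \x P)%E, forall u, enorm (G (translate x u)) <= C u.2}.
Proof.
apply: aeS (ae_gradient x) => u /= [h1 h2 ->].
exact: gradient_le.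
Qed.

Lemma measurable_approx_gradient x i :
  measurable_fun setT (fun u => G (translate x u) 0 i).
Proof.
exact: (measurableT_comp (@measurable_coord R n i) (measurableT_comp mG (measurable_translate x))).
Qed.

Lemma integrable_approx_gradient x i :
  (U \x P)%E.-integrable setT (EFin \o (fun u => G (translate x u) 0 i)).
Proof.
apply: integrable_ae_le (measurable_approx_gradient x i) (integrable_snd intC) _.
apply: aeS (ae_approx_gradient_le x) => u.
exact: le_trans (ler_coord_enorm _ _).
Qed.

Lemma dotprod_smooth_gradient x h :
  dotprod (smooth_gradient x) h = \int[(U \x P)%E]_u dotprod (G (translate x u)) h.
Proof.
have I i : (U \x P)%E.-integrable setT (EFin \o (fun u => G (translate x u) 0 i * h 0 i)).
  rewrite (_ : _ \o _ = fun u => ((h 0 i)%:E * (G (translate x u) 0 i)%:E)%E).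
    by apply: integrableZl => //; exact: integrable_approx_gradient.
  by apply/funext => u /=; rewrite -EFinM mulrC.
rewrite [RHS]Rintegral_sum//; apply: eq_bigr => i _; rewrite mxE -RintegralZr//.
exact: integrable_approx_gradient.
Qed.

Let D x h (u : 'rV[R]_n * Y) := F (x + h + u.1) u.2 - F (x + u.1) u.2.

Let measurable_D x h : measurable_fun setT (D x h).
Proof.
apply: measurable_funB.
  apply: (measurableT_comp (caratheodory_measurable mF cF) (measurable_translate (x + h))).
apply: (measurableT_comp (caratheodory_measurable mF cF) (measurable_translate x)).
Qed.

Let D_le x h : {ae (U \x P)%E, forall u, `|D x h u| <= C u.2 * enorm h}.
Proof.
apply: aeS (ae_snd lipF) => u /= lu.
by rewrite (le_trans (lu _ _))// opprD addrACA subrr addr0 (addrC x) addrK.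
Qed.

Let intC_norm h :
  (U \x P)%E.-integrable setT (EFin \o (fun u : 'rV[R]_n * Y => C u.2 * enorm h)).
Proof.
rewrite (_ : _ \o _ = fun u => ((enorm h)%:E * (C u.2)%:E)%E).
  by apply: integrableZl => //; exact: integrable_snd.
by apply/funext => u /=; rewrite -EFinM mulrC.
Qed.

Let integrable_D x h : (U \x P)%E.-integrable setT (EFin \o D x h).
Proof. exact: integrable_ae_le (measurable_D x h) (intC_norm h) (D_le x h). Qed.

Let smoothE x h : smooth rho f (x + h) - smooth rho f x = \int[(U \x P)%E]_u D x h u.
Proof.
rewrite (smoothB rho0 n0 fL).
transitivity (fine (\int[U]_z fubini_F P (EFin \o D x h) z)%E); last first.
  by rewrite /Rintegral -(integral12_prod_meas1 (integrable_D x h)).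
rewrite [LHS]/Rintegral; apply: congr1; apply: eq_integral => z _.
rewrite -RintegralB// /Rintegral fineK//; apply: integrable_fin_num => //.
exact: (integrableB _ (intF (x + h + z)) (intF (x + z))).
Qed.

Lemma smooth_diff_quotient_cvg x h :
  N.+1%:R * (smooth rho f (x + N.+1%:R^-1 *: h) - smooth rho f x) @[N --> \oo]
  --> dotprod (smooth_gradient x) h.
Proof.
pose f_ N u := (N.+1%:R * D x (N.+1%:R^-1 *: h) u)%:E.
pose g u := (dotprod (G (translate x u)) h)%:E.
have [|||||Ig _ cvg] := @dominated_convergence _ _ R (U \x P)%E setT measurableT f_ g
  (EFin \o (fun u : 'rV[R]_n * Y => C u.2 * enorm h)).
- by move=> N; apply/measurable_EFinP; apply: measurable_funM.
- apply/measurable_EFinP; apply: measurable_sum => i.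
  by apply: measurable_funM => //; exact: measurable_approx_gradient.
- apply: aeS (ae_gradient x) => u /= [h1 h2 Gu] _.
  apply: cvg_EFin; first exact: nearW.
  rewrite Gu; have := rV_diff_quotient_cvg (h := h) h2.
  by under eq_fun do rewrite /= addrAC.
- exact: intC_norm.
- apply: aeS (ae_snd lipF) => u /= lu N _.
  rewrite lee_fin /D addrAC.
  by apply: le_trans (diff_quotient_le _ _ _ lu) _.
rewrite dotprod_smooth_gradient.
move: cvg; rewrite -[X in _ --> X](fineK (integrable_fin_num _ Ig))// => /fine_cvg.
apply: cvg_trans; apply: near_eq_cvg; apply: nearW => N /=.
by rewrite smoothE -RintegralZl.
Qed.

Lemma smooth_gradient_descent x h :
  smooth rho f (x + h) <= smooth rho f x + dotprod (smooth_gradient x) h +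
    L0 * Num.sqrt n%:R / rho / 2 * enorm h ^+ 2.
Proof. by apply: smooth_descent => //; exact: smooth_diff_quotient_cvg. Qed.

(** Each coordinate is a pointwise limit of difference quotients of fs, which are continuous because
    fs is Lipschitz. *)
Lemma measurable_smooth_gradient : measurable_fun setT smooth_gradient.
Proof.
apply: measurable_fun_rV => i; apply: (measurable_fun_cvg (h := fun N x =>
  N.+1%:R * (smooth rho f (x + N.+1%:R^-1 *: delta_mx 0 i) - smooth rho f x))) => [N|x _].
  apply: measurable_funM => //; apply: measurable_funB.
    have := measurable_shift (lipschitz_smooth rho0 n0 fL) (N.+1%:R^-1 *: delta_mx 0 i).
    by apply: eq_measurable_fun => z _; rewrite addrC.
  exact: lipschitz_e_measurable (lipschitz_smooth rho0 n0 fL).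
by have := @smooth_diff_quotient_cvg x (delta_mx 0 i); rewrite dotprod_delta.
Qed.

Lemma approx_gradient_second_moment x :
  (\int[(U \x P)%E]_u (enorm (G (translate x u)) ^+ 2)%:E <= \int[P]_y (C y ^+ 2)%:E)%E.
Proof.
have mC : measurable_fun setT C by apply/measurable_EFinP; exact: measurable_int intC.
rewrite -(@ge0_integral_snd (fun y => C y ^+ 2)); first last.
- by move=> y; exact: sqr_ge0.
- exact: measurable_funX.
have mE : measurable_fun setT (fun u => enorm (G (translate x u))).
  exact: (measurableT_comp measurable_enorm (measurableT_comp mG (measurable_translate x))).
apply: ae_ge0_le_integral => //.
- by move=> u _; rewrite lee_fin sqr_ge0.
- by apply/measurable_EFinP; exact: measurable_funX.
- by move=> u _; rewrite lee_fin sqr_ge0.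
- by apply/measurable_EFinP; apply: measurable_funX; apply: measurableT_comp.
apply: aeS (ae_approx_gradient_le x) => u Gu _.
by rewrite lee_fin ler_pXn2r ?nnegrE// ?enorm_ge0// (le_trans _ Gu)// enorm_ge0.
Qed.

End smooth_gradient.

(** * The Clarke epsilon-subdifferential *)

Section clarke.
Context {R : realType} {d : nat}.
Variables (f : 'rV[R]_d -> R) (L : R).
Hypotheses (d0 : (0 < d)%N) (fL : lipschitz_e f L).
Implicit Types (w x y v g h : 'rV[R]_d).

(** The upper limit is the infimum of the suprema over neighbourhoods, so it dominates <g, v>
    exactly when every local bound c of the difference quotients does. This removes filters and
    extended reals from later arguments. *)
Lemma clarkeP w g : clarke f w g <->
  forall v (c dl : R), 0 < dl -> (forall y (t : R), `|y - w| < dl -> 0 < t < dl ->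
    (f (y + t *: v) - f y) / t <= c) -> dotprod g v <= c.
Proof.
pose q v := fun yt : 'rV[R]_d * R => ((f (yt.1 + yt.2 *: v) - f yt.1) / yt.2)%:E.
split => [gw v c dl dl0 H|H v].
  rewrite -lee_fin (le_trans (gw v))// /clarke_dderiv limf_esupE.
  pose A := [set yt : 'rV[R]_d * R | `|yt.1 - w| < dl /\ 0 < yt.2 < dl].
  apply: (@le_trans _ _ (ereal_sup (q v @` A))).
    apply: ge_ereal_inf; exists (ereal_sup (q v @` A)) => //; exists A => //.
    exists ([set y | `|y - w| < dl], [set t : R | 0 < t < dl]); last by case.
    split; first by apply/nbhs_rVP; exists dl.
    exists dl => //= t; rewrite /ball/= sub0r normrN => td t0.
    by rewrite t0/= (le_lt_trans (ler_norm t)).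
  by apply: ge_ereal_sup => _ [[y t] [/= yw t0] <-]; rewrite lee_fin H.
rewrite /clarke_dderiv limf_esupE; apply: le_ereal_inf_tmp => _ [A [[B T] /= [wB T0] BTA] <-].
have [d1 d10 HB] := (nbhs_rVP _ _).1 wB.
have [d2 /= d20 HT] := T0.
pose dl := Num.min d1 d2; have dl0 : 0 < dl by rewrite lt_min d10.
have HA y (t : R) : `|y - w| < dl -> 0 < t < dl -> A (y, t).
  move=> yw /andP[t0 td]; apply: BTA; split => /=.
    by apply: HB; rewrite (lt_le_trans yw)// ge_min lexx.
  apply: HT => //; rewrite /ball/= sub0r normrN gtr0_norm//.
  by rewrite (lt_le_trans td)// ge_min lexx orbT.
set s := ereal_sup _.
have Hs y (t : R) : `|y - w| < dl -> 0 < t < dl -> (q v (y, t) <= s)%E.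
  by move=> yw t0; apply: ereal_sup_ubound; exists (y, t) => //; exact: HA.
case Es : s => [r| |]; rewrite ?leey ?lee_fin//.
  by apply: (H v r dl dl0) => y t yw t0; have := Hs _ _ yw t0; rewrite Es lee_fin.
(* The supremum cannot be minus infinity, because the pair (w, dl / 2) belongs to the set over which
   it is taken. *)
have := Hs w (dl / 2); rewrite Es subrr normr0 => /(_ dl0).
rewrite divr_gt0//= ltr_pdivrMr// ltr_pMr// ltr1n => /(_ isT).
by rewrite leeNy_eq.
Qed.

Lemma clarke_le w g : clarke f w g -> enorm g <= L.
Proof.
move=> /clarkeP/(_ g (L * enorm g) 1 ltr01) H.
have {}H : enorm g ^+ 2 <= L * enorm g.
  rewrite enorm2; apply: H => y t _ /andP[t0 _].
  rewrite ler_pdivrMr// (le_trans (ler_norm _))// (le_trans (fL _ _))//.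
  by rewrite addrC addKr enormZ gtr0_norm// -mulrA [t * _]mulrC.
exact: ler_enorm_sqr (lipschitz_e_ge0 d0 fL) _.
Qed.

Lemma gradient_clarke w : rV_diff f w -> clarke f w (gradient f w).
Proof.
move=> fw; apply/clarkeP => v c dl dl0 H.
apply: (cvgr_to_le (rV_diff_quotient_cvg fw)).
have [j Hj] := natSinv_le (divr_gt0 dl0 (ltr0n R 2)).
exists j => //= N /= jN.
have := H w N.+1%:R^-1; rewrite subrr normr0 invrK mulrC; apply => //.
rewrite invr_gt0 ltr0n/= (@le_lt_trans _ _ (dl / 2))//; last first.
  by rewrite ltr_pdivrMr// ltr_pMr// ltr1n.
by rewrite (le_trans _ Hj)// lef_pV2 ?posrE ?ltr0n// ler_nat ltnS.
Qed.

Variable e : R.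

Definition clarke_ball w : set 'rV[R]_d := \bigcup_(z in eball e) clarke f (w + z).

Lemma compact_eball (r : R) : compact (eball r : set 'rV[R]_d).
Proof.
apply: (@subclosed_compact _ _ [set v : 'rV[R]_d | forall i, `[- r, r]%classic (v ord0 i)]).
- by apply: closed_leP; exact: enorm_continuous.
- apply: (@rV_compact R d (fun=> `[- r, r]%classic)) => i; exact: segment_compact.
- move=> v /= vr i; rewrite in_itv/= -ler_norml.
  exact: le_trans (ler_coord_enorm _ _) vr.
Qed.

(** The pairs (z, g) range over a compact set by [clarke_le], so a local statement at each pair is
    enough. If g belongs to the subdifferential at w + z, it serves as the nearby point itself;
    otherwise a strict violation persists around (z, g, w). *)
Lemma clarke_ball_usc w (eta : R) : 0 < eta -> exists2 dl : R, 0 < dl &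
  forall w', `|w' - w| < dl -> forall g, clarke_ball w' g ->
  exists2 x, clarke_ball w x & enorm (g - x) <= eta.
Proof.
move=> eta0.
have := compact_setX (@compact_eball e) (@compact_eball L) => /compact_near_coveringP.
move=> /(_ _ (nbhs w) (fun w' zg => clarke f (w' + zg.1) zg.2 ->
  exists2 x, clarke_ball w x & enorm (zg.2 - x) <= eta) _) H.
suff /H/nbhs_rVP[dl dl0 Hdl] : forall x : 'rV[R]_d * 'rV[R]_d, (eball e `*` eball L) x ->
    \forall x' \near x & i \near w, clarke f (i + x'.1) x'.2 ->
      exists2 x0, clarke_ball w x0 & enorm (x'.2 - x0) <= eta.
  exists dl => // w' /Hdl Hw' g [z ze gz]; apply: (Hw' (z, g)) => //; split => //=.
  exact: clarke_le gz.
clear H; move=> [z g] [/= ze gL].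
have near2 (dl : R) : 0 < dl -> (forall z' g' w', `|z' - z| < dl -> `|g' - g| < dl -> `|w' - w| < dl ->
    clarke f (w' + z') g' -> exists2 x, clarke_ball w x & enorm (g' - x) <= eta) ->
    \forall x' \near (z, g) & i \near w, clarke f (i + x'.1) x'.2 ->
      exists2 x0, clarke_ball w x0 & enorm (x'.2 - x0) <= eta.
  move=> dl0 H.
  exists ([set zg | `|zg.1 - z| < dl /\ `|zg.2 - g| < dl], [set w' | `|w' - w| < dl]).
    split; last by apply/nbhs_rVP; exists dl.
    exists ([set z' | `|z' - z| < dl], [set g' | `|g' - g| < dl]); last by case.
    by split; apply/nbhs_rVP; exists dl.
  by move=> [[z' g'] w'] /= [[zz gg] ww]; exact: H.
have [gz|ngz] := pselect (clarke f (w + z) g).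
  pose dl := eta / d%:R; have dl0 : 0 < dl by rewrite divr_gt0// ltr0n.
  apply: (near2 dl) => // z' g' w' _ gg _ _; exists g; first by exists z.
  by rewrite (le_trans (ler_enorm_norm _))// -ler_pdivlMl ?ltr0n// mulrC ltW.
have : exists v c dl, [/\ 0 < dl, forall y (t : R), `|y - (w + z)| < dl -> 0 < t < dl ->
    (f (y + t *: v) - f y) / t <= c & c < dotprod g v].
  apply: contrapT => N; apply: ngz; apply/clarkeP => v c dl dl0 H.
  by rewrite leNgt; apply/negP => gc; apply: N; exists v, c, dl.
move=> [v [c [dl [dl0 Hq gc]]]].
have [d1 d10 Hd1] : exists2 d1 : R, 0 < d1 & forall g', `|g' - g| < d1 -> c < dotprod g' v.
  have gc0 : 0 < (dotprod g v - c) / 2 by rewrite divr_gt0// subr_gt0.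
  have [d1 d10 Hd1] := (continuous_rVP _).1 (@dotprod_continuous R d v) g _ gc0.
  exists d1 => // g' /Hd1; rewrite !(dotprodC v) => /(le_lt_trans (ler_norm _)).
  by move: gc; lra.
(* Three displacements, of z, of w and of the point y, must together stay below [dl]. *)
pose dm := Num.min d1 (dl / 3).
have dm0 : 0 < dm by rewrite lt_min d10 divr_gt0.
apply: (near2 dm dm0) => z' g' w' zz gg ww cl; have {cl} H := (clarkeP _ _).1 cl v c (dl / 3).
exfalso; have := Hd1 _ (lt_le_trans gg _); rewrite ge_min lexx => /(_ isT).
apply/negP; rewrite -leNgt; apply: H; first by rewrite divr_gt0.
move=> y t yw /andP[t0 td]; apply: Hq; last first.
  by rewrite t0 (lt_trans td)// ltr_pdivrMr// ltr_pMr// ltr1n.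
have -> : y - (w + z) = (y - (w' + z')) + ((w' - w) + (z' - z)).
  by rewrite (addrACA w' (- w)) -opprD addrA subrK.
have dml : dm <= dl / 3 by rewrite ge_min lexx orbT.
have := ler_normD (y - (w' + z')) ((w' - w) + (z' - z)).
have := ler_normD (w' - w) (z' - z).
by move: yw zz ww dml; lra.
Qed.

(** Replacing each point of a convex combination by a close one and keeping the weights moves the
    combination by at most [eta]. *)
Lemma clarke_eps_usc w (eta : R) : 0 < eta -> exists2 dl : R, 0 < dl &
  forall w', `|w' - w| < dl -> forall g, clarke_eps e f w' g ->
  exists2 x, clarke_eps e f w x & enorm (g - x) <= eta.
Proof.
move=> eta0; have [dl dl0 H] := clarke_ball_usc w eta0.
exists dl => // w' /H {}H _ [n [a [g [a0 a1 gw' ->]]]].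
pose x i := s2val (cid2 (H _ (gw' i))).
have xw i : clarke_ball w (x i) by exact: s2valP (cid2 (H _ (gw' i))).
have xg i : enorm (g i - x i) <= eta by exact: s2valP' (cid2 (H _ (gw' i))).
exists (\sum_i a i *: x i).
  by exists n, a, x.
rewrite -sumrB (le_trans (enorm_sum _ _ _))// -[leRHS]mul1r -a1 mulr_suml.
by apply: ler_sum => i _; rewrite -scalerBr enormZ ger0_norm// ler_wpM2l.
Qed.

(** Upper semicontinuity of the set makes its distance to 0 lower semicontinuous: a margin [2 * eta]
    at w leaves [eta] nearby. Open superlevel sets then give the measurability clause of
    [expected_stationary]. *)
Lemma dist0_clarke_eps_lsc (c : R) w : (c%:E < dist0 (clarke_eps e f w))%E ->
  exists2 dl : R, 0 < dl & forall w', `|w' - w| < dl -> (c%:E < dist0 (clarke_eps e f w'))%E.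
Proof.
move=> cw.
have [eta eta0 Heta] : exists2 eta : R, 0 < eta &
    ((c + 2 * eta)%:E <= dist0 (clarke_eps e f w))%E.
  case: (dist0 _) cw => [r| |]//; last by exists 1 => //; rewrite leey.
  rewrite lte_fin => cr; exists ((r - c) / 2); first by rewrite divr_gt0// subr_gt0.
  by rewrite lee_fin; lra.
have [dl dl0 H] := clarke_eps_usc w eta0; exists dl; first exact: dl0.
move=> w' ww; have {}H := H w' ww.
apply: (@lt_le_trans _ _ (c + eta)%:E); first by rewrite lte_fin ltrDl.
apply: le_ereal_inf_tmp => _ [g Ag <-]; have [x xw gx] := H g Ag; rewrite lee_fin.
have : ((c + 2 * eta)%:E <= (enorm x)%:E)%E.
  by apply: le_trans Heta _; apply: ereal_inf_lbound; exists x.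
rewrite lee_fin; have := enormD g (x - g); rewrite addrC subrK enormBC.
by move: gx; lra.
Qed.

Lemma measurable_dist0_clarke_eps :
  measurable_fun setT (fun w => dist0 (clarke_eps e f w)).
Proof.
apply: (measurability _ (ErealGenOInfty.measurableE R)) => _ [_ [c ->] <-].
have op : open [set w | (c%:E < dist0 (clarke_eps e f w))%E].
  rewrite openE => w /= cw; have [dl dl0 H] := dist0_clarke_eps_lsc cw.
  by apply/nbhs_rVP; exists dl; [exact: dl0|exact: H].
rewrite setTI (_ : _ @^-1` _ = [set w | (c%:E < dist0 (clarke_eps e f w))%E]).
  exact: sub_sigma_algebra.
by apply/seteqP; split => w; rewrite /= in_itv/= andbT.
Qed.

End clarke.

(** * The gradient of the smoothing and the distance to the subdifferential *)

Section clarke_smoothing.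
Context {R : realType} {d : nat}.
Variables (f : 'rV[R]_d -> R) (L rho : R).
Hypotheses (d0 : (0 < d)%N) (rho0 : 0 < rho) (fL : lipschitz_e f L).
Local Notation U := (@unif_ball R d rho).
Implicit Types (w x y v g h : 'rV[R]_d).

Lemma unif_ball_ae_translate (Q : 'rV[R]_d -> Prop) x : {ae @leb R d, forall w, Q w} ->
  {ae U, forall z, Q (x + z)}.
Proof.
move=> [N [mN N0 QN]]; have mN' : measurable [set z | N (z + x)].
  by rewrite -[X in measurable X]setTI; exact: measurable_addr_rV.
exists [set z | N (z + x)]; split => //.
  by apply: unif_ball_null => //; rewrite leb_shift.
by move=> z /= Qz; rewrite addrC; exact: QN.
Qed.

Lemma ae_unif_rV_diff x : {ae U, forall z, rV_diff f (x + z)}.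
Proof.
by apply: unif_ball_ae_translate; apply: lipschitz_ae_rV_diff (lipschitz_e_sup fL).
Qed.

(* Dominated convergence is applied to the truncation at [c] of the difference
   quotients, whose limit is the constant [c]. *)
Lemma smooth_derivative_ge x a (c l : R) :
  N.+1%:R * (smooth rho f (x + N.+1%:R^-1 *: a) - smooth rho f x) @[N --> \oo] --> l ->
  {ae U, forall z, rV_diff f (x + z) -> c <= dotprod (gradient f (x + z)) a} -> c <= l.
Proof.
move=> Hl Hc.
pose q N z := N.+1%:R * (f (x + z + N.+1%:R^-1 *: a) - f (x + z)).
pose k N z := Num.min (q N z) c.
have mq N : measurable_fun setT (q N).
  apply: measurable_funM => //; apply: measurable_funB; last exact: measurable_shift fL _.
  have := measurable_shift fL (x + N.+1%:R^-1 *: a).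
  by apply: eq_measurable_fun => z _; rewrite addrAC.
have qle N z : `|q N z| <= L * enorm a by exact: diff_quotient_le.
have mk N : measurable_fun setT (k N) by exact: measurable_minr.
have kle N z : `|k N z| <= L * enorm a + `|c|.
  rewrite /k minEle; case: ifP => _; first by rewrite (le_trans (qle _ _))// lerDl.
  by rewrite lerDr mulr_ge0 ?enorm_ge0// (lipschitz_e_ge0 d0 fL).
have Iq N : U.-integrable setT (EFin \o q N) by apply: integrable_ae_bounded => //; exact: aeW.
have Ik N : U.-integrable setT (EFin \o k N) by apply: integrable_ae_bounded => //; exact: aeW.
have [|||||_ _ cvg] := @dominated_convergence _ _ R U setT measurableT (fun N => EFin \o k N)
  (EFin \o cst c) (EFin \o cst (L * enorm a + `|c|)).
- by move=> N; apply/measurable_EFinP.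
- by apply/measurable_EFinP.
- apply: (@filterS2 _ _ (ae_filter_ringOfSetsType U)) (ae_unif_rV_diff x) Hc => z fz /(_ fz) cz _.
  apply: cvg_EFin; first exact: nearW.
  apply/cvgrPdist_le => eps eps0.
  move/cvgrPdist_le: (rV_diff_quotient_cvg (h := a) fz) => /(_ _ eps0).
  apply: filterS => N; rewrite -/(q N z) /= /k => H.
  rewrite minEle; case: ifP => [qc|_]; last by rewrite subrr normr0 ltW.
  rewrite ger0_norm ?subr_ge0//; apply: le_trans H.
  by rewrite (le_trans _ (ler_norm _))// lerB.
- exact: probability_integrable_cst.
- by apply: aeW => z N _; rewrite /= lee_fin.
have {}cvg : \int[U]_z k N z @[N --> \oo] --> c.
  by apply: fine_cvg; move: cvg; rewrite /= integral_cst// [X in (_ * X)%E]probability_setT mule1.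
apply: (ler_cvg_to cvg Hl); apply: nearW => N.
rewrite (smoothB rho0 d0 fL) -RintegralZl//; last first.
  exact: (smoothB_integrable rho0 d0 fL).
rewrite [leRHS](@eq_Rintegral _ _ _ _ _ (q N)); last by move=> z _; rewrite /q addrAC.
by apply: le_Rintegral => // z _; rewrite /k ge_min lexx.
Qed.

Lemma convex_hull_segment (A : set 'rV[R]_d) a g (t : R) : 0 <= t <= 1 ->
  convex_hull A a -> A g -> convex_hull A (a + t *: (g - a)).
Proof.
move=> /andP[t0 t1] [n [b [x [b0 b1 Ax ->]]]] Ag.
exists n.+1, (fun i => oapp (fun j => (1 - t) * b j) t (unlift ord0 i)),
  (fun i => oapp x g (unlift ord0 i)); split.
- by move=> i; case: unliftP => [j|] _ //=; rewrite mulr_ge0// subr_ge0.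
- rewrite big_ord_recl unlift_none/=; under eq_bigr do rewrite liftK/=.
  by rewrite -mulr_sumr b1 mulr1 addrC subrK.
- by move=> i; case: unliftP => [j|] _ /=.
- rewrite big_ord_recl unlift_none/=; under [in RHS]eq_bigr do rewrite liftK/= -scalerA.
  by rewrite -scaler_sumr scalerBr scalerBl scale1r addrCA.
Qed.

Lemma ae_unif_ball_exists (Q : 'rV[R]_d -> Prop) : {ae U, forall z, Q z} -> exists z, Q z.
Proof.
move=> [N [mN N0 QN]]; apply: contrapT => nQ.
have : U setT = 0%E.
  rewrite -N0; congr (U _); apply/seteqP; split => // z _; apply: QN => Qz.
  by apply: nQ; exists z.
by rewrite [LHS]probability_setT => /eqP; rewrite onee_eq0.
Qed.

(* Expand [D <= |a + s (g - a)|], where the segment stays in the hull. *)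
Lemma min_norm_point_ge (A : set 'rV[R]_d) (D s : R) a g : 0 < s <= 1 -> 0 <= D ->
  (forall u, convex_hull A u -> D <= enorm u) -> convex_hull A a ->
  enorm a <= D + s ^+ 2 -> A g -> enorm g <= L ->
  D ^+ 2 - s * ((2 * D + 1 + (L + D + 1) ^+ 2) / 2) <= dotprod g a.
Proof.
move=> /andP[s0 s1] D0 DA Aa aD Ag gL.
have L0 := lipschitz_e_ge0 d0 fL.
have Da := DA _ Aa.
have s01 : 0 <= s <= 1 by rewrite ltW.
have := DA _ (convex_hull_segment s01 Aa Ag).
have s2 : s ^+ 2 <= 1 by rewrite expr_le1// ltW.
have gaB : enorm (g - a) ^+ 2 <= (L + D + 1) ^+ 2.
  rewrite ler_pXn2r ?nnegrE ?enorm_ge0//; last by rewrite !addr_ge0.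
  by rewrite (le_trans (enormB _ _))//; move: aD gL s2; lra.
have a2 : enorm a ^+ 2 <= D ^+ 2 + (2 * D + 1) * s ^+ 2.
  apply: (@le_trans _ _ ((D + s ^+ 2) ^+ 2)).
    by rewrite ler_pXn2r ?nnegrE ?enorm_ge0// addr_ge0 ?sqr_ge0.
  have : s ^+ 2 * s ^+ 2 <= s ^+ 2 by rewrite ler_piMl ?sqr_ge0.
  by set q := s ^+ 2 => qq; move: qq; lra.
have Da2 : D ^+ 2 <= enorm a ^+ 2 by rewrite ler_pXn2r ?nnegrE ?enorm_ge0.
rewrite -(@ler_pXn2r _ 2) ?nnegrE ?enorm_ge0//.
rewrite enorm2 dotprodDl !dotprodDr !dotprodZl !dotprodZr -!enorm2 dotprodBl dotprodBr -enorm2 (dotprodC a g).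
set b := dotprod g a; move: gaB a2 Da2; set X := enorm a ^+ 2; set Y := enorm (g - a) ^+ 2.
set B := (L + D + 1) ^+ 2 => gaB a2 Da2 H.
have H2 : s * Y <= s * B by rewrite ler_wpM2l// ltW.
have : 0 <= s * (2 * (b - X) + s * B + (2 * D + 1) * s).
  have : s * (s * Y) <= s * (s * B) by rewrite ler_wpM2l// ltW.
  by move: H a2; lra.
rewrite pmulr_rge0//.
by move: Da2; lra.
Qed.

(** As rho <= e, the gradients at x + z belong to the set for almost every z; in particular it is
    nonempty and D is finite. The approximate minimiser [a] has norm below D + s^2, one order better
    than the step s along the segment, so that division by s leaves an error O(s). *)
Lemma dist0_clarke_eps_le (e : R) x g : rho <= e ->
  (forall h, N.+1%:R * (smooth rho f (x + N.+1%:R^-1 *: h) - smooth rho f x) @[N --> \oo]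
     --> dotprod g h) ->
  (dist0 (clarke_eps e f x) <= (enorm g)%:E)%E.
Proof.
move=> rhoe Hg; set A := clarke_eps e f x.
have H0 : {ae U, forall z, rV_diff f (x + z) -> clarke_ball f e x (gradient f (x + z))}.
  apply: aeS (unif_ball_ae rho0) => z zr fz.
  by exists z; [exact: le_trans rhoe|exact: gradient_clarke].
have [a0 Aa0] : exists a0, A a0.
  have [z [Hz1 Hz2]] := ae_unif_ball_exists
    (@filterI _ _ (ae_filter_ringOfSetsType U) _ _ H0 (ae_unif_rV_diff x)).
  exists (gradient f (x + z)); exists 1%N, (fun=> 1), (fun=> gradient f (x + z)).
  by split => //; rewrite ?big_ord1 ?scale1r// => _; exact: Hz1.
have dist_ge0 : (0 <= dist0 A)%E.
  by apply: le_ereal_inf_tmp => _ [u _ <-]; rewrite lee_fin enorm_ge0.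
have dist_fin : dist0 A \is a fin_num.
  rewrite ge0_fin_numE//; apply: le_lt_trans (ltry (enorm a0)).
  by apply: ereal_inf_lbound; exists a0.
rewrite -(fineK dist_fin) lee_fin; set D := fine (dist0 A).
have D0 : 0 <= D by exact: fine_ge0.
have DA u : A u -> D <= enorm u.
  by move=> Au; rewrite -lee_fin /D fineK//; apply: ereal_inf_lbound; exists u.
(* The fraction is the error constant of [min_norm_point_ge]; the norm of [g] pays for replacing |a|
   by D. *)
pose M := (2 * D + 1 + (L + D + 1) ^+ 2) / 2 + enorm g.
have M0 : 0 < M.
  rewrite ltr_wpDr ?enorm_ge0// divr_gt0// ltr_wpDr ?sqr_ge0// ltr_wpDl// mulr_ge0//.
have HM (s : R) : 0 < s <= 1 -> D ^+ 2 - s * M <= enorm g * D.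
  move=> s01; have /andP[s0 s1] := s01.
  have [_ [a Aa <-]] := lb_ereal_inf_adherent (exprn_gt0 2 s0) dist_fin.
  rewrite -/(dist0 A) -(fineK dist_fin) -EFinD lte_fin -/D => /ltW aD.
  have := normr_dotprod_le g a => /(le_trans (ler_norm _)).
  have : enorm g * enorm a <= enorm g * (D + s ^+ 2) by rewrite ler_wpM2l ?enorm_ge0.
  have : enorm g * s ^+ 2 <= enorm g * s.
    by rewrite ler_wpM2l ?enorm_ge0// expr2 ler_piMl// ltW.
  suff : D ^+ 2 - s * ((2 * D + 1 + (L + D + 1) ^+ 2) / 2) <= dotprod g a.
    by rewrite /M; lra.
  apply: (smooth_derivative_ge (Hg a)).
  apply: aeS H0 => z /[swap] fz /(_ fz) Sz.
  apply: (min_norm_point_ge s01 D0 DA Aa aD Sz).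
  by apply: gradient_le fz => //; exact: fL.
have [->|Dn0] := eqVneq D 0; first exact: enorm_ge0.
rewrite -(ler_pM2r (_ : 0 < D)) ?lt_neqAle ?D0 ?(eq_sym 0) ?Dn0// -expr2 leNgt; apply/negP => DD.
(* Chosen so that [s * M] is at most half of the supposed positive gap, against [HM]. *)
pose s := Num.min 1 ((D ^+ 2 - enorm g * D) / (2 * M)).
have s0 : 0 < s <= 1.
  rewrite lt_min ltr01/= ge_min lexx/= andbT divr_gt0 ?subr_gt0//.
  by rewrite mulr_gt0.
have := HM s s0; have : s * M <= (D ^+ 2 - enorm g * D) / 2.
  rewrite -ler_pdivlMr// /s ge_min; apply/orP; right.
  by rewrite le_eqVlt; apply/orP; left; apply/eqP; field; rewrite gt_eqF.
by move: DD; lra.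
Qed.

End clarke_smoothing.

(** * Independent families *)

Section independence.
Context dT (T : measurableType dT) {R : realType} (Pr : probability T R).
Variables C1 C2 : set (set T).
Hypotheses (mC1 : C1 `<=` measurable) (mC2 : C2 `<=` measurable).
Hypotheses (setI1 : setI_closed C1) (setI2 : setI_closed C2).
Hypotheses (C1T : C1 setT) (C2T : C2 setT).
Hypothesis indep : forall A B, C1 A -> C2 B -> Pr (A `&` B) = (Pr A * Pr B)%E.

Let sigma_measurable (C : set (set T)) : C `<=` measurable -> <<s C >> `<=` measurable.
Proof.
by move=> mC; apply: smallest_sub => //; exact: sigma_algebra_measurable.
Qed.

(** For fixed B both sides are finite measures in A which agree on the pi-system C1, hence on the
    sigma-algebra it generates. *)
Lemma indep_sigma_left A B : <<s C1 >> A -> C2 B -> Pr (A `&` B) = (Pr A * Pr B)%E.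
Proof.
move=> sA C2B; have mB := mC2 C2B.
have PB : Pr B \is a fin_num by exact: fin_num_measure.
have PB0 : 0 <= fine (Pr B) by rewrite fine_ge0.
have H := @g_sigma_algebra_measure_unique _ R T C1 mC1 (fun=> setT) (fun=> C1T) _
  (mrestr Pr mB) (mscale (NngNum PB0) Pr) setI1.
transitivity (mscale (NngNum PB0) Pr A); last by rewrite /mscale/= fineK// muleC.
apply: H => //.
- by rewrite bigcup_const//; exists 0%N.
- move=> D C1D; transitivity (Pr (D `&` B)) => //.
  by rewrite indep// muleC -[X in (X * _)%E = _](fineK PB).
- move=> _; rewrite [ltLHS](_ : _ = Pr (setT `&` B)) ?setTI//.
    by rewrite ltey_eq PB.
  by transitivity (Pr (setT `&` B)); [|rewrite setTI].
Qed.

Lemma indep_sigma A B : <<s C1 >> A -> <<s C2 >> B -> Pr (A `&` B) = (Pr A * Pr B)%E.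
Proof.
move=> sA sB; have mA := sigma_measurable mC1 sA.
have PA : Pr A \is a fin_num by exact: fin_num_measure.
have PA0 : 0 <= fine (Pr A) by rewrite fine_ge0.
have H := @g_sigma_algebra_measure_unique _ R T C2 mC2 (fun=> setT) (fun=> C2T) _
  (mrestr Pr mA) (mscale (NngNum PA0) Pr) setI2.
transitivity (mscale (NngNum PA0) Pr B); last by rewrite /mscale/= fineK.
rewrite setIC; apply: H => //.
- by rewrite bigcup_const//; exists 0%N.
- move=> D C2D; transitivity (Pr (D `&` A)) => //.
  by rewrite setIC indep_sigma_left// -[X in (X * _)%E = _](fineK PA).
- move=> _; rewrite [ltLHS](_ : _ = Pr (setT `&` A)) ?setTI//.
    by rewrite ltey_eq PA.
  by transitivity (Pr (setT `&` A)); [|rewrite setTI].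
Qed.

Local Notation T1 := (g_sigma_algebraType C1).
Local Notation T2 := (g_sigma_algebraType C2).

Let m1 : measurable_fun setT (fun t : T => t : T1).
Proof. by move=> _ A sA; rewrite setTI; exact: (sigma_measurable mC1 sA). Qed.

Let m2 : measurable_fun setT (fun t : T => t : T2).
Proof. by move=> _ A sA; rewrite setTI; exact: (sigma_measurable mC2 sA). Qed.

Let m12 : measurable_fun setT (fun t : T => (t : T1, t : T2)).
Proof. exact/measurable_fun_pairP. Qed.

Let X1 : {RV Pr >-> T1} := mfun_Sub (mem_set m1).
Let X2 : {RV Pr >-> T2} := mfun_Sub (mem_set m2).
Let X12 : {RV Pr >-> (T1 * T2)%type} := mfun_Sub (mem_set m12).
Let P1 : probability T1 R := distribution Pr X1.
Let P2 : probability T2 R := distribution Pr X2.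

(* The law of the diagonal map [t |-> (t, t)] into the two sub-sigma-algebras is
   the product of their laws. *)
Let P12E (A : set (T1 * T2)) : measurable A -> (P1 \x P2)%E A = distribution Pr X12 A.
Proof.
by move=> mA; apply: product_measure_unique => // B1 B2 sB1 sB2; exact: indep_sigma.
Qed.

Let P12_ge0_integral (f : T1 * T2 -> \bar R) : measurable_fun setT f ->
  (forall u, 0 <= f u)%E -> (\int[(P1 \x P2)%E]_u f u = \int[Pr]_t f (t, t))%E.
Proof.
move=> mf f0; rewrite (@eq_measure_integral _ _ _ _ (distribution Pr X12)).
  by rewrite ge0_integral_distribution.
by move=> A mA _; exact: (P12E mA).
Qed.

(** Tonelli's theorem for the joint law on the two sub-sigma-algebras. It replaces conditional
    expectation: one argument holds the past, the other the fresh samples, and the latter are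
    integrated first. *)
Lemma indep_ge0_integral (Phi : T -> T -> \bar R) :
  measurable_fun setT (fun u : T1 * T2 => Phi u.1 u.2) -> (forall t t', 0 <= Phi t t')%E ->
  (\int[Pr]_t Phi t t = \int[Pr]_t \int[Pr]_t' Phi t t')%E.
Proof.
move=> mPhi Phi0.
rewrite -(@P12_ge0_integral (fun u => Phi u.1 u.2))//.
rewrite fubini_tonelli1// ge0_integral_distribution//; last 2 first.
- by apply: measurable_fun_fubini_tonelli_F.
- by move=> t; apply: integral_ge0.
apply: eq_integral => t _; rewrite /fubini_F/= ge0_integral_distribution//.
have mt : measurable_fun setT (fun t' : T2 => (t : T1, t')) by exact: measurable_fun_pair.
exact: (measurableT_comp mPhi mt).
Qed.

Lemma indep_RintegralM (X Y : T -> R) :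
  measurable_fun setT (X : T1 -> R) -> measurable_fun setT (Y : T2 -> R) ->
  Pr.-integrable setT (EFin \o X) -> Pr.-integrable setT (EFin \o Y) ->
  Pr.-integrable setT (EFin \o (fun t => X t * Y t)) /\
  \int[Pr]_t (X t * Y t) = \int[Pr]_t X t * \int[Pr]_t Y t.
Proof.
move=> mX mY IX IY.
have mX' : measurable_fun setT X by exact: (measurableT_comp mX m1).
have mY' : measurable_fun setT Y by exact: (measurableT_comp mY m2).
have mXY : measurable_fun setT (fun u : T1 * T2 => X u.1 * Y u.2).
  by apply: measurable_funM; apply: measurableT_comp.
have IXY : Pr.-integrable setT (EFin \o (fun t => X t * Y t)).
  apply/integrableP; split; first by apply/measurable_EFinP; exact: measurable_funM.
  rewrite (@indep_ge0_integral (fun t t' => `|X t * Y t'|%:E)); first last.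
  - by move=> t t'; rewrite lee_fin.
  - by apply/measurable_EFinP; exact: measurableT_comp.
  under eq_integral => t _.
    under eq_integral => t' _ do rewrite normrM EFinM.
    rewrite ge0_integralZl_EFin//; last by apply/measurable_EFinP; exact: measurableT_comp.
    over.
  have /integrableP[_ IX'] := IX; have /integrableP[_ IY'] := IY.
  rewrite ge0_integralZr//.
  - by apply: lte_mul_pinfty => //; [exact: integral_ge0|rewrite ge0_fin_numE//; exact: integral_ge0].
  - by apply/measurable_EFinP; exact: measurableT_comp.
  - exact: integral_ge0.
split => //.
have I12 : (P1 \x P2)%E.-integrable setT (EFin \o (fun u : T1 * T2 => X u.1 * Y u.2)).
  apply/integrableP; split; first exact/measurable_EFinP.
  rewrite P12_ge0_integral//; first by have /integrableP[] := IXY.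
  by apply: measurableT_comp => //; exact/measurable_EFinP.
have I1 : P1.-integrable setT (EFin \o (X : T1 -> R)).
  apply/integrableP; split; first exact/measurable_EFinP.
  rewrite ge0_integral_distribution//; first by have /integrableP[] := IX.
  by apply: measurableT_comp => //; exact/measurable_EFinP.
have I2 : P2.-integrable setT (EFin \o (Y : T2 -> R)).
  apply/integrableP; split; first exact/measurable_EFinP.
  rewrite ge0_integral_distribution//; first by have /integrableP[] := IY.
  by apply: measurableT_comp => //; exact/measurable_EFinP.
transitivity (\int[(P1 \x P2)%E]_u (X u.1 * Y u.2)).
  rewrite /Rintegral; congr fine.
  rewrite [RHS](@eq_measure_integral _ _ _ _ (distribution Pr X12)).
    by rewrite integral_distribution//; exact/measurable_EFinP.
  by move=> A mA _; exact: (P12E mA).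
rewrite {1}/Rintegral -(integral12_prod_meas1 I12).
transitivity (\int[P1]_t (X t * \int[P2]_t' Y t')).
  rewrite [RHS]/Rintegral; congr fine; apply: eq_integral => t _.
  rewrite /fubini_F/= -RintegralZl// /Rintegral fineK//.
  apply: integrable_fin_num => //.
  by have := integrableZl measurableT (X t) I2.
rewrite RintegralZr//; congr (_ * _).
  by rewrite /Rintegral integral_distribution//; exact/measurable_EFinP.
by rewrite /Rintegral integral_distribution//; exact/measurable_EFinP.
Qed.

End independence.

Lemma telescope_step (R : realType) (E0 E1 n s : \bar R) (b q : R) :
  (E1 + n <= E0 + q%:E -> E0 + s <= b%:E -> E1 + (s + n) <= (b + q)%:E)%E.
Proof.
move=> H1 H2; rewrite (addeC s) addeA EFinD; apply: (@le_trans _ _ (E0 + q%:E + s)%E).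
  exact: leeD.
by rewrite addeAC; exact: leeD.
Qed.

Lemma integralD_le_cst dT (T : measurableType dT) (R : realType) (P : probability T R)
  (a b e : T -> \bar R) (q : R) : measurable_fun setT a -> measurable_fun setT b ->
  measurable_fun setT e -> (forall t, 0 <= a t)%E -> (forall t, 0 <= b t)%E ->
  (forall t, 0 <= e t)%E -> 0 <= q -> (forall t, a t + b t <= e t + q%:E)%E ->
  (\int[P]_t a t + \int[P]_t b t <= \int[P]_t e t + q%:E)%E.
Proof.
move=> ma mb me a0 b0 e0 q0 abeq.
have -> : (q%:E = \int[P]_t (cst q%:E t))%E.
  by rewrite integral_cst// [X in (_ * X)%E]probability_setT mule1.
rewrite -ge0_integralD// -ge0_integralD//.
apply: ge0_le_integral => //.
- by move=> t _; rewrite adde_ge0.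
- exact: emeasurable_funD.
- exact: emeasurable_funD.
Qed.

(** * The stochastic gradient iteration *)

Section measurable_iterates.
Context {R : realType} {d p : nat} dT (T : measurableType dT).
Variables (G : 'rV[R]_d * 'rV[R]_p -> 'rV[R]_d) (S : nat) (eta : R).
Hypothesis mG : measurable_fun setT G.

Lemma measurable_pisgd_step (x : T -> 'rV[R]_d) (z : nat -> T -> 'rV[R]_d)
  (y : nat -> T -> 'rV[R]_p) : measurable_fun setT x ->
  (forall l, (1 <= l <= S)%N -> measurable_fun setT (z l)) ->
  (forall l, (1 <= l <= S)%N -> measurable_fun setT (y l)) ->
  measurable_fun setT (fun t => x t - (eta / S%:R) *: \sum_(1 <= l < S.+1) G (x t + z l t, y l t)).
Proof.
move=> mx mz my; apply: measurable_fun_rV => i.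
under eq_fun do rewrite !mxE summxE big_add1 big_mkord.
apply: measurable_funB; first exact: measurable_fun_rVP.
apply: measurable_funM => //; apply: measurable_sum => l.
apply: (measurableT_comp (@measurable_coord R d i)); apply: (measurableT_comp mG).
have lS : (1 <= l.+1 <= S)%N by rewrite ltn_ord.
apply: measurable_fun_pair; last exact: my.
apply: measurable_fun_rV => j; under eq_fun do rewrite mxE.
by apply: measurable_funD; apply: measurable_fun_rVP => //; exact: mz.
Qed.

(** The measurable space is left arbitrary so that it may be a sigma-algebra generated by some of
    the samples only; measurability then expresses on which samples the iterate depends. *)
Lemma measurable_pisgd_iterate (x1 : 'rV[R]_d) (z : nat -> nat -> T -> 'rV[R]_d)
  (y : nat -> nat -> T -> 'rV[R]_p) k :
  (forall k' l, (1 <= k' <= k)%N -> (1 <= l <= S)%N -> measurable_fun setT (z k' l)) ->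
  (forall k' l, (1 <= k' <= k)%N -> (1 <= l <= S)%N -> measurable_fun setT (y k' l)) ->
  measurable_fun setT
    (fun t => pisgd_iterate eta S G x1 (fun k l => z k l t) (fun k l => y k l t) k).
Proof.
elim: k => [|k IH] mz my /=; first exact: measurable_cst.
apply: (@measurable_pisgd_step _ (fun l t => z k.+1 l t) (fun l t => y k.+1 l t)).
- by apply: IH => k' l /andP[k0 k'k]; [apply: mz|apply: my]; rewrite k0 leqW.
- by move=> l lS; apply: mz => //; rewrite /= leqnn.
- by move=> l lS; apply: my => //; rewrite /= leqnn.
Qed.

End measurable_iterates.

(** * The sampling model and the decrease in expectation *)

Section pisgd.
Context {R : realType} {d p : nat} dT (T : measurableType dT) (Pr : probability T R).
Variables (Pxi : probability 'rV[R]_p R) (K S : nat) (rho : R) (r : {RV Pr >-> nat}).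
Variables (z : nat -> nat -> {RV Pr >-> 'rV[R]_d}) (y : nat -> nat -> {RV Pr >-> 'rV[R]_p}).
Hypothesis sampling : pisgd_sampling Pxi K S rho r z y.
Hypothesis rho0 : 0 < rho.
Local Notation U := (@unif_ball R d rho).
Implicit Type J : nat -> nat -> bool -> bool.

Definition sample_event (E : set nat) (B : nat -> nat -> set 'rV[R]_d)
    (D : nat -> nat -> set 'rV[R]_p) : set T :=
  [set t | E (r t) /\ forall k l, (1 <= k < K)%N -> (1 <= l <= S)%N ->
                 B k l (z k l t) /\ D k l (y k l t)].

(* The events that constrain [r] only if [jr], [z k l] only if [J k l true], and
   [y k l] only if [J k l false]. *)
Definition sample_events (jr : bool) (J : nat -> nat -> bool -> bool) : set (set T) :=
  [set A | exists E B D, [/\ forall k l, measurable (B k l), forall k l, measurable (D k l),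
     ~~ jr -> E = setT,
     forall k l, (~~ J k l true -> B k l = setT) /\ (~~ J k l false -> D k l = setT) &
     A = sample_event E B D]].

Lemma sample_eventI E E' B B' D D' : sample_event E B D `&` sample_event E' B' D' =
  sample_event (E `&` E') (fun k l => B k l `&` B' k l) (fun k l => D k l `&` D' k l).
Proof.
apply/seteqP; split => t.
  by move=> [[Et H] [E't H']]; split => // k l kK lS; have [] := H k l kK lS; have [] := H' k l kK lS.
by move=> [[Et E't] H]; split; split => // k l kK lS; have [[? ?] [? ?]] := H k l kK lS.
Qed.

Lemma measurable_sample_events jr J : sample_events jr J `<=` measurable.
Proof.
move=> _ [E [B [D [mB mD _ _ ->]]]].
rewrite (_ : sample_event E B D = (r @^-1` E) `&` [set t | forall k l, (1 <= k < K)%N ->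
    (1 <= l <= S)%N -> ((z k l @^-1` B k l) `&` (y k l @^-1` D k l)) t]).
  apply: measurableI; first exact: measurable_sfunP.
  apply: measurable_forall => k; apply: measurable_forall => l.
  apply: measurable_imply_cst => _; apply: measurable_imply_cst => _.
  by apply: measurableI; exact: measurable_sfunP.
by apply/seteqP; split.
Qed.

Lemma sample_events_setI jr J : setI_closed (sample_events jr J).
Proof.
move=> _ _ [E [B [D [mB mD hr hJ ->]]]] [E' [B' [D' [mB' mD' hr' hJ' ->]]]].
rewrite sample_eventI; do 3!eexists; split; last by reflexivity.
- by move=> k l; exact: measurableI.
- by move=> k l; exact: measurableI.
- by move=> jr0; rewrite hr// hr'// setTI.
- move=> k l; have [h1 h2] := hJ k l; have [h3 h4] := hJ' k l.
  by split => j0; rewrite ?h1 ?h2 ?h3 ?h4// setTI.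
Qed.

Lemma sample_events_setT jr J : sample_events jr J setT.
Proof.
exists setT, (fun _ _ => setT), (fun _ _ => setT); split => //.
by apply/seteqP; split.
Qed.

(** An intersection of two sample events is again one, so the product formula of [pisgd_indep]
    applies to all three. In each factor at least one of the two constraints is the whole space,
    which splits the product. *)
Lemma sample_events_indep jr jr' J J' A A' : ~~ (jr && jr') ->
  (forall k l b, ~~ (J k l b && J' k l b)) ->
  sample_events jr J A -> sample_events jr' J' A' -> Pr (A `&` A') = (Pr A * Pr A')%E.
Proof.
move=> jrr JJ [E [B [D [mB mD hr hJ ->]]]] [E' [B' [D' [mB' mD' hr' hJ' ->]]]].
have PT (X : set T) : X = setT -> Pr X = 1%E by move->; exact: probability_setT.
have PI (X Y : set T) : X = setT \/ Y = setT -> Pr (X `&` Y) = (Pr X * Pr Y)%E.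
  by move=> [->|->]; rewrite ?setTI ?setIT (PT setT)// ?mul1e ?mule1.
rewrite sample_eventI (pisgd_indep sampling); try by move=> k l; exact: measurableI.
rewrite (pisgd_indep sampling)// (pisgd_indep sampling)//.
rewrite preimage_setI PI; last first.
  by move: jrr; rewrite negb_and => /orP[/hr ->|/hr' ->]; [left|right].
rewrite muleACA; congr (_ * _)%E.
rewrite -big_split; apply: eq_bigr => k _; rewrite -big_split; apply: eq_bigr => l _.
rewrite preimage_setI PI; last first.
  have := JJ k l true; rewrite negb_and.
  by move=> /orP[/(hJ k l).1 ->|/(hJ' k l).1 ->]; [left|right].
rewrite preimage_setI PI; last first.
  have := JJ k l false; rewrite negb_and.
  by move=> /orP[/(hJ k l).2 ->|/(hJ' k l).2 ->]; [left|right].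
by rewrite muleACA.
Qed.

Lemma sample_ge0_integral_indep jr jr' J J' (Phi : T -> T -> \bar R) :
  ~~ (jr && jr') -> (forall k l b, ~~ (J k l b && J' k l b)) ->
  measurable_fun setT (fun u : g_sigma_algebraType (sample_events jr J) *
    g_sigma_algebraType (sample_events jr' J') => Phi u.1 u.2) ->
  (forall t t', 0 <= Phi t t')%E ->
  (\int[Pr]_t Phi t t = \int[Pr]_t \int[Pr]_t' Phi t t')%E.
Proof.
move=> jrr JJ; apply: indep_ge0_integral; try exact: measurable_sample_events;
  try exact: sample_events_setI; try exact: sample_events_setT.
by move=> A B; exact: sample_events_indep.
Qed.

Lemma sample_z_event jr J k l (A : set 'rV[R]_d) : (1 <= k < K)%N -> (1 <= l <= S)%N ->
  J k l true -> measurable A -> sample_events jr J (z k l @^-1` A).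
Proof.
move=> kK lS Jkl mA.
exists setT, (fun k' l' => if (k' == k) && (l' == l) then A else setT), (fun _ _ => setT); split => //.
- by move=> k' l'; case: ifP.
- by move=> k' l'; split => //; case: ifP => // /andP[/eqP -> /eqP ->]; rewrite Jkl.
apply/seteqP; split => t /=.
  by move=> At; split => // k' l' _ _; split => //; case: ifP => // /andP[/eqP -> /eqP ->].
by move=> [_ /(_ k l kK lS)[]]; rewrite !eqxx.
Qed.

Lemma sample_y_event jr J k l (A : set 'rV[R]_p) : (1 <= k < K)%N -> (1 <= l <= S)%N ->
  J k l false -> measurable A -> sample_events jr J (y k l @^-1` A).
Proof.
move=> kK lS Jkl mA.
exists setT, (fun _ _ => setT), (fun k' l' => if (k' == k) && (l' == l) then A else setT); split => //.
- by move=> k' l'; case: ifP.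
- by move=> k' l'; split => //; case: ifP => // /andP[/eqP -> /eqP ->]; rewrite Jkl.
apply/seteqP; split => t /=.
  by move=> At; split => // k' l' _ _; split => //; case: ifP => // /andP[/eqP -> /eqP ->].
by move=> [_ /(_ k l kK lS)[]]; rewrite !eqxx.
Qed.

Lemma sample_r_event J (A : set nat) : sample_events true J (r @^-1` A).
Proof.
by exists A, (fun _ _ => setT), (fun _ _ => setT); split => //; apply/seteqP; split => t // [].
Qed.

Lemma measurable_sample_z jr J k l : (1 <= k < K)%N -> (1 <= l <= S)%N -> J k l true ->
  measurable_fun setT (z k l : g_sigma_algebraType (sample_events jr J) -> 'rV[R]_d).
Proof.
by move=> kK lS Jkl _ A mA; rewrite setTI; apply: sub_sigma_algebra; exact: sample_z_event.
Qed.

Lemma measurable_sample_y jr J k l : (1 <= k < K)%N -> (1 <= l <= S)%N -> J k l false ->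
  measurable_fun setT (y k l : g_sigma_algebraType (sample_events jr J) -> 'rV[R]_p).
Proof.
by move=> kK lS Jkl _ A mA; rewrite setTI; apply: sub_sigma_algebra; exact: sample_y_event.
Qed.

Section pair_law.
Variables k l : nat.
Hypotheses (kK : (1 <= k < K)%N) (lS : (1 <= l <= S)%N).

Let mzy : measurable_fun setT (fun t => (z k l t, y k l t)).
Proof. by apply: measurable_fun_pair. Qed.

Let ZY : {RV Pr >-> ('rV[R]_d * 'rV[R]_p)%type} := mfun_Sub (mem_set mzy).

Let ZYE (A : set ('rV[R]_d * 'rV[R]_p)) : measurable A ->
  (U \x Pxi)%E A = distribution Pr ZY A.
Proof.
move=> mA; apply: product_measure_unique => // B1 B2 mB1 mB2.
rewrite [LHS](_ : _ = Pr ((z k l @^-1` B1) `&` (y k l @^-1` B2)))//.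
(* The first selector retains all perturbations, the second all data points. *)
rewrite (@sample_events_indep false false (fun k' l' b => b) (fun k' l' b => ~~ b))//.
- congr (_ * _)%E; last exact: (pisgd_data sampling kK lS mB2).
  by rewrite [RHS](unif_ball_uniform rho0); exact: (pisgd_perturbation sampling kK lS mB1).
- by move=> k' l' [].
- exact: sample_z_event.
- exact: sample_y_event.
Qed.

Lemma sample_ge0_integral (f : 'rV[R]_d * 'rV[R]_p -> \bar R) : measurable_fun setT f ->
  (forall u, 0 <= f u)%E ->
  (\int[Pr]_t f (z k l t, y k l t) = \int[(U \x Pxi)%E]_u f u)%E.
Proof.
move=> mf f0; rewrite [RHS](@eq_measure_integral _ _ _ _ (distribution Pr ZY)).
  by rewrite ge0_integral_distribution.
by move=> A mA _; exact: ZYE.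
Qed.

Lemma sample_integrable (f : 'rV[R]_d * 'rV[R]_p -> R) :
  (U \x Pxi)%E.-integrable setT (EFin \o f) ->
  Pr.-integrable setT (EFin \o (fun t => f (z k l t, y k l t))).
Proof.
move=> /integrableP[mf foo]; apply/integrableP; split.
  exact: (measurableT_comp mf mzy).
rewrite (@sample_ge0_integral (fun u => `|(EFin \o f) u|%E))//.
exact: measurableT_comp.
Qed.

Lemma sample_Rintegral (f : 'rV[R]_d * 'rV[R]_p -> R) :
  (U \x Pxi)%E.-integrable setT (EFin \o f) ->
  \int[Pr]_t f (z k l t, y k l t) = \int[(U \x Pxi)%E]_u f u.
Proof.
move=> If; have mf := measurable_int _ If; rewrite /Rintegral; congr fine.
rewrite [RHS](@eq_measure_integral _ _ _ _ (distribution Pr ZY)).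
  by rewrite integral_distribution//; exact: sample_integrable.
by move=> A mA _; exact: ZYE.
Qed.

End pair_law.

Lemma measurable_random_index dX (X : measurableType dX) (h : nat -> T -> X) :
  (forall k, measurable_fun setT (h k)) -> measurable_fun setT (fun t => h (r t).-1 t).
Proof.
move=> mh _ A mA; rewrite setTI.
rewrite (_ : _ @^-1` A = [set t | exists k, ((r @^-1` [set k]) `&` (h k.-1 @^-1` A)) t]).
  apply: measurable_exists => k; apply: measurableI; first exact: measurable_sfunP.
  by rewrite -[X in measurable X]setTI; exact: mh.
apply/seteqP; split => t /=; first by move=> At; exists (r t).
by move=> [k [-> At]].
Qed.

Lemma index_mass k : (k < K)%N -> (\int[Pr]_t (\1_[set k.+1] (r t))%:E = (K%:R^-1)%:E)%E.
Proof.
move=> kK; rewrite -(pisgd_index sampling (k := k.+1))//.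
transitivity (\int[Pr]_t (\1_(r @^-1` [set k.+1]) t)%:E)%E.
  by apply: eq_integral => t _; congr (_%:E); rewrite !indicE.
by rewrite integral_indic ?setIT//; exact: measurable_sfunP.
Qed.

Let measurable_ind (k : nat) : measurable_fun setT (fun t => \1_[set k.+1] (r t) : R).
Proof.
rewrite (_ : (fun _ => _) = \1_(r @^-1` [set k.+1])).
  by apply: measurable_indic; exact: measurable_sfunP.
by apply/funext => t; rewrite !indicE.
Qed.

(** The law of r is prescribed on 1, ..., K only; these K masses 1 / K already add up to 1, so the
    other values are negligible. *)
Lemma ae_index : (0 < K)%N -> {ae Pr, forall t, (1 <= r t <= K)%N}.
Proof.
move=> K0; pose A := [set t | (1 <= r t <= K)%N].
have mA : measurable A.
  by rewrite (_ : A = r @^-1` [set k | (1 <= k <= K)%N])//; exact: measurable_sfunP.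
exists (~` A); split => //; first exact: measurableC.
rewrite [LHS]probability_setC//.
suff -> : Pr A = 1%E by rewrite subee.
transitivity (\int[Pr]_t (\1_A t)%:E)%E; first by rewrite integral_indic ?setIT.
transitivity (\int[Pr]_t (\sum_(k < K) (\1_[set k.+1] (r t))%:E))%E.
  apply: eq_integral => t _; rewrite sumEFin; congr (_%:E).
  have [/andP[r1 rK]|rn] := boolP (1 <= r t <= K)%N.
    have rK' : ((r t).-1 < K)%N by rewrite prednK.
    rewrite (bigD1 (Ordinal rK'))//= big1 ?addr0.
      by rewrite prednK// !indicE !mem_set// /A/= r1.
    move=> k kr; rewrite indicE memNset//= => E.
    by move/eqP: kr; apply; apply: val_inj; rewrite /= E.
  rewrite indicE memNset//=; last by apply/negP.
  rewrite big1// => k _; rewrite indicE memNset//= => E.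
  by move: rn; rewrite E ltn_ord.
rewrite ge0_integral_sum//; last first.
  by move=> k; apply/measurable_EFinP; exact: measurable_ind.
rewrite (eq_bigr (fun=> (K%:R^-1)%:E)); last by move=> k _; rewrite index_mass.
rewrite sumEFin; congr (_%:E).
by rewrite sumr_const card_ord -[_ *+ K]mulr_natl divff// pnatr_eq0 -lt0n.
Qed.

(** Split according to the value of r and decouple its indicator from [psi k], which depends on the
    perturbations and the data only. The shift by one matches iterates counted from 0 with indices
    counted from 1. *)
Lemma index_integral (psi : nat -> T -> \bar R) : (0 < K)%N -> (forall k t, 0 <= psi k t)%E ->
  (forall k, measurable_fun setT (psi k)) ->
  (forall k, (k < K)%N -> measurable_fun setT
    (psi k : g_sigma_algebraType (sample_events false (fun _ _ _ => true)) -> \bar R)) ->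
  (\int[Pr]_t psi (r t).-1 t = (K%:R^-1)%:E * \sum_(k < K) \int[Pr]_t psi k t)%E.
Proof.
move=> K0 psi0 mpsi spsi.
pose J0 (k l : nat) (b : bool) := false.
pose J1 (k l : nat) (b : bool) := true.
transitivity (\int[Pr]_t (\sum_(k < K) (\1_[set k.+1] (r t))%:E * psi k t))%E.
  apply: ae_eq_integral => //.
  - exact: measurable_random_index.
  - apply: emeasurable_sum => k; apply: emeasurable_funM => //.
    by apply/measurable_EFinP; exact: measurable_ind.
  - apply: aeS (ae_index K0) => t /andP[r1 rK] _ /=.
    have rK' : ((r t).-1 < K)%N by rewrite prednK.
    rewrite (bigD1 (Ordinal rK'))//= big1 ?adde0.
      by rewrite indicE mem_set/= ?prednK// mul1e.
    move=> k kr; rewrite indicE memNset/= ?mul0e// => E.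
    by move/eqP: kr; apply; apply: val_inj; rewrite /= E.
rewrite ge0_integral_sum//; last 2 first.
- move=> k; apply: emeasurable_funM => //.
  by apply/measurable_EFinP; exact: measurable_ind.
- by move=> k t _; rewrite mule_ge0// lee_fin.
rewrite ge0_sume_distrr; last by move=> k _; exact: integral_ge0.
apply: eq_bigr => k _.
rewrite (sample_ge0_integral_indep (jr := true) (J := J0) (jr' := false) (J' := J1)
  (Phi := fun t t' => (\1_[set k.+1] (r t))%:E * psi k t')%E)//.
- rewrite -(index_mass (ltn_ord k)).
  transitivity (\int[Pr]_t ((\1_[set k.+1] (r t))%:E * \int[Pr]_t' psi k t')%E)%E.
    by apply: eq_integral => t _; rewrite ge0_integralZl_EFin.
  rewrite ge0_integralZr//.
  + by apply/measurable_EFinP; exact: measurable_ind.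
  + exact: integral_ge0.
- apply: emeasurable_funM; last first.
    by apply: (measurableT_comp (spsi k (ltn_ord k))).
  apply/measurable_EFinP.
  have mr : measurable_fun setT (fun t : g_sigma_algebraType
      (sample_events true J0) => \1_[set k.+1] (r t) : R).
    rewrite (_ : (fun _ => _) = \1_(r @^-1` [set k.+1])).
      by apply: measurable_indic; apply: sub_sigma_algebra; exact: sample_r_event.
    by apply/funext => t; rewrite !indicE.
  exact: (measurableT_comp mr measurable_fst).
- by move=> t t'; rewrite mule_ge0// lee_fin.
Qed.

Hypothesis d0 : (0 < d)%N.
Variables (F : 'rV[R]_d -> 'rV[R]_p -> R) (C : 'rV[R]_p -> R)
  (G : 'rV[R]_d * 'rV[R]_p -> 'rV[R]_d) (L0 Q : R).
Hypothesis cF : caratheodory F.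
Hypothesis lipF : {ae Pxi, forall y, lipschitz_e (F ^~ y) (C y)}.
Hypothesis intC : Pxi.-integrable setT (EFin \o C).
Hypothesis C2 : (\int[Pxi]_y (C y ^+ 2)%:E = Q%:E)%E.
Hypothesis intF : forall w, Pxi.-integrable setT (EFin \o F w).
Hypothesis hG : approx_gradient Pxi F G.
Local Notation f := (fun w => \int[Pxi]_y F w y).
Hypothesis fL : lipschitz_e f L0.
Local Notation fs := (smooth rho f).
Local Notation g := (smooth_gradient Pxi rho G).
Let mG := hG.1.

Section moments.
Variables (k : nat) (x : 'rV[R]_d).
Hypothesis kK : (1 <= k < K)%N.

Let V l t := G (x + z k l t, y k l t).

Let sample_coord l i : (1 <= l <= S)%N ->
  Pr.-integrable setT (EFin \o (fun t => V l t 0 i)) /\ \int[Pr]_t V l t 0 i = g x 0 i.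
Proof.
move=> lS.
have I := integrable_approx_gradient rho0 d0 cF.1 cF.2 lipF intC mG hG.2 x i.
split; first exact: (sample_integrable kK lS I).
by rewrite mxE -(sample_Rintegral kK lS I).
Qed.

Let measurable_V l : measurable_fun setT (V l).
Proof.
by apply: (measurableT_comp (measurableT_comp mG (measurable_translate x))
  (g := fun t => (z k l t, y k l t))); exact: measurable_fun_pair.
Qed.

Let sample_second_moment l : (1 <= l <= S)%N ->
  Pr.-integrable setT (EFin \o (fun t => enorm (V l t) ^+ 2)) /\
  \int[Pr]_t (enorm (V l t) ^+ 2) <= Q.
Proof.
move=> lS.
have mV : measurable_fun setT (fun t => enorm (V l t) ^+ 2).
  by apply: measurable_funX; apply: (measurableT_comp measurable_enorm (measurable_V l)).
have VQ : (\int[Pr]_t (enorm (V l t) ^+ 2)%:E <= Q%:E)%E.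
  rewrite (sample_ge0_integral kK lS
    (f := fun u => (enorm (G (translate x u)) ^+ 2)%:E)).
  - rewrite -C2.
    exact: (approx_gradient_second_moment rho0 d0 cF.1 cF.2 lipF intC mG hG.2).
  - apply/measurable_EFinP; apply: measurable_funX.
    exact: (measurableT_comp measurable_enorm (measurableT_comp mG (measurable_translate x))).
  - by move=> u; rewrite lee_fin sqr_ge0.
have IV : Pr.-integrable setT (EFin \o (fun t => enorm (V l t) ^+ 2)).
  apply/integrableP; split; first exact/measurable_EFinP.
  under eq_integral do rewrite /= ger0_norm ?sqr_ge0//.
  exact: le_lt_trans VQ (ltry _).
by split => //; rewrite -lee_fin /Rintegral fineK//; exact: integrable_fin_num.
Qed.

(** The selector [J n] keeps the samples whose position in the batch is n, so the gradients numbered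
    l and m are independent. The product rule is applied coordinate by coordinate, each mean being
    that of [smooth_gradient]. *)
Let sample_cross_moment l m : (1 <= l <= S)%N -> (1 <= m <= S)%N -> l != m ->
  Pr.-integrable setT (EFin \o (fun t => dotprod (V l t) (V m t))) /\
  \int[Pr]_t dotprod (V l t) (V m t) = enorm (g x) ^+ 2.
Proof.
move=> lS mS lm.
pose J n (k' l' : nat) (b : bool) := l' == n.
have I i : Pr.-integrable setT (EFin \o (fun t => V l t 0 i * V m t 0 i)) /\
    \int[Pr]_t (V l t 0 i * V m t 0 i) = g x 0 i ^+ 2.
  have [I1 E1] := sample_coord i lS; have [I2 E2] := sample_coord i mS.
  have mJ n : (1 <= n <= S)%N ->
      measurable_fun setT (fun t : g_sigma_algebraType (sample_events false (J n)) => V n t 0 i).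
    move=> nS.
    have mp : measurable_fun setT (fun t : g_sigma_algebraType
        (sample_events false (J n)) => (z k n t, y k n t)).
      apply: measurable_fun_pair.
        by apply: measurable_sample_z => //; exact: eqxx.
      by apply: measurable_sample_y => //; exact: eqxx.
    exact: (measurableT_comp (measurable_approx_gradient mG x i) mp).
  rewrite expr2 -{1}E1 -E2.
  apply: (indep_RintegralM (C1 := sample_events false (J l))
    (C2 := sample_events false (J m))) => //.
  - exact: measurable_sample_events.
  - exact: measurable_sample_events.
  - exact: sample_events_setI.
  - exact: sample_events_setI.
  - exact: sample_events_setT.
  - exact: sample_events_setT.
  - move=> A B; apply: sample_events_indep => // k' l' b.
    by rewrite /J; apply/negP => /andP[/eqP -> /eqP E]; rewrite E eqxx in lm.
  - exact: mJ.
  - exact: mJ.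
split; first by apply: integrable_real_sum => i; have [] := I i.
rewrite Rintegral_sum; last by move=> i; have [] := I i.
by rewrite enorm2; apply: eq_bigr => i _; have [_ ->] := I i.
Qed.

Let W (l : 'I_S) := V l.+1.

Let lS (l : 'I_S) : (1 <= l.+1 <= S)%N.
Proof. by rewrite ltn_ord. Qed.

Let mean_sum : Pr.-integrable setT (EFin \o (fun t => dotprod (g x) (\sum_l W l t))) /\
  \int[Pr]_t dotprod (g x) (\sum_l W l t) = S%:R * enorm (g x) ^+ 2.
Proof.
have E t : dotprod (g x) (\sum_l W l t) = \sum_l \sum_i g x 0 i * W l t 0 i.
  by rewrite dotprodC dotprod_suml; apply: eq_bigr => l _; rewrite dotprodC.
have I l i : Pr.-integrable setT (EFin \o (fun t => g x 0 i * W l t 0 i)).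
  by have [I _] := sample_coord i (lS l); have := integrableZl measurableT (g x 0 i) I.
have I2 l : Pr.-integrable setT (EFin \o (fun t => \sum_i g x 0 i * W l t 0 i)).
  by apply: integrable_real_sum => i; exact: I.
split; first by under eq_fun do rewrite /= E; exact: integrable_real_sum.
under eq_Rintegral do rewrite E.
rewrite Rintegral_sum// -[S in RHS]card_ord mulr_natl -sumr_const; apply: eq_bigr => l _.
rewrite Rintegral_sum// enorm2; apply: eq_bigr => i _.
by have [Ii Ei] := sample_coord i (lS l); rewrite RintegralZl// Ei.
Qed.

(** Of the S^2 products only the S diagonal ones see Q. Each of them is bounded by |g(x)|^2 + Q,
    which completes the double sum of |g(x)|^2; after division by S^2 the noise is Q / S. *)
Let second_moment_sum : Pr.-integrable setT (EFin \o (fun t => enorm (\sum_l W l t) ^+ 2)) /\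
  \int[Pr]_t (enorm (\sum_l W l t) ^+ 2) <= S%:R ^+ 2 * enorm (g x) ^+ 2 + S%:R * Q.
Proof.
have E t : enorm (\sum_l W l t) ^+ 2 = \sum_l \sum_m dotprod (W l t) (W m t).
  rewrite enorm2 dotprod_suml; apply: eq_bigr => l _.
  by rewrite dotprodC dotprod_suml; apply: eq_bigr => m _; rewrite dotprodC.
have I l m : Pr.-integrable setT (EFin \o (fun t => dotprod (W l t) (W m t))) /\
    \int[Pr]_t dotprod (W l t) (W m t) <= enorm (g x) ^+ 2 + (l == m)%:R * Q.
  have [->|lm] := eqVneq l m.
    have [I1 H1] := sample_second_moment (lS m).
    split; first by under eq_fun do rewrite /= -enorm2; exact: I1.
    under eq_Rintegral do rewrite -enorm2.
    by rewrite mul1r (le_trans H1)// lerDr sqr_ge0.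
  have [//|I1 ->] := sample_cross_moment (lS l) (lS m).
  by rewrite mul0r addr0.
have I1 l m := (I l m).1.
have I2 l : Pr.-integrable setT (EFin \o (fun t => \sum_m dotprod (W l t) (W m t))).
  exact: integrable_real_sum.
split; first by under eq_fun do rewrite /= E; exact: integrable_real_sum.
under eq_Rintegral do rewrite E.
rewrite Rintegral_sum//.
apply: (@le_trans _ _ (\sum_(l < S) (S%:R * enorm (g x) ^+ 2 + Q))).
  apply: ler_sum => l _; rewrite Rintegral_sum//.
  rewrite (le_trans (ler_sum _ (fun m _ => (I l m).2)))// big_split/= sumr_const card_ord mulr_natl.
  rewrite lerD2l (bigD1 l)//= eqxx mul1r big1 ?addr0// => m /negPf; rewrite eq_sym => ->.
  by rewrite mul0r.
rewrite sumr_const card_ord -[_ *+ S]mulr_natl le_eqVlt; apply/orP; left; apply/eqP.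
by set a := enorm _ ^+ 2; set s : R := S%:R; ring.
Qed.

(** With L1 eta = 1 the descent inequality leaves - eta |g|^2 + (eta / 2) |g|^2 and the noise eta Q
    / (2 S). Subtracting the lower bound m makes the integrand nonnegative, so that Tonelli's
    theorem can be used afterwards. *)
Lemma step_integral (eta m : R) : 0 < eta -> (0 < S)%N -> (forall w, m <= fs w) ->
  L0 * Num.sqrt d%:R / rho * eta = 1 ->
  (\int[Pr]_t (fs (x - (eta / S%:R) *: \sum_(1 <= l < S.+1) G (x + z k l t, y k l t)) - m)%:E +
   (eta / 2 * enorm (g x) ^+ 2)%:E <= (fs x - m + eta * Q / (2 * S%:R))%:E)%E.
Proof.
move=> eta0 S0 mfs L1eta.
have S0' : 0 < S%:R :> R by rewrite ltr0n.
have [I1 E1] := mean_sum; have [I2 E2] := second_moment_sum.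
pose c := eta / S%:R; pose L1 := L0 * Num.sqrt d%:R / rho.
have c0 : 0 < c by rewrite divr_gt0.
have L10 : 0 < L1.
  rewrite lt_neqAle divr_ge0 ?mulr_ge0 ?sqrtr_ge0 ?(lipschitz_e_ge0 d0 fL) ?(ltW rho0)// andbT.
  by apply/eqP => L10; move: L1eta; rewrite -/L1 -L10 mul0r => /eqP; rewrite eq_sym oner_eq0.
pose up t := (fs x - m) + (- c) * dotprod (g x) (\sum_l W l t) +
  L1 / 2 * c ^+ 2 * enorm (\sum_l W l t) ^+ 2.
have Ic : Pr.-integrable setT (EFin \o cst (fs x - m)) by exact: probability_integrable_cst.
have Ia : Pr.-integrable setT (EFin \o (fun t => (- c) * dotprod (g x) (\sum_l W l t))).
  by have := integrableZl measurableT (- c) I1.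
have Ib : Pr.-integrable setT (EFin \o (fun t => L1 / 2 * c ^+ 2 * enorm (\sum_l W l t) ^+ 2)).
  by have := integrableZl measurableT (L1 / 2 * c ^+ 2) I2.
have Iab : Pr.-integrable setT (EFin \o (fun t => (fs x - m) + (- c) * dotprod (g x) (\sum_l W l t))).
  by have := integrableD measurableT Ic Ia.
have Iup : Pr.-integrable setT (EFin \o up) by have := integrableD measurableT Iab Ib.
have upE : \int[Pr]_t up t <= fs x - m - eta / 2 * enorm (g x) ^+ 2 + eta * Q / (2 * S%:R).
  have -> : \int[Pr]_t up t = (fs x - m) + (- c) * (S%:R * enorm (g x) ^+ 2) +
      L1 / 2 * c ^+ 2 * \int[Pr]_t (enorm (\sum_l W l t) ^+ 2).
    rewrite -E1 -RintegralZl// -RintegralZl// -[X in X + _ + _](Rintegral_cstT Pr).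
    by rewrite -RintegralD// -RintegralD.
  have : L1 / 2 * c ^+ 2 * \int[Pr]_t (enorm (\sum_l W l t) ^+ 2) <=
      L1 / 2 * c ^+ 2 * (S%:R ^+ 2 * enorm (g x) ^+ 2 + S%:R * Q).
    by rewrite ler_wpM2l// mulr_ge0 ?sqr_ge0// divr_ge0// ltW.
  rewrite (_ : L1 / 2 * c ^+ 2 * (_ + _) = (L1 * eta) * eta / 2 * enorm (g x) ^+ 2 +
    (L1 * eta) * (eta * Q / (2 * S%:R))); last by rewrite /c; field; rewrite gt_eqF.
  rewrite L1eta !mul1r (_ : - c * _ = - eta * enorm (g x) ^+ 2); last first.
    by rewrite /c; field; rewrite gt_eqF.
  by lra.
have Eup : (\int[Pr]_t (up t)%:E = (\int[Pr]_t up t)%:E)%E.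
  by rewrite /Rintegral fineK//; exact: integrable_fin_num.
apply: (@le_trans _ _ (\int[Pr]_t (up t)%:E + (eta / 2 * enorm (g x) ^+ 2)%:E)%E); last first.
  by rewrite Eup -EFinD lee_fin; move: upE; lra.
rewrite leeD2r//.
have lfs := lipschitz_smooth rho0 d0 fL.
have mfsX : measurable_fun setT
    (fun t => fs (x - (eta / S%:R) *: \sum_(1 <= l < S.+1) G (x + z k l t, y k l t)) - m).
  apply: measurable_funB => //; apply: (measurableT_comp (lipschitz_e_measurable lfs)).
  exact: (measurable_pisgd_step eta mG (measurable_cst x) (z := fun l => z k l) (y := fun l => y k l)).
apply: ge0_le_integral => //.
- by move=> t _; rewrite lee_fin subr_ge0.
- exact/measurable_EFinP.
- exact: measurable_int Iup.
- move=> t _; rewrite lee_fin.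
  rewrite big_add1 big_mkord -/c.
  have := smooth_gradient_descent rho0 d0 cF.1 cF.2 lipF intC intF mG hG.2 fL x (- (c *: \sum_l W l t)).
  rewrite dotprodNr dotprodZr enormN enormZ (gtr0_norm c0) -/L1 /up /W /V.
  rewrite exprMn.
  by lra.
Qed.

End moments.
Variables (eta m : R) (x1 : 'rV[R]_d).
Hypotheses (eta0 : 0 < eta) (S0 : (0 < S)%N) (mfs : forall w, m <= fs w).
Hypothesis L1eta : L0 * Num.sqrt d%:R / rho * eta = 1.

Let X k t := pisgd_iterate eta S G x1 (fun k l => z k l t) (fun k l => y k l t) k.

Let lfs : lipschitz_e fs L0.
Proof. exact: lipschitz_smooth. Qed.

Lemma measurable_X k : measurable_fun setT (X k).
Proof.
exact: (measurable_pisgd_iterate eta mG x1 (z := fun k l => z k l) (y := fun k l => y k l)).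
Qed.

(** Past and present live on separate spaces A and B, so that the product of two different
    sub-sigma-algebras is covered as well. *)
Let measurable_gap dA dB (A : measurableType dA) (B : measurableType dB) (x : A -> 'rV[R]_d)
  (zz : nat -> B -> 'rV[R]_d) (yy : nat -> B -> 'rV[R]_p) :
  measurable_fun setT x ->
  (forall l, (1 <= l <= S)%N -> measurable_fun setT (zz l)) ->
  (forall l, (1 <= l <= S)%N -> measurable_fun setT (yy l)) ->
  measurable_fun setT (fun u : A * B => (fs (x u.1 - (eta / S%:R) *:
    \sum_(1 <= l < S.+1) G (x u.1 + zz l u.2, yy l u.2)) - m)%:E).
Proof.
move=> mx mz my; apply/measurable_EFinP; apply: measurable_funB => //.
apply: (measurableT_comp (lipschitz_e_measurable lfs)).
apply: (measurable_pisgd_step eta mG (x := fun u : A * B => x u.1)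
  (z := fun l (u : A * B) => zz l u.2) (y := fun l (u : A * B) => yy l u.2)).
- exact: measurableT_comp.
- by move=> l lS; apply: measurableT_comp => //; exact: mz.
- by move=> l lS; apply: measurableT_comp => //; exact: my.
Qed.

Let measurable_sqr_g : measurable_fun setT (fun x => eta / 2 * enorm (g x) ^+ 2).
Proof.
apply: measurable_funM => //; apply: measurable_funX.
apply: (measurableT_comp measurable_enorm).
exact: (measurable_smooth_gradient rho0 d0 cF.1 cF.2 lipF intC intF mG hG.2 fL).
Qed.

Let sqr_g_ge0 x : (0 <= (eta / 2 * enorm (g x) ^+ 2)%:E)%E.
Proof. by rewrite lee_fin mulr_ge0 ?sqr_ge0// divr_ge0// ltW. Qed.

Let noise_ge0 : 0 <= eta * Q / (2 * S%:R).
Proof.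
rewrite divr_ge0// mulr_ge0 ?(ltW eta0)// -lee_fin -C2.
by apply: integral_ge0 => u _; rewrite lee_fin sqr_ge0.
Qed.

Let E k := (\int[Pr]_t (fs (X k t) - m)%:E)%E.
Let N k := (\int[Pr]_t (eta / 2 * enorm (g (X k t)) ^+ 2)%:E)%E.

(** After decoupling, the iterate is frozen while the new batch is integrated, and [step_integral]
    applies at that fixed point. *)
Lemma expected_step k : (k.+1 < K)%N -> (E k.+1 + N k <= E k + (eta * Q / (2 * S%:R))%:E)%E.
Proof.
move=> kK; have kK' : (1 <= k.+1 < K)%N by [].
pose Phi t t' := (fs (X k t - (eta / S%:R) *:
  \sum_(1 <= l < S.+1) G (X k t + z k.+1 l t', y k.+1 l t')) - m)%:E.
have Phi0 t t' : (0 <= Phi t t')%E by rewrite lee_fin subr_ge0.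
have mXk := measurable_X k.
have mPhi : measurable_fun setT (fun u : T * T => Phi u.1 u.2).
  exact: (measurable_gap mXk (zz := fun l => z k.+1 l) (yy := fun l => y k.+1 l)).
(* [X k] uses the rounds up to k, since it is the iterate of index k + 1; the next step uses round k
   + 1 only. *)
pose J1 (k' l : nat) (b : bool) := (k' <= k)%N.
pose J2 (k' l : nat) (b : bool) := (k' == k.+1)%N.
have -> : E k.+1 = (\int[Pr]_t \int[Pr]_t' Phi t t')%E.
  apply: (sample_ge0_integral_indep (jr := false) (J := J1) (jr' := false) (J' := J2)
    (Phi := Phi)) => //.
  - by move=> k' l' b; apply/negP => /andP[h /eqP kk]; move: h; rewrite /J1 kk ltnn.
  - apply: (@measurable_gap _ _ (g_sigma_algebraType (sample_events false J1))
      (g_sigma_algebraType (sample_events false J2)) (X k)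
      (fun l => z k.+1 l) (fun l => y k.+1 l)).
    + apply: (@measurable_pisgd_iterate R d p _
        (g_sigma_algebraType (sample_events false J1)) G S eta mG x1
        (fun k l => z k l) (fun k l => y k l)) => k' l /andP[k'0 k'k] lS.
        apply: measurable_sample_z => //.
        by rewrite k'0 (leq_ltn_trans k'k)// ltnW.
      apply: measurable_sample_y => //.
      by rewrite k'0 (leq_ltn_trans k'k)// ltnW.
    + by move=> l lS; apply: measurable_sample_z => //; exact: eqxx.
    + by move=> l lS; apply: measurable_sample_y => //; exact: eqxx.
have mN : measurable_fun setT (fun t => (eta / 2 * enorm (g (X k t)) ^+ 2)%:E).
  by apply/measurable_EFinP; exact: (measurableT_comp measurable_sqr_g mXk).
have mI : measurable_fun setT (fun t => \int[Pr]_t' Phi t t')%E.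
  rewrite -[X in measurable_fun _ X]/(fubini_F Pr (fun u : T * T => Phi u.1 u.2)).
  exact: measurable_fun_fubini_tonelli_F.
have N0 t : (0 <= (eta / 2 * enorm (g (X k t)) ^+ 2)%:E)%E.
  exact: sqr_g_ge0.
have I0 t : (0 <= \int[Pr]_t' Phi t t')%E by exact: integral_ge0.
have mE : measurable_fun setT (fun t => (fs (X k t) - m)%:E).
  apply/measurable_EFinP; apply: measurable_funB => //.
  exact: (measurableT_comp (lipschitz_e_measurable lfs) mXk).
have H t := step_integral (X k t) kK' eta0 S0 mfs L1eta.
have e0 t : (0 <= (fs (X k t) - m)%:E)%E by rewrite lee_fin subr_ge0.
exact: (@integralD_le_cst _ _ _ Pr _ _ _ (eta * Q / (2 * S%:R)) mI mN mE I0 N0 e0 noise_ge0 H).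
Qed.

Lemma expected_steps k : (k < K)%N ->
  (E k + \sum_(i < k) N i <= (fs x1 - m + k%:R * (eta * Q / (2 * S%:R)))%:E)%E.
Proof.
elim: k => [|k IH] kK.
  rewrite big_ord0 adde0 mul0r addr0 /E /X/=.
  by rewrite integral_cst// [X in (_ * X)%E]probability_setT mule1.
have -> : \sum_(i < k.+1) N i = (\sum_(i < k) N i + N k)%E by rewrite big_ord_recr.
rewrite (_ : (fs x1 - m + k.+1%:R * (eta * Q / (2 * S%:R))) =
  (fs x1 - m + k%:R * (eta * Q / (2 * S%:R))) + eta * Q / (2 * S%:R)).
  by apply: (telescope_step (expected_step kK)); apply: IH; exact: ltnW.
by rewrite -natr1 mulrDl mul1r addrA.
Qed.

(** A step along the exact gradient lowers fs by at least (eta / 2) |g|^2 and cannot go below m. *)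
Lemma sqr_smooth_gradient_le x : eta / 2 * enorm (g x) ^+ 2 <= fs x - m.
Proof.
have := smooth_gradient_descent rho0 d0 cF.1 cF.2 lipF intC intF mG hG.2 fL x (- (eta *: g x)).
rewrite dotprodNr dotprodZr enormN enormZ (gtr0_norm eta0) -enorm2 exprMn.
have := mfs (x - eta *: g x); set a := fs x; set b := fs _; set n2 := enorm _ ^+ 2.
rewrite (_ : _ / 2 * (eta ^+ 2 * n2) = (L0 * Num.sqrt d%:R / rho * eta) * (eta / 2 * n2)).
  by rewrite L1eta mul1r; lra.
by ring.
Qed.

Hypothesis K0 : (0 < K)%N.

(** There are K gradient terms but only K - 1 steps. The last term has no step to pay for it; the
    remaining gap [E K'] does so by [sqr_smooth_gradient_le]. *)
Lemma expected_sum_le :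
  (\sum_(k < K) N k <= (fs x1 - m + K%:R * (eta * Q / (2 * S%:R)))%:E)%E.
Proof.
case: K K0 sampling expected_steps => // K' _ _ H.
have NE : (N K' <= E K')%E.
  apply: ge0_le_integral => //.
  - by apply/measurable_EFinP; exact: (measurableT_comp measurable_sqr_g (measurable_X K')).
  - apply/measurable_EFinP; apply: measurable_funB => //.
    exact: (measurableT_comp (lipschitz_e_measurable lfs) (measurable_X K')).
  - by move=> t _; rewrite lee_fin sqr_smooth_gradient_le.
have -> : \sum_(i < K'.+1) N i = (N K' + \sum_(i < K') N i)%E by rewrite big_ord_recr addeC.
apply: (le_trans (leeD NE (lexx _))); apply: (le_trans (H K' (ltnSn _))).
by rewrite lee_fin lerD2l ler_wpM2r ?ler_nat// noise_ge0.
Qed.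

Local Notation W := (pisgd_output eta S G x1 r z y).

Lemma measurable_pisgd_output : measurable_fun setT W.
Proof.
exact: (measurable_random_index measurable_X).
Qed.

Lemma expected_sqr_output : (\int[Pr]_t (eta / 2 * enorm (g (W t)) ^+ 2)%:E <=
  ((fs x1 - m + K%:R * (eta * Q / (2 * S%:R))) / K%:R)%:E)%E.
Proof.
have m2 : measurable_fun setT (fun x => (eta / 2 * enorm (g x) ^+ 2)%:E).
  exact/measurable_EFinP.
rewrite [leLHS](index_integral K0
  (psi := fun k t => (eta / 2 * enorm (g (X k t)) ^+ 2)%:E)).
- rewrite [X in (_ <= X%:E)%E]mulrC EFinM; apply: lee_wpmul2l; first by rewrite lee_fin invr_ge0.
  exact: expected_sum_le.
- by move=> k t; exact: sqr_g_ge0.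
- by move=> k; apply: (measurableT_comp m2); exact: measurable_X.
- move=> k kK; apply: (measurableT_comp m2).
  apply: (@measurable_pisgd_iterate R d p _
    (g_sigma_algebraType (sample_events false (fun _ _ _ => true))) G S eta mG x1
    (fun k l => z k l) (fun k l => y k l)) => k' l /andP[k'0 k'k] lS.
    by apply: measurable_sample_z => //; rewrite k'0 (leq_ltn_trans k'k).
  by apply: measurable_sample_y => //; rewrite k'0 (leq_ltn_trans k'k).
Qed.

Lemma pisgd_stationary (e1 e2 : R) : rho <= e1 -> 0 < e2 ->
  2 * (fs x1 - m + K%:R * (eta * Q / (2 * S%:R))) / (eta * K%:R) <= e2 ^+ 2 ->
  expected_stationary Pr f e1 e2 W.
Proof.
move=> rhoe e20 He2; have mW := measurable_pisgd_output.
have md : measurable_fun setT (fun t => dist0 (clarke_eps e1 f (W t))).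
  exact: (measurableT_comp (measurable_dist0_clarke_eps d0 fL e1) mW).
split => //.
have dist_ge0 A : (0 <= @dist0 R d A)%E.
  by apply: le_ereal_inf_tmp => _ [u _ <-]; rewrite lee_fin enorm_ge0.
have K0' : 0 < K%:R :> R by rewrite ltr0n.
have c0 : 0 <= (eta * e2)^-1 by rewrite invr_ge0 mulr_ge0// ltW.
have m2 : measurable_fun setT (fun t => (eta / 2 * enorm (g (W t)) ^+ 2)%:E).
  by apply/measurable_EFinP; exact: (measurableT_comp measurable_sqr_g mW).
(* Instead of Jensen's inequality: |g| <= |g|^2 / (2 e2) + e2 / 2, so that a second moment of at
   most e2^2 bounds the mean by e2. *)
apply: (@le_trans _ _ (\int[Pr]_t (((eta * e2)^-1)%:E * (eta / 2 * enorm (g (W t)) ^+ 2)%:E +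
    (cst (e2 / 2)%:E t)))%E).
  apply: ge0_le_integral => //.
  - by apply: emeasurable_funD => //; apply: emeasurable_funM.
  - move=> t _; apply: (@le_trans _ _ (enorm (g (W t)))%:E).
      apply: (dist0_clarke_eps_le d0 rho0 fL rhoe) => h.
      exact: (smooth_diff_quotient_cvg rho0 d0 cF.1 cF.2 lipF intC intF mG hG.2 fL).
    rewrite -EFinM -EFinD lee_fin; set a := enorm _.
    have := sqr_ge0 (a - e2); rewrite sqrrB => H.
    have -> : (eta * e2)^-1 * (eta / 2 * a ^+ 2) = a ^+ 2 / (2 * e2).
      by field; rewrite !gt_eqF.
    rewrite -lerBlDr ler_pdivlMr ?mulr_gt0//.
    by move: H; lra.
rewrite ge0_integralD//; first last.
- by move=> t _; rewrite /= lee_fin divr_ge0// ltW.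
- by apply: emeasurable_funM.
- by move=> t _; apply: mule_ge0 (sqr_g_ge0 _); rewrite lee_fin.
rewrite integral_cst// [X in (_ + _ * X)%E]probability_setT mule1.
rewrite ge0_integralZl_EFin//.
apply: (@le_trans _ _ (((eta * e2)^-1)%:E *
  ((fs x1 - m + K%:R * (eta * Q / (2 * S%:R))) / K%:R)%:E + (e2 / 2)%:E)%E).
  by apply: leeD => //; rewrite lee_wpmul2l ?lee_fin//; exact: expected_sqr_output.
rewrite -EFinM -EFinD lee_fin; move: He2; set B := _ + _ => He2.
have -> : (eta * e2)^-1 * (B / K%:R) = 2 * B / (eta * K%:R) / (2 * e2).
  by field; rewrite !gt_eqF.
rewrite -lerBrDr ler_pdivrMr ?mulr_gt0//.
by rewrite (le_trans He2)// expr2; lra.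
Qed.

End pisgd.

(** * The choice of K and the number of gradient calls *)

Section parameter_choice.
Context {R : realType}.
Variables (beta : R).
Hypothesis hbeta : 0 < beta < 1.

Let b0 : 0 < beta. Proof. by case/andP: hbeta. Qed.
Let b1 : 0 < 1 - beta. Proof. by rewrite subr_gt0; case/andP: hbeta. Qed.

Lemma batch_size_ge K : K%:R `^ (1 - beta) <= (batch_size beta K)%:R :> R.
Proof.
rewrite /batch_size natr_absz ger0_norm ?ceil_ge//.
by rewrite -(ler_int R) (le_trans _ (ceil_ge _))// powR_ge0.
Qed.

Lemma batch_size_le K : (batch_size beta K)%:R <= K%:R `^ (1 - beta) + 1 :> R.
Proof.
rewrite /batch_size natr_absz ger0_norm.
  by have := ceilB1_lt (K%:R `^ (1 - beta) : R); rewrite intrB ltrBlDr => /ltW.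
by rewrite -(ler_int R) (le_trans _ (ceil_ge _))// powR_ge0.
Qed.

Lemma iteration_count (u v : R) : 0 < u -> 0 < v -> exists2 c : R, 0 < c &
  forall e1 e2 : R, 0 < e1 < 1 -> 0 < e2 < 1 -> exists K : nat, [/\ (0 < K)%N,
    (gradient_calls beta K)%:R <=
      c * Num.max (e1 `^ ((beta - 2) / beta)) (e2 `^ (- 2 * ((2 - beta) / (1 - beta)))),
    u * K%:R `^ (- beta) <= e1 & v * K%:R `^ (beta - 1) <= e2 ^+ 2].
Proof.
move=> u0 v0.
have one (s : R) : 1 `^ s = 1 :> R by rewrite powR1.
have bn0 : beta != 0 by rewrite gt_eqF.
have bn1 : 1 - beta != 0 by rewrite gt_eqF.
(* The two powers solve the two conditions on K for u and v; the 1 ensures [1 <= a], which absorbs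
   rounding. *)
pose a := 1 + u `^ beta^-1 + v `^ (1 - beta)^-1.
have a1 : 1 <= a by rewrite /a -addrA lerDl addr_ge0// powR_ge0.
have a0 : 0 < a by rewrite (lt_le_trans ltr01).
(* The number of calls is at most a M times K^(1 - beta) + 1, hence at most a M times 2 (2 a M)^(1 -
   beta), which is (2 a M)^(2 - beta). *)
exists ((2 * a) `^ (2 - beta)); first by rewrite powR_gt0// mulr_gt0.
move=> e1 e2 /andP[e10 e11] /andP[e20 e21].
pose p1 := e1 `^ (- beta^-1); pose p2 := e2 `^ (- 2 / (1 - beta)).
pose M := Num.max p1 p2.
have M1 : 1 <= M.
  rewrite le_max; apply/orP; left; rewrite /p1 powRN invf_ge1 ?powR_gt0//.
  rewrite -[leRHS](one beta^-1) ge0_ler_powR ?nnegrE ?invr_ge0 ?(ltW b0)//.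
    exact: ltW.
  exact: ltW.
have M0 : 0 < M by rewrite (lt_le_trans ltr01).
have aM1 : 1 <= a * M by rewrite mulr_ege1.
have aM0 : 0 < a * M by rewrite mulr_gt0.
(* Then K - 1 <= a M < K: the upper bound on K - 1 serves the count of calls, the lower bound on K
   the two accuracy conditions. *)
exists (Num.trunc (a * M)).+1; set K := (Num.trunc (a * M)).+1.
have /andP[KaM aMK] := truncn_itv (ltW aM0).
have K0 : 0 < K%:R :> R by rewrite ltr0n.
have K2 : K%:R <= 2 * (a * M).
  by rewrite /K -natr1; move: KaM aM1; set x := _%:R; lra.
split => //.
- rewrite natrM /=.
  apply: (@le_trans _ _ (a * M * (2 * (2 * (a * M)) `^ (1 - beta)))).
    apply: ler_pM => //; apply: (le_trans (batch_size_le K)).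
    have h1 : K%:R `^ (1 - beta) <= (2 * (a * M)) `^ (1 - beta).
      by apply: ge0_ler_powR; rewrite ?nnegrE ?(ltW b1)// mulr_ge0// ltW.
    have h2 : 1 <= (2 * (a * M)) `^ (1 - beta).
      rewrite -[leLHS](one (1 - beta)); apply: ge0_ler_powR; rewrite ?nnegrE ?(ltW b1)//.
        by rewrite mulr_ge0// ltW.
      by move: aM1; lra.
    by move: h1 h2; lra.
  rewrite [leLHS](_ : _ = (2 * (a * M)) `^ (2 - beta)); last first.
    rewrite (_ : 2 - beta = 1 + (1 - beta)); last by ring.
    rewrite [RHS]powRD; last by rewrite mulf_neq0 ?implybT// gt_eqF.
    have -> : (2 * (a * M)) `^ 1 = 2 * (a * M) by rewrite powRr1// mulr_ge0// ltW.
    by rewrite mulrA [a * M * 2]mulrC.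
  rewrite mulrA powRM ?mulr_ge0 ?(ltW a0) ?(ltW M0)// ler_wpM2l ?powR_ge0//.
  have E1 : p1 `^ (2 - beta) = e1 `^ ((beta - 2) / beta).
    by rewrite -powRrM; congr (_ `^ _); field.
  have E2 : p2 `^ (2 - beta) = e2 `^ (- 2 * ((2 - beta) / (1 - beta))).
    by rewrite -powRrM; congr (_ `^ _); field.
  by rewrite -E1 -E2 le_max /M maxEle; case: ifP => _; apply/orP; [right|left].
- rewrite powRN ler_pdivrMr ?powR_gt0// -ler_pdivrMl//.
  rewrite [leLHS](_ : _ = (u `^ beta^-1 * p1) `^ beta); last first.
    rewrite powRM ?powR_ge0// -!powRrM mulVf// mulNr mulVf// powRr1 ?(ltW u0)//.
    by rewrite powR_inv1 ?(ltW e10)// mulrC.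
  apply: ge0_ler_powR; rewrite ?nnegrE ?(ltW b0) ?mulr_ge0 ?powR_ge0//.
  apply: le_trans (ltW aMK); apply: ler_pM; rewrite ?powR_ge0//.
    by rewrite /a addrAC lerDr addr_ge0// powR_ge0.
  by rewrite /M le_max lexx.
- rewrite (_ : beta - 1 = - (1 - beta)); last by ring.
  rewrite powRN ler_pdivrMr ?powR_gt0// -ler_pdivrMl ?exprn_gt0//.
  rewrite [leLHS](_ : _ = (v `^ (1 - beta)^-1 * p2) `^ (1 - beta)); last first.
    rewrite powRM ?powR_ge0// -!powRrM mulVf// mulfVK// powRr1 ?(ltW v0)//.
    by rewrite powR_invn ?(ltW e20)// mulrC.
  apply: ge0_ler_powR; rewrite ?nnegrE ?(ltW b1) ?mulr_ge0 ?powR_ge0//.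
  apply: le_trans (ltW aMK); apply: ler_pM; rewrite ?powR_ge0//.
    by rewrite /a lerDr addr_ge0// powR_ge0.
  by rewrite /M le_max lexx orbT.
Qed.

End parameter_choice.

(** * The complexity bound *)

Theorem corollary8 (R : realType) (d : nat) (beta theta L0 Delta Q : R)
    (hd : (0 < d)%N) (hbeta : 0 < beta < 1) (htheta : 0 < theta)
    (hL0 : 0 < L0) :
  exists c delta : R, [/\ 0 < c, 0 < delta &
  forall (p : nat)
    (dO : measure_display) (Omega : measurableType dO)
    (P : probability Omega R) (xi : {RV P >-> 'rV[R]_p})
    (F : 'rV[R]_d -> 'rV[R]_p -> R) (C : 'rV[R]_p -> R)
    (G : 'rV[R]_d * 'rV[R]_p -> 'rV[R]_d) (x1 xstar : 'rV[R]_d),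
  caratheodory F ->
  measurable_fun setT C ->
  {ae distribution P xi, forall y, lipschitz_e (F ^~ y) (C y)} ->
  ('E_P[fun t => (C (xi t) ^+ 2)%R] = Q%:E)%E ->
  ('E_P[fun t => C (xi t)] = L0%:E)%E ->
  (forall w, P.-integrable setT (fun t => (F w (xi t))%:E)) ->
  lipschitz_e (objective P xi F) L0 ->
  (forall w, objective P xi F xstar <= objective P xi F w) ->
  Delta = objective P xi F x1 - objective P xi F xstar ->
  approx_gradient (distribution P xi) F G ->
  forall e1 e2 : R, 0 < e1 < delta -> 0 < e2 < delta ->
  exists K : nat, [/\ (0 < K)%N,
    (gradient_calls beta K)%:R <=
      c * Num.max (e1 `^ ((beta - 2) / beta))
                  (e2 `^ (- 2 * ((2 - beta) / (1 - beta)))) &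
  forall (dT : measure_display) (T : measurableType dT)
    (Pr : probability T R) (r : {RV Pr >-> nat})
    (z : nat -> nat -> {RV Pr >-> 'rV[R]_d})
    (y : nat -> nat -> {RV Pr >-> 'rV[R]_p}),
  pisgd_sampling (distribution P xi) K (batch_size beta K)
    (ball_radius beta theta K d) r z y ->
  expected_stationary Pr (objective P xi F) e1 e2
    (pisgd_output (step_size beta theta K L0) (batch_size beta K) G x1 r z y)]].
Proof.
have sd0 : 0 < Num.sqrt d%:R :> R by rewrite sqrtr_gt0 ltr0n.
pose u := theta * Num.sqrt d%:R; have u0 : 0 < u by rewrite mulr_gt0.
(* [u * K^(- beta)] is the smoothing radius, and [v * K^(beta - 1)] bounds twice the averaged
   energy. The absolute values keep [v] positive for arbitrary reals [Delta] and [Q], which are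
   fixed before any problem is given. *)
pose v := 2 * (`|Delta| + L0 * u) * L0 / theta + `|Q|.
have v0 : 0 < v.
  by rewrite /v ltr_wpDr// divr_gt0// !mulr_gt0// ltr_wpDl// mulr_gt0.
have [c c0 Hc] := iteration_count hbeta u0 v0.
exists c, 1; split => // p dO Omega P xi F C G x1 xstar cF mC lipF EC2 EC intF fL fmin DE hG.
move=> e1 e2 e1d e2d; have [K [K0 Kc Ke1 Ke2]] := Hc e1 e2 e1d e2d.
exists K; split => // dT T Pr r z y sampling.
pose Pxi : probability 'rV[R]_p R := distribution P xi.
have C2 : (\int[Pxi]_y (C y ^+ 2)%:E = Q%:E)%E.
  rewrite ge0_integral_distribution//; first by rewrite -EC2 unlock.
  - by apply/measurable_EFinP; exact: measurable_funX.
  - by move=> w; rewrite lee_fin sqr_ge0.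
(* From |C| <= 1 + C^2 the finite second moment gives the integrability of [C], the dominating
   function later on. *)
have IC2 : Pxi.-integrable setT (EFin \o (fun w => 1 + C w ^+ 2)).
  have I2 : Pxi.-integrable setT (EFin \o (fun w => C w ^+ 2)).
    apply/integrableP; split; first by apply/measurable_EFinP; exact: measurable_funX.
    under eq_integral do rewrite /= ger0_norm ?sqr_ge0//.
    by rewrite C2 ltry.
  by have := integrableD measurableT (probability_integrable_cst Pxi 1) I2.
have intC : Pxi.-integrable setT (EFin \o C).
  apply: (integrable_ae_le mC IC2); apply: aeW => w.
  rewrite -real_normK ?num_real//; have := sqr_ge0 (`|C w| - 1); rewrite sqrrB1.
  by have := normr_ge0 (C w); set a := `|_|; have := sqr_ge0 a; lra.
have intF' w : Pxi.-integrable setT (EFin \o F w).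
  apply/integrableP; split; first by apply/measurable_EFinP; exact: cF.1.
  rewrite ge0_integral_distribution//; first by have /integrableP[] := intF w.
  by apply: measurableT_comp => //; apply/measurable_EFinP; exact: cF.1.
have fE : objective P xi F = fun w => \int[Pxi]_y F w y.
  apply/funext => w; rewrite /objective /Rintegral unlock; congr fine.
  rewrite integral_distribution//; first by apply/measurable_EFinP; exact: cF.1.
  exact: intF.
rewrite fE in fL fmin DE *.
set S := batch_size beta K in sampling *.
set rho := ball_radius beta theta K d in sampling *.
set eta := step_size beta theta K L0.
have K0' : 0 < K%:R :> R by rewrite ltr0n.
pose b := K%:R `^ (- beta) : R; have b0 : 0 < b by rewrite powR_gt0.
have rho0 : 0 < rho by rewrite /rho /ball_radius mulr_gt0.
have eta0 : 0 < eta by rewrite /eta /step_size mulr_gt0// divr_gt0.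
have kb0 : 0 < K%:R `^ (1 - beta) :> R by rewrite powR_gt0.
have Sge := batch_size_ge beta K.
have S0' : 0 < S%:R :> R by exact: lt_le_trans Sge.
have S0 : (0 < S)%N by rewrite ltr0n in S0'.
have L1eta : L0 * Num.sqrt d%:R / rho * eta = 1.
  rewrite /rho /eta /ball_radius /step_size -/b; field.
  by rewrite !gt_eqF.
have mfs w : \int[Pxi]_y F xstar y <= smooth rho (fun w => \int[Pxi]_y F w y) w.
  exact: smooth_ge.
apply: (pisgd_stationary sampling rho0 hd cF lipF intC C2 intF' hG fL eta0 S0 mfs L1eta K0).
- exact: Ke1.
- by case/andP: e2d.
apply: le_trans Ke2.
have bK : b * K%:R = K%:R `^ (1 - beta).
  rewrite -[X in b * X](powRr1 (ltW K0')) -powRD ?(addrC (- beta))//.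
  by apply/implyP => _; rewrite gt_eqF.
have b1 : b <= 1.
  rewrite /b powRN invf_le1 ?powR_gt0//.
  by rewrite -[leLHS](powRr0 K%:R) ler_powR ?ler1n//; case/andP: hbeta => /ltW.
have -> : K%:R `^ (beta - 1) = (b * K%:R)^-1 by rewrite bK -powRN opprB.
have bK0 : 0 < b * K%:R by rewrite mulr_gt0.
(* Smoothing raises the initial value by at most L0 rho, and rho <= u because K^(- beta) <= 1; the
   minimum of f remains a lower bound. *)
set A := smooth rho _ x1 - _.
have A_le : A <= `|Delta| + L0 * u.
  have := smooth_le rho0 hd fL x1; have := ler_norm Delta.
  have : L0 * rho <= L0 * u by rewrite ler_pM2l// ler_piMr// ltW.
  by rewrite DE /A; lra.
(* Optimisation error plus sampling noise. The step size makes the first of order K^(beta - 1), and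
   the batch size S >= K^(1 - beta) is what brings the second to the same order. *)
rewrite (_ : 2 * _ / _ = 2 * A * L0 / theta / (b * K%:R) + Q / S%:R); last first.
  by rewrite /eta /step_size -/b; field; rewrite !gt_eqF.
rewrite /v [leRHS]mulrDl; apply: lerD.
  rewrite ler_wpM2r ?invr_ge0 ?(ltW bK0)// ler_wpM2r ?invr_ge0 ?(ltW htheta)//.
  by rewrite ler_wpM2r ?(ltW hL0)// ler_wpM2l.
apply: (@le_trans _ _ (`|Q| / S%:R)).
  by rewrite ler_wpM2r ?invr_ge0 ?ler_norm// ltW.
by rewrite ler_wpM2l// lef_pV2 ?posrE// bK.
Qed.
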